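(* Let $h>0$. Let $F$ be a function on $\mathbb{R}^{2n}$ and $\nu$ a bounded measure on $\mathbb{R}^{2n}$ such that $F\star\nu$ belongs to $D_h(\mathbb{R}^{2n})$, and therefore has a sesqui-holomorphic extension $(F\star\nu)^{\rm ext}(X,Y)$. Then the equality $${\rm Op}_h^\nu(F)=(2\pi h)^{-2n}\int_{\mathbb{R}^{4n}}\Pi_{Xh}\,(F\star\nu)^{\rm ext}(Y,X)\,\Pi_{Yh}\,dX\,dY$$ defines a bounded operator in $L^2(\mathbb{R}^n)$. Moreover, for all $X\in\mathbb{R}^{2n}$, $$\langle{\rm Op}_h^\nu(F)\Psi_{Xh},\Psi_{Xh}\rangle=(F\star\nu)(X).$$
   Context: The scalar product $\langle\cdot,\cdot\rangle$ of $L^2(\mathbb{R}^n)$ is linear in the first variable. For $X=(x,\xi)\in\mathbb{R}^{2n}$ the coherent state is $\Psi_{Xh}(u)=(\pi h)^{-n/4}e^{-\frac{|u-x|^2}{2h}}e^{\frac ihu\cdot\xi-\frac i{2h}x\cdot\xi}$, and $\Pi_{Xh}f=\langle f,\Psi_{Xh}\rangle\Psi_{Xh}$ is the orthogonal projection on its span. A bounded measure is a finite complex Borel measure; $(F\star\nu)(X)=\int F(X-T)\,d\nu(T)$. Operator-valued integrals are weak integrals. $D_h(\mathbb{R}^{2n})$ is the set of functions $F:\mathbb{R}^{2n}\to\mathbb{C}$ for which there is a real-analytic function $F^{\rm ext}(X,Y)$ on $\mathbb{R}^{2n}\times\mathbb{R}^{2n}$ (the sesqui-holomorphic extension; unique)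 such that, with $X=(x,\xi)$, $Y=(y,\eta)$: (1) $(\partial_{x_j}+i\partial_{\xi_j})F^{\rm ext}=0$ and $(\partial_{y_j}-i\partial_{\eta_j})F^{\rm ext}=0$ for $1\le j\le n$; (2) $F^{\rm ext}(X,X)=F(X)$; (3) there is $\psi_F\in L^1(\mathbb{R}^{2n})\cap L^\infty(\mathbb{R}^{2n})$ with $|F^{\rm ext}(X,Y)|\le e^{\frac1{4h}|X-Y|^2}\psi_F(X-Y)$. *)

(* Defs.v *)
From HB Require Import structures.
From mathcomp Require Import all_boot all_order all_algebra.
From mathcomp Require Import all_classical all_reals all_analysis.
From mathcomp Require Import complex.

Set Implicit Arguments.
Unset Strict Implicit.
Unset Printing Implicit Defensive.

Import Order.TTheory GRing.Theory Num.Theory.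
Import numFieldNormedType.Exports.

Local Open Scope classical_set_scope.
Local Open Scope ring_scope.

(* The sigma-algebra on row vectors is generated by the coordinates; on
   'rV[R]_n it is the Borel sigma-algebra. *)
Section measurable_row.
Context {d : measure_display} {T : measurableType d} (n : nat).

Let coord : 'I_n -> 'rV[T]_n -> T := fun i v => v 0 i.

Let row_set0 : g_sigma_preimage coord set0.
Proof. exact: sigma_algebra0. Qed.

Let row_setC A : g_sigma_preimage coord A -> g_sigma_preimage coord (~` A).
Proof. exact: sigma_algebraC. Qed.

Let row_bigcup (A : (set 'rV[T]_n)^nat) :
  (forall i, g_sigma_preimage coord (A i)) ->
  g_sigma_preimage coord (\bigcup_i A i).
Proof. exact: sigma_algebra_bigcup. Qed.

HB.instance Definition _ := @isMeasurable.Build (measure_tuple_display d)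
  'rV[T]_n (g_sigma_preimage coord) row_set0 row_setC row_bigcup.

End measurable_row.


Lemma measurable_row_coord d (T : measurableType d) n (i : 'I_n) :
  measurable_fun [set: 'rV[T]_n] (fun v : 'rV[T]_n => v 0 i).
Proof.
move=> _ Y mY; rewrite setTI; apply: sub_sigma_algebra => /=.
rewrite -bigcup_seq/=; exists i => /=; first by rewrite mem_index_enum.
by exists Y => //; rewrite setTI.
Qed.

Lemma measurable_fun_rowP d d' (T : measurableType d) (T' : measurableType d')
    n (f : T' -> 'rV[T]_n) :
  (forall i, measurable_fun [set: T'] (fun x => f x 0 i)) ->
  measurable_fun [set: T'] f.
Proof.
move=> mf.
suff : g_sigma_preimage (fun i : 'I_n => (fun v : 'rV[T]_n => v 0 i) \o f)
    `<=` measurable.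
  rewrite g_sigma_preimage_comp => prefS _ A mA.
  by apply: prefS; exists A.
apply: smallest_sub; first exact: sigma_algebra_measurable.
case: n f mf => [|n] f mf; first by rewrite big_ord0.
rewrite -bigcup_mkord_ord; apply: bigcup_sub => i Ii A [B mB <-].
exact: mf.
Qed.

(* In the library this is a canonical instance only for subprobabilities. *)
Lemma sigma_finite_prod d1 d2 (T1 : measurableType d1) (T2 : measurableType d2)
    (R : realType) (m1 : {sigma_finite_measure set T1 -> \bar R})
    (m2 : {sigma_finite_measure set T2 -> \bar R}) :
  sigma_finite setT (m1 \x m2)%E.
Proof.
have /sigma_finiteP[F [TF ndF Foo]] := sigma_finiteT m1.
have /sigma_finiteP[G [TG ndG Goo]] := sigma_finiteT m2.
exists (fun n => F n `*` G n).
  rewrite -setXTT TF TG predeqE => -[x y]; split.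
    move=> [/= [n _ Fnx] [k _ Gky]]; exists (maxn n k) => //; split.
    - by move: x Fnx; exact/subsetPset/ndF/leq_maxl.
    - by move: y Gky; exact/subsetPset/ndG/leq_maxr.
  by move=> [n _ []/= ? ?]; split; exists n.
move=> k; have [? ?] := Foo k; have [? ?] := Goo k.
split; first exact: measurableX.
by rewrite product_measure1E// lte_mul_pinfty// ge0_fin_numE.
Qed.

Section lebesgue_row.
Context {R : realType}.

Definition row_cons n (p : R * 'rV[R]_n) : 'rV[R]_n.+1 :=
  row_mx (const_mx p.1 : 'rV_1) p.2.

Definition row_uncons n (v : 'rV[R]_n.+1) : R * 'rV[R]_n :=
  (v 0 0, rsubmx (v : 'rV_(1 + n))).

Lemma row_consK n : cancel (@row_cons n) (@row_uncons n).
Proof.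
case=> t v; rewrite /row_uncons /row_cons row_mxKr; congr pair => /=.
have -> : (0 : 'I_n.+1) = lshift n (0 : 'I_1) by exact/val_inj.
by rewrite (@row_mxEl _ 1 1 n) mxE.
Qed.

Lemma measurable_row_cons n : measurable_fun
  [set: (measurableTypeR R * 'rV[R]_n)%type] (@row_cons n).
Proof.
apply: measurable_fun_rowP => i.
case: (split_ordP (i : 'I_(1 + n))) => j ->.
  under eq_fun do rewrite (@row_mxEl _ 1 1 n) mxE.
  exact: measurable_fst.
under eq_fun do rewrite (@row_mxEr _ 1 1 n).
exact: measurableT_comp (measurable_row_coord j) measurable_snd.
Qed.

Lemma measurable_row_uncons n : measurable_fun
  setT (@row_uncons n : _ -> (measurableTypeR R * 'rV[R]_n)%type).
Proof.
apply: measurable_fun_pair; first exact: measurable_row_coord.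
apply: measurable_fun_rowP => i; under eq_fun do rewrite mxE.
exact: measurable_row_coord.
Qed.

Section cons.
Context n (mu : {sigma_finite_measure set 'rV[R]_n -> \bar R}).

Definition lebesgue_cons : set 'rV[R]_n.+1 -> \bar R :=
  pushforward (@lebesgue_measure R \x mu)%E (@row_cons n).

Let lebesgue_cons0 : lebesgue_cons set0 = 0%E.
Proof. by rewrite /lebesgue_cons /pushforward preimage_set0 measure0. Qed.

Let lebesgue_cons_ge0 A : (0 <= lebesgue_cons A)%E.
Proof. by apply: integral_ge0 => x _; exact: measure_ge0. Qed.

Let measurable_preimage_cons A : measurable A -> measurable (@row_cons n @^-1` A).
Proof. by move=> mA; rewrite -[X in measurable X]setTI; exact: measurable_row_cons. Qed.

Let lebesgue_cons_sigma_additive : semi_sigma_additive lebesgue_cons.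
Proof.
move=> A mA tA mUA; rewrite /lebesgue_cons /pushforward preimage_bigcup.
apply: measure_semi_sigma_additive.
- by move=> k; exact: measurable_preimage_cons.
- apply/trivIsetP => /= i j _ _ ij; rewrite -preimage_setI.
  by move/trivIsetP : tA => /(_ _ _ _ _ ij) ->//; rewrite preimage_set0.
- by rewrite -preimage_bigcup; exact: measurable_preimage_cons.
Qed.

HB.instance Definition _ := isMeasure.Build _ _ _ lebesgue_cons
  lebesgue_cons0 lebesgue_cons_ge0 lebesgue_cons_sigma_additive.

Let lebesgue_cons_sigma_finite : sigma_finite setT lebesgue_cons.
Proof.
have [A AT Aoo] := sigma_finite_prod (@lebesgue_measure R) mu.
exists (fun k => @row_uncons n @^-1` A k) => [|k].
  by rewrite -preimage_bigcup -AT preimage_setT.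
have [mA Ak] := Aoo k; split.
  by rewrite -[X in measurable X]setTI; exact: measurable_row_uncons.
rewrite /lebesgue_cons /pushforward -comp_preimage.
by rewrite (_ : _ \o _ = id) ?preimage_id//; apply/funext => p /=; rewrite row_consK.
Qed.

HB.instance Definition _ := Measure_isSigmaFinite.Build _ _ _ lebesgue_cons
  lebesgue_cons_sigma_finite.

End cons.

Fixpoint lebesgue_row n : {sigma_finite_measure set 'rV[R]_n -> \bar R} :=
  if n is m.+1 then lebesgue_cons (lebesgue_row m) else \d_(0 : 'rV[R]_0).

End lebesgue_row.


Notation phase R n := ('rV[R]_n * 'rV[R]_n)%type.

Definition lebesgue_phase (R : realType) n : set (phase R n) -> \bar R :=
  (@lebesgue_row R n \x @lebesgue_row R n)%E.

HB.instance Definition _ (R : realType) n := Measure.on (@lebesgue_phase R n).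

HB.instance Definition _ (R : realType) n :=
  Measure_isSigmaFinite.Build _ _ _ (@lebesgue_phase R n)
    (@sigma_finite_prod _ _ _ _ R (lebesgue_row n) (lebesgue_row n)).

Section complex_integral.
Context d (T : measurableType d) (R : realType).
Implicit Types (mu : {measure set T -> \bar R}) (f g : T -> R[i]).

Definition cmeasurable f :=
  measurable_fun setT (fun x => complex.Re (f x)) /\
  measurable_fun setT (fun x => complex.Im (f x)).

Definition cintegrable mu f :=
  mu.-integrable setT (fun x => (complex.Re (f x))%:E) /\
  mu.-integrable setT (fun x => (complex.Im (f x))%:E).

Definition cintegral mu f : R[i] :=
  Complex (\int[mu]_x complex.Re (f x)) (\int[mu]_x complex.Im (f x)).

End complex_integral.

Section complex_measure.
Context d (T : measurableType d) (R : realType).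

Section charge_integral.
Variable nu : {charge set T -> \bar R}.

Let pos_set : set T := projT1 (cid (Hahn_decomposition nu)).
Let neg_set : set T := projT1 (cid (projT2 (cid (Hahn_decomposition nu)))).
Let hahn : hahn_decomposition nu pos_set neg_set :=
  projT2 (cid (projT2 (cid (Hahn_decomposition nu)))).

Definition charge_pos : {finite_measure set T -> \bar R} := jordan_pos hahn.
Definition charge_neg : {finite_measure set T -> \bar R} := jordan_neg hahn.

Definition charge_integrable (f : T -> R) :=
  charge_pos.-integrable setT (EFin \o f) /\
  charge_neg.-integrable setT (EFin \o f).

Definition charge_integral (f : T -> R) : R :=
  \int[charge_pos]_x f x - \int[charge_neg]_x f x.

End charge_integral.

(* Charges take finite values, so that this is the type of finite complex
   measures. *)
Record complex_measure := ComplexMeasure {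
  cm_Re : {charge set T -> \bar R} ;
  cm_Im : {charge set T -> \bar R} }.

(* Integrability with respect to the total variation of nu. *)
Definition cm_integrable (nu : complex_measure) (f : T -> R[i]) :=
  [/\ charge_integrable (cm_Re nu) (fun x => complex.Re (f x)),
      charge_integrable (cm_Re nu) (fun x => complex.Im (f x)),
      charge_integrable (cm_Im nu) (fun x => complex.Re (f x)) &
      charge_integrable (cm_Im nu) (fun x => complex.Im (f x))].

Definition cm_integral (nu : complex_measure) (f : T -> R[i]) : R[i] :=
  Complex (charge_integral (cm_Re nu) (fun x => complex.Re (f x)) -
           charge_integral (cm_Im nu) (fun x => complex.Im (f x)))
          (charge_integral (cm_Re nu) (fun x => complex.Im (f x)) +
           charge_integral (cm_Im nu) (fun x => complex.Re (f x))).

End complex_measure.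

Section defs.
Context (R : realType).

Definition convolution n (F : phase R n -> R[i])
    (nu : complex_measure (phase R n) R) (X : phase R n) : R[i] :=
  cm_integral nu (fun T => F (X - T)).

Definition pseries_term N (c : {ffun 'I_N -> nat} -> R) (v : 'rV[R]_N)
    (k : {ffun 'I_N -> nat}) : R := c k * \prod_(j < N) v 0 j ^+ k j.

(* The power series in N variables with coefficients c converges absolutely
   at v, with sum l; partial sums run over the boxes of exponents below m. *)
Definition pseries_cvg_to N (c : {ffun 'I_N -> nat} -> R) (v : 'rV[R]_N)
    (l : R) :=
  summable setT (EFin \o pseries_term c v) /\
  (fun m => \sum_(k : {ffun 'I_N -> 'I_m})
     pseries_term c v [ffun j => k j : nat]) @ \oo --> l.

Definition real_analytic N (f : 'rV[R]_N -> R) :=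
  forall a : 'rV[R]_N, exists c : {ffun 'I_N -> nat} -> R,
    \forall u \near nbhs a, pseries_cvg_to c (u - a) (f u).

Definition phase_of_row n (v : 'rV[R]_(n + n)) : phase R n :=
  (lsubmx v, rsubmx v).

Definition real_analytic2 n (G : phase R n -> phase R n -> R[i]) :=
  let G' (Z : 'rV[R]_((n + n) + (n + n))) :=
    G (phase_of_row (lsubmx Z)) (phase_of_row (rsubmx Z)) in
  real_analytic (fun Z => complex.Re (G' Z)) /\
  real_analytic (fun Z => complex.Im (G' Z)).

Definition partial_deriv n (v : phase R n) (f : phase R n -> R[i])
    (X : phase R n) : R[i] :=
  Complex ('D_v (fun Z => complex.Re (f Z)) X)
          ('D_v (fun Z => complex.Im (f Z)) X).

Definition pos_dir n (j : 'I_n) : phase R n := (delta_mx 0 j, 0).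
Definition mom_dir n (j : 'I_n) : phase R n := (0, delta_mx 0 j).

Definition dotr n (u v : 'rV[R]_n) : R := \sum_(j < n) u 0 j * v 0 j.

Definition sqnorm_phase n (X : phase R n) : R :=
  dotr X.1 X.1 + dotr X.2 X.2.

Definition sesquiholomorphic n (G : phase R n -> phase R n -> R[i]) :=
  forall (X Y : phase R n) (j : 'I_n),
    partial_deriv (pos_dir j) (G ^~ Y) X +
      'i%C * partial_deriv (mom_dir j) (G ^~ Y) X = 0 /\
    partial_deriv (pos_dir j) (G X) Y -
      'i%C * partial_deriv (mom_dir j) (G X) Y = 0.

Definition Dh_extension n (h : R) (F : phase R n -> R[i])
    (Fext : phase R n -> phase R n -> R[i]) :=
  [/\ real_analytic2 Fext, sesquiholomorphic Fext,
      forall X, Fext X X = F X &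
      exists psi : phase R n -> R,
        [/\ psi \in Lfun (@lebesgue_phase R n) 1%E,
            psi \in Lfun (@lebesgue_phase R n) +oo%E &
            forall X Y, Normc.normc (Fext X Y) <=
              expR (sqnorm_phase (X - Y) / (4 * h)) * psi (X - Y)]].

Definition Dh n (h : R) (F : phase R n -> R[i]) :=
  exists Fext, Dh_extension h F Fext.

Section L2.
Variable n : nat.
Local Notation fct := ('rV[R]_n -> R[i]).
Local Notation leb := (@lebesgue_row R n).

(* Elements of L^2 are represented by functions, up to equality almost
   everywhere. *)
Definition L2 (f : fct) :=
  cmeasurable f /\ (\int[leb]_u (Normc.normc (f u) ^+ 2)%:E < +oo)%E.

Definition L2norm (f : fct) : R :=
  Num.sqrt (\int[leb]_u (Normc.normc (f u) ^+ 2)).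

Definition inner (f g : fct) : R[i] :=
  cintegral leb (fun u => f u * conjc (g u)).

Definition bounded_operator (A : fct -> fct) :=
  [/\ forall f, L2 f -> L2 (A f),
      forall f g, L2 f -> L2 g -> f = g %[ae leb] -> A f = A g %[ae leb],
      forall (a : R[i]) f g, L2 f -> L2 g ->
        A (fun u => a * f u + g u) = (fun u => a * A f u + A g u) %[ae leb] &
      exists M : R, forall f, L2 f -> L2norm (A f) <= M * L2norm f].

Definition expi (t : R) : R[i] := Complex (cos t) (sin t).

Definition coherent (h : R) (X : phase R n) : fct := fun u =>
  ((pi * h) `^ (- (n%:R / 4)) *
   expR (- (dotr (u - X.1) (u - X.1) / (2 * h))))%:C%C *
  expi (dotr u X.2 / h - dotr X.1 X.2 / (2 * h)).

Definition coherent_proj (h : R) (X : phase R n) (f : fct) : fct := fun u =>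
  inner f (coherent h X) * coherent h X u.

(* A is the bounded operator (2 pi h)^(-2n) \int Pi_X G(Y, X) Pi_Y dX dY, the
   integral being weak, i.e. tested against pairs of elements of L^2. *)
Definition is_Op (h : R) (G : phase R n -> phase R n -> R[i])
    (A : fct -> fct) :=
  bounded_operator A /\
  forall f g, L2 f -> L2 g ->
    let mu := (@lebesgue_phase R n \x @lebesgue_phase R n)%E in
    let K (XY : phase R n * phase R n) : R[i] :=
      let: (X, Y) := XY in
      inner (coherent_proj h X (fun u => G Y X * coherent_proj h Y f u)) g in
    cintegrable mu K /\
    inner (A f) g = (((2 * pi * h) ^- (2 * n)%N)%:C)%C * cintegral mu K.

End L2.
End defs.

(* Main.v *)
Require Import Defs.
From mathcomp Require Import all_boot all_order all_algebra.
From mathcomp Require Import all_classical all_reals all_analysis.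
From mathcomp Require Import measurable_realfun complex.
From mathcomp Require Import ring lra.

(** Write G for the sesqui-holomorphic extension. The weak integral defining
    the operator has the kernel
      K_(f,g)(X, Y) = G(Y, X) <f, Psi_Y> <Psi_Y, Psi_X> <Psi_X, g>,
    and the overlap <Psi_Y, Psi_X> has modulus exp (- |X - Y|^2 / (4 h))
    ([inner_coherent], a Gaussian Fourier transform). This decay exactly
    compensates the growth allowed to G, so that
      |K_(f,g)(X, Y)| <= psi(Y - X) |<f, Psi_Y>| |<Psi_X, g>|
    ([normc_op_kernel_le]).

    Boundedness. The coherent state transform f |-> <f, Psi_Y> is bounded from
    L^2(R^n) to L^2(R^(2n)) ([transform_bounded]): this is the Schur test
    applied to the Gaussian kernel <Psi_Y, Psi_X> of T T^*, where T is the
    transform. A second use of the Schur test ([schur_test]), now with the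
    convolution kernel psi, makes K_(f,g) integrable, with an integral bounded
    by a multiple of |f| |g| ([op_kernel_bounded]). The Riesz representation
    theorem ([riesz]) turns the bounded sesquilinear form into an operator,
    which is determined up to null sets ([inner_ae_inj]).

    Diagonal values. For f = g = Psi_Z, a translation by (Z, Z) brings the
    kernel to the form
      exp (- (|X|^2 + |Y|^2) / (2 h)) exp (s(X, Y)) G(Z + Y, Z + X),
    where s(X, Y) is 1 / (2 h) times the Hermitian product conj(X) Y, and
    R^(2n) is seen as C^n ([op_kernel_shift]). Replace (X, Y) by
    (conj(z) X, z Y) with |z| = 1: the Gaussian weight does not move, and
    the product of the other two factors becomes a holomorphic function of z,
    because G is holomorphic in its first variable and antiholomorphic in the
    second one. These maps preserve Lebesgue measure, so that the holomorphic
    function may be replaced by its mean over the circle |z| = 1, which is its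
    value G(Z, Z) at z = 0 ([rotation_average]). The remaining Gaussian
    integral is (2 pi h)^(2n), which the normalisation cancels.

    The mean over the circle is taken over the N-th roots of unity, with N
    tending to infinity. This needs neither contour integrals nor continuity
    of derivatives: a telescoping argument on a polar grid suffices
    ([discrete_mean]), once differentiability is uniform on the closed disc. *)

Set Implicit Arguments.
Unset Strict Implicit.
Unset Printing Implicit Defensive.

Import Order.TTheory GRing.Theory Num.Theory.
Import numFieldNormedType.Exports.

Local Open Scope classical_set_scope.
Local Open Scope ring_scope.

Notation normc := Normc.normc.

(** * Complex numbers *)

Section modulus.
Context {R : realType}.
Implicit Types z w : R[i].

Lemma normc_ge0 z : 0 <= normc z.
Proof. by case: z => a b; exact: sqrtr_ge0. Qed.

Lemma sqr_normc z : normc z ^+ 2 = complex.Re z ^+ 2 + complex.Im z ^+ 2.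
Proof. by case: z => a b /=; rewrite sqr_sqrtr// addr_ge0// sqr_ge0. Qed.

Lemma normc_triangle z w : normc (z + w) <= normc z + normc w.
Proof. exact: le_normcD. Qed.

Lemma normc_opp z : normc (- z) = normc z.
Proof. exact: normcN. Qed.

Lemma normc_real (r : R) : normc (r%:C)%C = `|r|.
Proof. by rewrite /= expr0n addr0 sqrtr_sqr. Qed.

Lemma normc_conjc z : normc (conjc z) = normc z.
Proof. by case: z => a b /=; rewrite sqrrN. Qed.

Lemma abs_Re_le_normc z : `|complex.Re z| <= normc z.
Proof.
by case: z => a b /=; rewrite -sqrtr_sqr ler_wsqrtr// lerDl sqr_ge0.
Qed.

Lemma abs_Im_le_normc z : `|complex.Im z| <= normc z.
Proof.
by case: z => a b /=; rewrite -sqrtr_sqr ler_wsqrtr// lerDr sqr_ge0.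
Qed.

Lemma normc_le_ReIm z : normc z <= `|complex.Re z| + `|complex.Im z|.
Proof.
rewrite -(@ler_pXn2r _ 2)// ?nnegrE ?normc_ge0 ?addr_ge0// sqr_normc sqrrD.
by rewrite !real_normK ?num_real// lerD2r lerDl mulrn_wge0// mulr_ge0.
Qed.

Lemma normc_sum I (r : seq I) (P : pred I) (F : I -> R[i]) :
  normc (\sum_(i <- r | P i) F i) <= \sum_(i <- r | P i) normc (F i).
Proof.
elim/big_rec2 : _ => [|i y x _ xy]; first by rewrite Normc.normc0.
by rewrite (le_trans (normc_triangle _ _))// lerD2l.
Qed.

Lemma mulc_conjc z : z * conjc z = ((normc z ^+ 2)%:C)%C.
Proof. by rewrite sqr_normc; case: z => a b; simpc; congr Complex; ring. Qed.

Lemma ReM z w : complex.Re (z * w) =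
  complex.Re z * complex.Re w - complex.Im z * complex.Im w.
Proof. by case: z w => a b [c d]. Qed.

Lemma ImM z w : complex.Im (z * w) =
  complex.Re z * complex.Im w + complex.Im z * complex.Re w.
Proof. by case: z w => a b [c d]. Qed.

Lemma ReD z w : complex.Re (z + w) = complex.Re z + complex.Re w.
Proof. by case: z w => a b [c d]. Qed.

Lemma ImD z w : complex.Im (z + w) = complex.Im z + complex.Im w.
Proof. by case: z w => a b [c d]. Qed.

Lemma Re_conjc z : complex.Re (conjc z) = complex.Re z.
Proof. by case: z. Qed.

Lemma Im_conjc z : complex.Im (conjc z) = - complex.Im z.
Proof. by case: z. Qed.

Lemma complexP z w : complex.Re z = complex.Re w ->
  complex.Im z = complex.Im w -> z = w.
Proof. by case: z w => a b [c d]/= -> ->. Qed.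

Lemma conjcD z w : conjc (z + w) = conjc z + conjc w.
Proof. by apply: complexP; rewrite ?(ReD, ImD, Re_conjc, Im_conjc) ?opprD. Qed.

Lemma conjcM z w : conjc (z * w) = conjc z * conjc w.
Proof. by case: z w => a b [c d]; simpc; congr Complex; ring. Qed.

End modulus.

(** * Measurable and integrable complex functions *)

Section complex_measurability.
Context d (T : measurableType d) (R : realType).
Implicit Types (f g : T -> R[i]).

Lemma cmeasurable_cst (c : R[i]) : cmeasurable (fun _ : T => c).
Proof. by split; exact: measurable_cst. Qed.

Lemma cmeasurableD f g : cmeasurable f -> cmeasurable g ->
  cmeasurable (fun x => f x + g x).
Proof.
move=> [f1 f2] [g1 g2]; split.
  under eq_fun do rewrite ReD; exact: measurable_funD.
under eq_fun do rewrite ImD; exact: measurable_funD.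
Qed.

Lemma cmeasurableM f g : cmeasurable f -> cmeasurable g ->
  cmeasurable (fun x => f x * g x).
Proof.
move=> [f1 f2] [g1 g2]; split.
  under eq_fun do rewrite ReM.
  by apply: measurable_funB; exact: measurable_funM.
under eq_fun do rewrite ImM.
by apply: measurable_funD; exact: measurable_funM.
Qed.

Lemma cmeasurable_conj f : cmeasurable f -> cmeasurable (fun x => conjc (f x)).
Proof.
move=> [f1 f2]; split; first by under eq_fun do rewrite Re_conjc.
under eq_fun do rewrite Im_conjc; exact: measurableT_comp.
Qed.

Lemma cmeasurable_real (f : T -> R) : measurable_fun setT f ->
  cmeasurable (fun x => (f x)%:C%C).
Proof. by move=> mf; split => //; exact: measurable_cst. Qed.

Lemma measurable_normc_sq f : cmeasurable f ->
  measurable_fun setT (fun x => normc (f x) ^+ 2).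
Proof.
move=> [f1 f2]; under eq_fun do rewrite sqr_normc.
by apply: measurable_funD; exact: measurable_funX.
Qed.

Lemma measurable_normc f : cmeasurable f ->
  measurable_fun setT (fun x => normc (f x)).
Proof.
move=> mf.
rewrite (_ : (fun x => _) = (fun x => Num.sqrt (normc (f x) ^+ 2))); last first.
  by apply/funext => x; rewrite sqrtr_sqr ger0_norm// normc_ge0.
apply: (@measurableT_comp _ _ _ _ _ _ (@Num.sqrt R)) (measurable_normc_sq mf).
by apply: continuous_measurable_fun; exact: sqrt_continuous.
Qed.

Lemma cmeasurable_comp d' (T' : measurableType d') (phi : T' -> T) f :
  measurable_fun setT phi -> cmeasurable f -> cmeasurable (f \o phi).
Proof.
move=> mphi [f1 f2]; split; first exact: (measurableT_comp f1 mphi).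
exact: (measurableT_comp f2 mphi).
Qed.

End complex_measurability.

Section complex_integration.
Context d (T : measurableType d) (R : realType) (mu : {measure set T -> \bar R}).
Implicit Types (f g : T -> R[i]).

Lemma integrable_le (f g : T -> R) : measurable_fun setT f ->
  (forall x, `|f x| <= g x) -> mu.-integrable setT (EFin \o g) ->
  mu.-integrable setT (EFin \o f).
Proof.
move=> mf fg ig; apply: (le_integrable measurableT _ _ ig).
  exact/measurable_EFinP.
by move=> x _ /=; rewrite lee_fin (le_trans (fg x)) ?ler_norm.
Qed.

Lemma integrable_addr (f g : T -> R) : mu.-integrable setT (EFin \o f) ->
  mu.-integrable setT (EFin \o g) ->
  mu.-integrable setT (EFin \o (fun x => f x + g x)).
Proof. by move=> fi gi; exact: (integrableD measurableT fi gi). Qed.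

Lemma integrable_mulrl (c : R) (f : T -> R) :
  mu.-integrable setT (EFin \o f) ->
  mu.-integrable setT (EFin \o (fun x => c * f x)).
Proof. by move=> fi; exact: (integrableZl measurableT c fi). Qed.

Lemma cintegrable_meas f : cintegrable mu f -> cmeasurable f.
Proof.
by move=> [i1 i2]; split; [move/measurable_int : i1|move/measurable_int : i2];
  move/measurable_EFinP.
Qed.

Lemma cintegrable_normc f : cintegrable mu f ->
  mu.-integrable setT (EFin \o (fun x => normc (f x))).
Proof.
move=> fi; have [i1 i2] := fi.
have mf := cintegrable_meas fi.
apply: (@integrable_le _
  (fun x => `|complex.Re (f x)| + `|complex.Im (f x)|)).
- exact: measurable_normc.
- by move=> x; rewrite ger0_norm ?normc_ge0 ?normc_le_ReIm.
- have h1 := integrable_abse i1; have h2 := integrable_abse i2.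
  exact: (integrableD measurableT h1 h2).
Qed.

Lemma cintegrable_le f (g : T -> R) : cmeasurable f ->
  (forall x, normc (f x) <= g x) -> mu.-integrable setT (EFin \o g) ->
  cintegrable mu f.
Proof.
move=> [m1 m2] fg ig; split; (apply: (@integrable_le _ g) => // x).
  exact: le_trans (abs_Re_le_normc _) (fg x).
exact: le_trans (abs_Im_le_normc _) (fg x).
Qed.

Lemma cintegrableD f g : cintegrable mu f -> cintegrable mu g ->
  cintegrable mu (fun x => f x + g x).
Proof.
move=> fi gi; apply: (@cintegrable_le _ (fun x => normc (f x) + normc (g x))).
- by apply: cmeasurableD; exact: cintegrable_meas.
- by move=> x; exact: normc_triangle.
- exact: (integrableD measurableT (cintegrable_normc fi) (cintegrable_normc gi)).
Qed.

Lemma cintegrableZ (c : R[i]) f : cintegrable mu f ->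
  cintegrable mu (fun x => c * f x).
Proof.
move=> fi; apply: (@cintegrable_le _ (fun x => normc c * normc (f x))).
- by apply: cmeasurableM; [exact: cmeasurable_cst|exact: cintegrable_meas].
- by move=> x; rewrite Normc.normcM.
- exact: (integrableZl measurableT _ (cintegrable_normc fi)).
Qed.

Lemma cintegrable_conj f : cintegrable mu f ->
  cintegrable mu (fun x => conjc (f x)).
Proof.
move=> fi; apply: (@cintegrable_le _ (fun x => normc (f x))).
- by apply: cmeasurable_conj; exact: cintegrable_meas.
- by move=> x; rewrite normc_conjc.
- exact: cintegrable_normc.
Qed.

Lemma eq_cintegral f g : f =1 g -> cintegral mu f = cintegral mu g.
Proof. by move=> /funext ->. Qed.

Lemma cintegralD f g : cintegrable mu f -> cintegrable mu g ->
  cintegral mu (fun x => f x + g x) = cintegral mu f + cintegral mu g.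
Proof.
move=> [f1 f2] [g1 g2]; apply: complexP; rewrite ?ReD ?ImD /=.
  by under eq_Rintegral do rewrite ReD; rewrite RintegralD.
by under eq_Rintegral do rewrite ImD; rewrite RintegralD.
Qed.

Lemma cintegralZ (c : R[i]) f : cintegrable mu f ->
  cintegral mu (fun x => c * f x) = c * cintegral mu f.
Proof.
move=> [f1 f2].
have i1 r := integrableZl measurableT r f1.
have i2 r := integrableZl measurableT r f2.
apply: complexP; rewrite ?ReM ?ImM /=.
  under eq_Rintegral do rewrite ReM.
  by rewrite RintegralB ?RintegralZl//; [exact: i1|exact: i2].
under eq_Rintegral do rewrite ImM.
by rewrite RintegralD ?RintegralZl//; [exact: i2|exact: i1].
Qed.

Lemma cintegral_conj f :
  cintegrable mu f -> cintegral mu (fun x => conjc (f x)) = conjc (cintegral mu f).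
Proof.
move=> [f1 f2]; apply: complexP; rewrite ?Re_conjc ?Im_conjc/=.
  by under eq_Rintegral do rewrite Re_conjc.
under eq_Rintegral do rewrite Im_conjc -mulN1r.
by rewrite RintegralZl// mulN1r.
Qed.

Lemma cintegral_real (f : T -> R) :
  cintegral mu (fun x => (f x)%:C%C) = (\int[mu]_x f x)%:C%C.
Proof.
by rewrite /cintegral/=; congr Complex; rewrite Rintegral_cst// mul0r.
Qed.

Lemma ae_eq_cintegral f g : cmeasurable f -> cmeasurable g ->
  f = g %[ae mu] -> cintegral mu f = cintegral mu g.
Proof.
move=> [f1 f2] [g1 g2] fg; rewrite /cintegral /Rintegral; congr Complex.
  congr fine; apply: ae_eq_integral => //; try exact/measurable_EFinP.
  exact: (@ae_eq_comp _ _ _ _ _ _ _ (fun z : R[i] => (complex.Re z)%:E)).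
congr fine; apply: ae_eq_integral => //; try exact/measurable_EFinP.
exact: (@ae_eq_comp _ _ _ _ _ _ _ (fun z : R[i] => (complex.Im z)%:E)).
Qed.

(** Rotating the integral to the positive real axis reduces the claim to
    monotonicity of the real integral. *)
Lemma normc_cintegral_le f : cintegrable mu f ->
  normc (cintegral mu f) <= \int[mu]_x normc (f x).
Proof.
move=> fi; set I := cintegral mu f.
have [->|I0] := eqVneq I 0.
  by rewrite Normc.normc0; apply: Rintegral_ge0 => x _; exact: normc_ge0.
have nI0 : 0 < normc I.
  rewrite lt_neqAle normc_ge0 andbT eq_sym; apply: contra I0 => /eqP.
  by move=> /Normc.eq0_normc ->.
rewrite -(ler_pM2l nI0) -expr2.
have -> : normc I ^+ 2 = complex.Re (cintegral mu (fun x => conjc I * f x)).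
  by rewrite cintegralZ// -/I mulrC mulc_conjc.
rewrite /= -RintegralZl ?(cintegrable_normc fi)//.
apply: le_Rintegral => //.
- by have [] := cintegrableZ (conjc I) fi.
- exact: (integrableZl measurableT _ (cintegrable_normc fi)).
- move=> x _; rewrite (le_trans (ler_norm _))// (le_trans (abs_Re_le_normc _))//.
  by rewrite Normc.normcM (normc_conjc I).
Qed.

End complex_integration.

(** * Integration on product spaces *)

Lemma ae_eq_integrable d (T : measurableType d) (R : realType)
    (mu : {measure set T -> \bar R}) (f g : T -> \bar R) :
  measurable_fun setT g -> ae_eq mu setT f g ->
  mu.-integrable setT f -> mu.-integrable setT g.
Proof.
move=> mg fg /integrableP[mf foo]; apply/integrableP; split => //.
suff <- : (\int[mu]_x `|f x| = \int[mu]_x `|g x|)%E by [].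
apply: ae_eq_integral => //; try exact: measurableT_comp.
exact: (@ae_eq_comp _ _ _ _ _ _ _ (@abse R)).
Qed.

Section fubini.
Context d1 d2 (T1 : measurableType d1) (T2 : measurableType d2) (R : realType).
Variables (m1 : {sigma_finite_measure set T1 -> \bar R})
          (m2 : {sigma_finite_measure set T2 -> \bar R}).

(** The inner integral may be infinite on a null set, where [Rintegral] sends
    it to 0; this changes neither the integrability nor the value of the outer
    integral. *)
Lemma Rfubini1 (f : T1 * T2 -> R) :
  (m1 \x m2)%E.-integrable setT (EFin \o f) ->
  m1.-integrable setT (fun x => (\int[m2]_y f (x, y))%:E) /\
  \int[m1]_x \int[m2]_y f (x, y) = \int[(m1 \x m2)%E]_z f z.
Proof.
move=> fi; have Fi := integrable_fubini_F fi.
have mF := measurable_int _ Fi.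
have FE : ae_eq m1 setT (fubini_F m2 (EFin \o f))
    (fun x => (\int[m2]_y f (x, y))%:E).
  have := integrable_ae measurableT Fi; apply: filterS => x /= Fx Tx.
  by rewrite /Rintegral fineK//; exact: Fx.
have mR : measurable_fun setT (fun x => (\int[m2]_y f (x, y))%:E).
  apply/measurable_EFinP; rewrite /Rintegral.
  exact: (measurableT_comp (fine_measurable _) mF).
split; first exact: (ae_eq_integrable mR FE Fi).
rewrite {1 3}/Rintegral; congr fine.
by rewrite -(integral12_prod_meas1 fi); apply: ae_eq_integral => //; exact: ae_eq_sym.
Qed.

Lemma Rfubini2 (f : T1 * T2 -> R) :
  (m1 \x m2)%E.-integrable setT (EFin \o f) ->
  m2.-integrable setT (fun y => (\int[m1]_x f (x, y))%:E) /\
  \int[m2]_y \int[m1]_x f (x, y) = \int[(m1 \x m2)%E]_z f z.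
Proof.
move=> fi; have mf := measurable_int _ fi.
have Fi : m2.-integrable setT (fubini_G m1 (EFin \o f)).
  apply/integrableP; split; first exact: measurable_fubini_G fi.
  apply: le_lt_trans ((integrable21ltyP m1 m2 mf).1 fi).
  apply: ge0_le_integral => //.
  - by apply: measurableT_comp => //; exact: measurable_fubini_G fi.
  - apply: (@measurable_fun_fubini_tonelli_G _ _ _ _ _ _ (abse \o (EFin \o f))) => //.
      exact: measurableT_comp.
    by move=> z; exact: abse_ge0.
  - move=> y _; apply: le_abse_integral => //.
    exact: measurableT_comp.
have mF := measurable_int _ Fi.
have FE : ae_eq m2 setT (fubini_G m1 (EFin \o f))
    (fun x => (\int[m1]_y f (y, x))%:E).
  have := integrable_ae measurableT Fi; apply: filterS => x /= Fx Tx.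
  by rewrite /Rintegral fineK//; exact: Fx.
have mR : measurable_fun setT (fun x => (\int[m1]_y f (y, x))%:E).
  apply/measurable_EFinP; rewrite /Rintegral.
  exact: (measurableT_comp (fine_measurable _) mF).
split; first exact: (ae_eq_integrable mR FE Fi).
rewrite {1 3}/Rintegral; congr fine.
by rewrite -(integral21_prod_meas1 fi); apply: ae_eq_integral => //; exact: ae_eq_sym.
Qed.

Lemma cfubini1 (f : T1 * T2 -> R[i]) : cintegrable (m1 \x m2)%E f ->
  cintegrable m1 (fun x => cintegral m2 (fun y => f (x, y))) /\
  cintegral m1 (fun x => cintegral m2 (fun y => f (x, y))) =
  cintegral (m1 \x m2)%E f.
Proof.
move=> [/Rfubini1[i1 e1] /Rfubini1[i2 e2]]; split; first by split.
by rewrite /cintegral/= e1 e2.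
Qed.

Lemma cfubini2 (f : T1 * T2 -> R[i]) : cintegrable (m1 \x m2)%E f ->
  cintegrable m2 (fun y => cintegral m1 (fun x => f (x, y))) /\
  cintegral m2 (fun y => cintegral m1 (fun x => f (x, y))) =
  cintegral (m1 \x m2)%E f.
Proof.
move=> [/Rfubini2[i1 e1] /Rfubini2[i2 e2]]; split; first by split.
by rewrite /cintegral/= e1 e2.
Qed.

Lemma integrable_tensor (f : T1 -> R) (g : T2 -> R) :
  m1.-integrable setT (EFin \o f) -> m2.-integrable setT (EFin \o g) ->
  (m1 \x m2)%E.-integrable setT (EFin \o (fun z => f z.1 * g z.2)).
Proof.
move=> fi gi.
have mf : measurable_fun setT f by apply/measurable_EFinP; exact: measurable_int fi.
have mg : measurable_fun setT g by apply/measurable_EFinP; exact: measurable_int gi.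
have mfg : measurable_fun setT (EFin \o (fun z : T1 * T2 => f z.1 * g z.2)).
  apply/measurable_EFinP; apply: measurable_funM.
    exact: measurableT_comp mf measurable_fst.
  exact: measurableT_comp mg measurable_snd.
apply/(integrable12ltyP _ _ mfg).
have /integrableP[_ foo] := fi; have /integrableP[_ goo] := gi.
pose I := (\int[m2]_y `|(g y)%:E|)%E.
rewrite (_ : (\int[m1]_x _)%E = (\int[m1]_x (`|(f x)%:E| * I))%E).
  rewrite ge0_integralZr//; try exact: integral_ge0.
    by rewrite lte_mul_pinfty ?integral_ge0// ge0_fin_numE ?integral_ge0.
  exact: measurableT_comp (measurable_int _ fi).
apply: eq_integral => x _; rewrite /I -ge0_integralZl//; last first.
  exact: measurableT_comp (measurable_int _ gi).
by apply: eq_integral => y _ /=; rewrite normrM EFinM.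
Qed.

Lemma cintegral_tensor (f : T1 -> R[i]) (g : T2 -> R[i]) :
  cintegrable m1 f -> cintegrable m2 g ->
  cintegrable (m1 \x m2)%E (fun z => f z.1 * g z.2) /\
  cintegral (m1 \x m2)%E (fun z => f z.1 * g z.2) =
    cintegral m1 f * cintegral m2 g.
Proof.
move=> fi gi.
have fgi : cintegrable (m1 \x m2)%E (fun z => f z.1 * g z.2).
  apply: (@cintegrable_le _ _ _ _ _ (fun z => normc (f z.1) * normc (g z.2))).
  - apply: cmeasurableM.
      exact: (cmeasurable_comp measurable_fst (cintegrable_meas fi)).
    exact: (cmeasurable_comp measurable_snd (cintegrable_meas gi)).
  - by move=> z; rewrite Normc.normcM.
  - exact: (integrable_tensor (cintegrable_normc fi) (cintegrable_normc gi)).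
split => //; have [_ <-] := cfubini1 fgi.
rewrite mulrC -cintegralZ//; apply: eq_cintegral => x /=.
by rewrite cintegralZ// mulrC.
Qed.

End fubini.

(** * The space L^2 *)

(** The weighted form of the inequality between arithmetic and geometric means:
    minimising over s recovers the product. It lets the bounds of
    Cauchy-Schwarz type below be proved by integrating pointwise inequalities
    that are linear in the two quadratic terms. *)
Lemma le_mul_of_amgm (R : realType) (q A B : R) : 0 <= A -> 0 <= B ->
  (forall s, 0 < s -> 2 * q <= s * A ^+ 2 + s^-1 * B ^+ 2) -> q <= A * B.
Proof.
move=> A0 B0 qAB; have [q0|q0] := leP q 0; first by rewrite (le_trans q0) ?mulr_ge0.
have {}A0 : 0 < A.
  rewrite lt_neqAle A0 andbT eq_sym; apply/eqP => A00.
  have B1 : 0 < B ^+ 2 + 1 by rewrite ltr_wpDl ?sqr_ge0.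
  have := qAB ((B ^+ 2 + 1) / q) (divr_gt0 B1 q0).
  rewrite A00 expr0n mulr0 add0r invf_div leNgt => /negP; apply.
  rewrite mulrAC ltr_pdivrMr// mulrC mulrAC.
  rewrite -subr_gt0 (_ : _ - _ = q * (B ^+ 2 + 2)); last by ring.
  by rewrite mulr_gt0// ltr_wpDl ?sqr_ge0.
rewrite -(@ler_pXn2r _ 2)// ?nnegrE ?mulr_ge0 ?(ltW A0) ?(ltW q0)//.
(* This s is B / A when the bound is sharp, and it needs no B <> 0. *)
have /(qAB _) : 0 < q / A ^+ 2 by rewrite divr_gt0 ?exprn_gt0.
rewrite divfK ?expf_neq0 ?gt_eqF// invf_div mulr2n mulrDl mul1r lerD2l.
by rewrite mulrAC ler_pdivlMr// -expr2 exprMn.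
Qed.

Section L2_space.
Context {R : realType} (n : nat).
Local Notation fct := ('rV[R]_n -> R[i]).
Local Notation leb := (@lebesgue_row R n).
Implicit Types (f g : fct) (c : R[i]).

Lemma L2_sq_integrable f : L2 f ->
  leb.-integrable setT (EFin \o (fun u => normc (f u) ^+ 2)).
Proof.
move=> [mf foo]; apply/integrableP; split.
  exact/measurable_EFinP/measurable_normc_sq.
by under eq_integral do rewrite /= ger0_norm ?sqr_ge0//.
Qed.

Lemma L2_le f (g : 'rV[R]_n -> R) : cmeasurable f ->
  (forall u, normc (f u) ^+ 2 <= g u) -> leb.-integrable setT (EFin \o g) ->
  L2 f.
Proof.
move=> mf fg ig; split => //.
have /integrableP[_] : leb.-integrable setT (EFin \o (fun u => normc (f u) ^+ 2)).
  apply: (integrable_le _ _ ig); first exact: measurable_normc_sq.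
  by move=> u; rewrite ger0_norm ?sqr_ge0.
by under eq_integral do rewrite /= ger0_norm ?sqr_ge0//.
Qed.

Lemma L2D f g : L2 f -> L2 g -> L2 (fun u => f u + g u).
Proof.
move=> f2 g2.
apply: (@L2_le _ (fun u => 2 * normc (f u) ^+ 2 + 2 * normc (g u) ^+ 2)).
- by apply: cmeasurableD; [case: f2|case: g2].
- move=> u; have := normc_triangle (f u) (g u).
  have := normc_ge0 (f u + g u); have := sqr_ge0 (normc (f u) - normc (g u)).
  by nra.
- by apply: integrable_addr; apply: integrable_mulrl; exact: L2_sq_integrable.
Qed.

Lemma L2Z c f : L2 f -> L2 (fun u => c * f u).
Proof.
move=> f2; apply: (@L2_le _ (fun u => normc c ^+ 2 * normc (f u) ^+ 2)).
- by apply: cmeasurableM; [exact: cmeasurable_cst|case: f2].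
- by move=> u; rewrite Normc.normcM exprMn.
- exact: (integrableZl measurableT _ (L2_sq_integrable f2)).
Qed.

Lemma L2B f g : L2 f -> L2 g -> L2 (fun u => f u - g u).
Proof.
move=> f2 g2; have := L2D f2 (L2Z (-1) g2).
by under eq_fun do rewrite mulN1r.
Qed.

Lemma L2_mul_conj f g : L2 f -> L2 g ->
  cintegrable leb (fun u => f u * conjc (g u)).
Proof.
move=> f2 g2.
apply: (@cintegrable_le _ _ _ _ _ (fun u => normc (f u) ^+ 2 + normc (g u) ^+ 2)).
- by apply: cmeasurableM; [case: f2|apply: cmeasurable_conj; case: g2].
- move=> u; rewrite Normc.normcM normc_conjc.
  have := sqr_ge0 (normc (f u)); have := sqr_ge0 (normc (g u)).
  have := sqr_ge0 (normc (f u) - normc (g u)); nra.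
- exact: (integrableD measurableT (L2_sq_integrable f2) (L2_sq_integrable g2)).
Qed.

Lemma innerD f g k : L2 f -> L2 g -> L2 k ->
  inner (fun u => f u + g u) k = inner f k + inner g k.
Proof.
move=> f2 g2 k2; rewrite /inner -cintegralD; try exact: L2_mul_conj.
by apply: eq_cintegral => u; rewrite mulrDl.
Qed.

Lemma innerZ c f k : L2 f -> L2 k ->
  inner (fun u => c * f u) k = c * inner f k.
Proof.
move=> f2 k2; rewrite /inner -cintegralZ; last exact: L2_mul_conj.
by apply: eq_cintegral => u; rewrite mulrA.
Qed.

Lemma inner_conj f g : L2 f -> L2 g -> inner g f = conjc (inner f g).
Proof.
move=> f2 g2; rewrite /inner -cintegral_conj; last exact: L2_mul_conj.
by apply: eq_cintegral => u; rewrite conjcM conjcK mulrC.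
Qed.

Lemma innerDr f g k : L2 f -> L2 g -> L2 k ->
  inner k (fun u => f u + g u) = inner k f + inner k g.
Proof.
move=> f2 g2 k2; rewrite inner_conj//; last exact: L2D.
by rewrite innerD// conjcD -(inner_conj f2 k2) -(inner_conj g2 k2).
Qed.

Lemma innerZr c f k : L2 f -> L2 k ->
  inner k (fun u => c * f u) = conjc c * inner k f.
Proof.
move=> f2 k2; rewrite inner_conj//; last exact: L2Z.
by rewrite innerZ// conjcM -(inner_conj f2 k2).
Qed.

Lemma innerB f g k : L2 f -> L2 g -> L2 k ->
  inner (fun u => f u - g u) k = inner f k - inner g k.
Proof.
move=> f2 g2 k2; have := innerD f2 (L2Z (-1) g2) k2.
by under eq_fun do rewrite mulN1r; rewrite innerZ// mulN1r.
Qed.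

Lemma L2norm_ge0 f : 0 <= L2norm f.
Proof. exact: sqrtr_ge0. Qed.

Lemma sqr_L2norm f : L2norm f ^+ 2 = \int[leb]_u (normc (f u) ^+ 2).
Proof.
by rewrite sqr_sqrtr//; apply: Rintegral_ge0 => u _; exact: sqr_ge0.
Qed.

Lemma inner_self f : inner f f = (L2norm f ^+ 2)%:C%C.
Proof.
rewrite sqr_L2norm -cintegral_real; apply: eq_cintegral => u.
exact: mulc_conjc.
Qed.

Lemma sqr_L2normD f g : L2 f -> L2 g -> L2norm (fun u => f u + g u) ^+ 2 =
  L2norm f ^+ 2 + 2 * complex.Re (inner f g) + L2norm g ^+ 2.
Proof.
move=> f2 g2; have fg2 := L2D f2 g2.
have nE (h : fct) : L2norm h ^+ 2 = complex.Re (inner h h) by rewrite inner_self.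
rewrite nE innerD// !innerDr// !ReD (inner_conj f2 g2) Re_conjc.
by rewrite !inner_self /=; ring.
Qed.

Lemma L2normZ c f : L2 f -> L2norm (fun u => c * f u) = normc c * L2norm f.
Proof.
move=> f2; rewrite /L2norm.
under eq_Rintegral do rewrite Normc.normcM exprMn.
rewrite RintegralZl//; last exact: L2_sq_integrable.
by rewrite sqrtrM ?sqr_ge0// sqrtr_sqr ger0_norm ?normc_ge0.
Qed.

Lemma cauchy_schwarz f g : L2 f -> L2 g ->
  normc (inner f g) <= L2norm f * L2norm g.
Proof.
move=> f2 g2; apply: le_mul_of_amgm; try exact: L2norm_ge0.
move=> s s0; rewrite !sqr_L2norm.
have If := L2_sq_integrable f2; have Ig := L2_sq_integrable g2.
rewrite -2?RintegralZl// -RintegralD//; last 2 first.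
- exact: (integrableZl measurableT _ If).
- exact: (integrableZl measurableT _ Ig).
have fgi := L2_mul_conj f2 g2.
apply: (@le_trans _ _ (2 * \int[leb]_u normc (f u * conjc (g u)))).
  by rewrite ler_pM2l// normc_cintegral_le.
rewrite -RintegralZl//; last exact: cintegrable_normc.
apply: le_Rintegral => //.
- exact: (integrableZl measurableT _ (cintegrable_normc fgi)).
- by apply: integrable_addr; exact: integrable_mulrl.
- move=> u _; rewrite Normc.normcM normc_conjc.
  have := sqr_ge0 (s * normc (f u) - normc (g u)) => h.
  rewrite -(ler_pM2l s0) mulrDr (mulrA s s^-1) mulfV ?gt_eqF// mul1r.
  by nra.
Qed.

Lemma L2norm_eq0 f : L2 f -> L2norm f = 0 -> f = (fun=> 0) %[ae leb].
Proof.
move=> f2 f0; have fi := L2_sq_integrable f2.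
have /eqP h : (\int[leb]_u `|(normc (f u) ^+ 2)%:E| = 0)%E.
  under eq_integral do rewrite /= ger0_norm ?sqr_ge0//.
  rewrite -[LHS]fineK ?(integrable_fin_num _ fi)//.
  by have := sqr_L2norm f; rewrite f0 expr0n /= /Rintegral => <-.
have /ae_eq_integral_abs := measurable_int _ fi => /(_ leb measurableT) [+ _].
move/(_ (eqP h)); apply: filterS => u /= + _ => /(_ I) [] /eqP.
by rewrite sqrf_eq0 => /eqP/Normc.eq0_normc.
Qed.

Lemma inner_ae_inj f g : L2 f -> L2 g ->
  (forall k, L2 k -> inner f k = inner g k) -> f = g %[ae leb].
Proof.
move=> f2 g2 fg; have d2 := L2B f2 g2.
have : inner (fun u => f u - g u) (fun u => f u - g u) = 0.
  by rewrite innerB// fg// subrr.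
rewrite inner_self => /eqP; rewrite fmorph_eq0 sqrf_eq0 => /eqP /(L2norm_eq0 d2).
by apply: filterS => u /= + _ => /(_ I) /eqP; rewrite subr_eq0 => /eqP.
Qed.

End L2_space.

(** * Completeness of L^2 and the Riesz representation theorem *)

Lemma cvg_geometric_increments (R : realType) (x : R^nat) (M : R) :
  (forall k, `|x k.+1 - x k| <= M * 2^-1 ^+ k) -> cvgn x.
Proof.
move=> xM; have -> : x = (fun k => x 0%N + series (fun i => x i.+1 - x i) k).
  by apply/funext => k; rewrite seriesEnat /= telescope_sumr// addrC subrK.
apply: is_cvgD; first exact: is_cvg_cst.
apply: normed_cvg; apply: (@series_le_cvg _ _ (fun k => M * 2^-1 ^+ k)) => //.
- by move=> k; rewrite /= normr_ge0.
- by move=> k; exact: (le_trans (normr_ge0 _) (xM k)).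
- rewrite (_ : (fun k => _) = geometric M (2^-1 : R))//.
  by apply: is_cvg_geometric_series; rewrite ger0_norm; lra.
Qed.

Section L2_complete.
Context {R : realType} (n : nat).
Local Notation fct := ('rV[R]_n -> R[i]).
Local Notation leb := (@lebesgue_row R n).

Lemma cvg_normc_sq (v : nat -> R[i]) (z : R[i]) :
  (fun m => complex.Re (v m)) @ \oo --> complex.Re z ->
  (fun m => complex.Im (v m)) @ \oo --> complex.Im z ->
  (fun m => normc (v m) ^+ 2) @ \oo --> normc z ^+ 2.
Proof.
move=> h1 h2; under eq_fun do rewrite sqr_normc.
by rewrite sqr_normc; apply: cvgD; under eq_fun do rewrite expr2;
  rewrite expr2; exact: cvgM.
Qed.

(** The squared increments are so small that they remain summable with the
    weights 4^k; hence at almost every point the increments are dominated by a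
    geometric sequence, and the sequence converges there. Fatou's lemma then
    gives the rate. *)
Lemma L2_complete (v : nat -> fct) : (forall k, L2 (v k)) ->
  (forall k m, (k <= m)%N ->
    L2norm (fun u => v m u - v k u) ^+ 2 <= 16^-1 ^+ k) ->
  exists2 w : fct, L2 w &
    forall k, L2norm (fun u => w u - v k u) ^+ 2 <= 16^-1 ^+ k.
Proof.
move=> v2 vC.
pose dd k u := 4 ^+ k * normc (v k.+1 u - v k u) ^+ 2.
have dd0 k u : 0 <= dd k u by rewrite mulr_ge0 ?sqr_ge0 ?exprn_ge0.
have mdd k : measurable_fun setT (fun u => dd k u).
  apply: measurable_funM => //; apply: measurable_normc_sq.
  by have [] := L2B (v2 k.+1) (v2 k).
pose S u : \bar R := (\sum_(0 <= k <oo) (dd k u)%:E)%E.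
have mS : measurable_fun setT S.
  by apply: ge0_emeasurable_sum => // k; [move=> u _ _; rewrite lee_fin|move=> _; exact/measurable_EFinP].
have S0 u : (0 <= S u)%E by apply: nneseries_ge0 => k _ _; rewrite lee_fin.
have Sint : leb.-integrable setT S.
  apply/integrableP; split => //.
  under eq_integral do rewrite gee0_abs//.
  rewrite integral_nneseries//; last 2 first.
  - by move=> k; exact/measurable_EFinP.
  - by move=> k u _; rewrite lee_fin.
  apply: (@le_lt_trans _ _ (\sum_(0 <= k <oo) (geometric 1 (4^-1 : R) k)%:E)%E).
    apply: lee_nneseries => [k _ _|k _].
      by apply: integral_ge0 => u _; rewrite lee_fin.
    have i2 := L2_sq_integrable (L2B (v2 k.+1) (v2 k)).
    rewrite -[leLHS]fineK; last first.
      by apply: integrable_fin_num => //; exact: (integrable_mulrl _ i2).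
    rewrite lee_fin -/(Rintegral _ _ _) RintegralZl// -sqr_L2norm/= mul1r.
    have /(ler_wpM2l (exprn_ge0 k (ler0n R 4))) := vC k k.+1 (leqnSn k).
    by rewrite -exprMn (_ : 4 * 16^-1 = 4^-1 :> R)//; lra.
  have cg : cvgn (series (geometric 1 (4^-1 : R))).
    by apply: is_cvg_geometric_series; rewrite ger0_norm; lra.
  rewrite (_ : (\sum_(0 <= k <oo) _)%E = (limn (series (geometric 1 (4^-1 : R))))%:E) ?ltry//.
  rewrite -EFin_lim//; congr (limn _); apply/funext => k /=.
  by rewrite seriesEnat /= sumEFin.
pose E := [set u | (S u < +oo)%E].
have mE : measurable E.
  by have := emeasurable_fun_infty_o measurableT mS +oo%E; rewrite setTI.
have aeE : {ae leb, forall u, E u}.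
  have := integrable_ae measurableT Sint; apply: filterS => u /(_ I).
  by rewrite /E /= ge0_fin_numE.
have incr u : E u -> exists M : R, forall k, normc (v k.+1 u - v k u) <= M * 2^-1 ^+ k.
  move=> Eu; exists (Num.sqrt (fine (S u))) => k.
  have Su : 0 <= fine (S u) by exact: fine_ge0.
  rewrite -(@ler_pXn2r _ 2)// ?nnegrE ?normc_ge0 ?mulr_ge0 ?sqrtr_ge0 ?exprn_ge0//.
  rewrite exprMn sqr_sqrtr// -exprM mulnC exprM (_ : 2^-1 ^+ 2 = 4^-1 :> R); last by lra.
  rewrite exprVn ler_pdivlMr ?exprn_gt0// mulrC -/(dd k u) -lee_fin fineK ?ge0_fin_numE//.
  rewrite /S (@nneseriesD1 _ _ k)//=; last by move=> i _; rewrite lee_fin.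
  by rewrite leeDl// nneseries_ge0// => i _ _; rewrite lee_fin.
pose w u := if u \in E then
   Complex (limn (fun k => complex.Re (v k u))) (limn (fun k => complex.Im (v k u))) else 0.
have cvgRe u : E u -> (fun k => complex.Re (v k u)) @ \oo --> complex.Re (w u).
  move=> Eu; rewrite /w mem_set//=; have [M hM] := incr _ Eu.
  apply: (@cvg_geometric_increments _ _ M) => k.
  by rewrite (le_trans _ (hM k))// (le_trans _ (abs_Re_le_normc _))//; case: (v k.+1 u) (v k u) => ? ? [].
have cvgIm u : E u -> (fun k => complex.Im (v k u)) @ \oo --> complex.Im (w u).
  move=> Eu; rewrite /w mem_set//=; have [M hM] := incr _ Eu.
  apply: (@cvg_geometric_increments _ _ M) => k.
  by rewrite (le_trans _ (hM k))// (le_trans _ (abs_Im_le_normc _))//; case: (v k.+1 u) (v k u) => ? ? [].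
have m1E : measurable_fun setT (\1_E : _ -> R) by exact: measurable_indic.
have mw : cmeasurable w.
  split.
    apply: (@measurable_realfun.measurable_fun_cvg _ _ _ _ (fun k u => \1_E u * complex.Re (v k u))).
      by move=> k; apply: measurable_funM => //; case: (v2 k) => -[].
    move=> u _; rewrite indicE; have [uE|uE] := boolP (u \in E).
      by under eq_fun do rewrite mul1r; apply: cvgRe; exact: set_mem.
    by under eq_fun do rewrite mul0r; rewrite /w (negbTE uE); exact: cvg_cst.
  apply: (@measurable_realfun.measurable_fun_cvg _ _ _ _ (fun k u => \1_E u * complex.Im (v k u))).
    by move=> k; apply: measurable_funM => //; case: (v2 k) => -[].
  move=> u _; rewrite indicE; have [uE|uE] := boolP (u \in E).
    by under eq_fun do rewrite mul1r; apply: cvgIm; exact: set_mem.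
  by under eq_fun do rewrite mul0r; rewrite /w (negbTE uE); exact: cvg_cst.
have mwv k : cmeasurable (fun u => w u - v k u).
  have := cmeasurableD mw (cmeasurableM (cmeasurable_cst _ (-1)) (v2 k).1).
  by under eq_fun do rewrite mulN1r.
have key k : (\int[leb]_u (normc (w u - v k u) ^+ 2)%:E <= (16^-1 ^+ k)%:E)%E.
  rewrite (_ : (\int[leb]_u _ = \int[leb]_u (\1_E u * normc (w u - v k u) ^+ 2)%:E)%E); last first.
    apply: ae_eq_integral => //.
    - exact/measurable_EFinP/measurable_normc_sq.
    - apply/measurable_EFinP/measurable_funM => //; exact/measurable_normc_sq.
    - by apply: filterS aeE => u Eu _; rewrite indicE mem_set// mul1r.
  pose F m u : \bar R := (\1_E u * normc (v m u - v k u) ^+ 2)%:E.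
  have mF m : measurable_fun setT (F m).
    apply/measurable_EFinP/measurable_funM => //; apply/measurable_normc_sq.
    by case: (L2B (v2 m) (v2 k)).
  have F0 m u : (0 <= F m u)%E by rewrite lee_fin mulr_ge0 ?sqr_ge0.
  rewrite (_ : (\int[leb]_u _)%E = \int[leb]_u (limn_einf (F^~ u)))%E; last first.
    apply: eq_integral => u _; symmetry; apply: (fun h => (cvg_limn_einf_sup h).1).
    apply: cvg_EFin; first by near=> m.
    rewrite indicE; have [uE|uE] := boolP (u \in E); last first.
      by under eq_fun do rewrite /F /= indicE (negbTE uE) mul0r;
         rewrite mul0r; exact: cvg_cst.
    rewrite mul1r; rewrite (_ : _ \o _ = (fun m => normc (v m u - v k u) ^+ 2)); last first.
      by apply/funext => m /=; rewrite indicE uE mul1r.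
    apply: cvg_normc_sq.
      under eq_fun do rewrite raddfB; rewrite raddfB.
      by apply: cvgB; [exact/cvgRe/set_mem|exact: cvg_cst].
    under eq_fun do rewrite raddfB; rewrite raddfB.
    by apply: cvgB; [exact/cvgIm/set_mem|exact: cvg_cst].
  apply: le_trans (fatou _ _ _ _) _ => //.
  rewrite limn_einf_lim; apply: lime_le; first exact: is_cvg_einfs.
  near=> j; rewrite /einfs /=.
  apply: ge_ereal_inf; exists (\int[leb]_u F (maxn j k) u)%E.
    by exists (maxn j k) => //=; exact: leq_maxl.
  have jk : (k <= maxn j k)%N := leq_maxr j k.
  have i2 := L2_sq_integrable (L2B (v2 (maxn j k)) (v2 k)).
  apply: (@le_trans _ _ (\int[leb]_u (normc (v (maxn j k) u - v k u) ^+ 2)%:E)%E).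
    apply: ge0_le_integral => //; first exact: measurable_int i2.
    move=> u _; rewrite lee_fin indicE.
    by case: (u \in E); rewrite ?mul1r// mul0r sqr_ge0.
  rewrite -[leLHS]fineK ?(integrable_fin_num _ i2)//.
  by rewrite lee_fin -/(Rintegral _ _ _) -sqr_L2norm vC.
have w2 : L2 w.
  have : L2 (fun u => w u - v 0%N u).
    by split => //; rewrite (le_lt_trans (key 0%N))// ltry.
  by move=> /L2D /(_ (v2 0%N)); under eq_fun do rewrite subrK.
exists w => // k.
rewrite sqr_L2norm -lee_fin /Rintegral fineK//.
by apply: (integrable_fin_num _ (L2_sq_integrable (L2B w2 (v2 k)))).
Unshelve. all: by end_near. Qed.

(** Used at the end of the proof of the Riesz theorem, to let an approximation
    index tend to infinity without mentioning limits. *)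
Lemma geometric_bound_le0 (x c : R) : (forall k, x <= c * 4^-1 ^+ k) -> x <= 0.
Proof.
move=> xc; have z1 : `|4^-1 : R| < 1 by rewrite ger0_norm; lra.
have cg := @cvg_geometric R c _ z1.
rewrite -(cvg_lim (@Rhausdorff R) cg); apply: limr_ge.
  by apply/cvg_ex; exists 0; exact: cg.
by near=> k; exact: xc.
Unshelve. all: by end_near. Qed.

(** The representing vector minimises J(v) = |v|^2 - 2 Re l(v). This functional
    is bounded below by - M^2; by the parallelogram identity, minimising
    sequences are Cauchy; and the vanishing of the first variation at the
    minimum reads Re <v, g> = Re l(g). Replacing g by i g gives the imaginary
    parts. *)
Lemma riesz (l : fct -> R[i]) (M : R) : 0 <= M ->
  (forall f g, L2 f -> L2 g -> l (fun u => f u + g u) = l f + l g) ->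
  (forall c f, L2 f -> l (fun u => c * f u) = conjc c * l f) ->
  (forall f, L2 f -> normc (l f) <= M * L2norm f) ->
  exists2 v : fct, L2 v & forall g, L2 g -> inner v g = l g.
Proof.
move=> M0 lD lZ lM.
pose J (v : fct) := L2norm v ^+ 2 - 2 * complex.Re (l v).
have L20 : L2 ((fun=> 0) : fct).
  split; first exact: cmeasurable_cst.
  by under eq_integral do rewrite Normc.normc0 expr0n; rewrite integral0.
have Jlb v : L2 v -> - M ^+ 2 <= J v.
  move=> v2; have := lM v v2; have := abs_Re_le_normc (l v).
  have := ler_norm (complex.Re (l v)); have := sqr_ge0 (L2norm v - M).
  rewrite /J; nra.
pose A := [set J v | v in [set v | L2 v]].
have hA : has_inf A.
  split; first by exists (J (fun=> 0)); exists (fun=> 0).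
  by exists (- M ^+ 2) => _ [v v2 <-]; exact: Jlb.
pose m := inf A.
have Jm v : L2 v -> m <= J v by move=> v2; apply: ge_inf; [case: hA|exists v].
have [k|v hv] :=
    @choice _ _ (fun k v => L2 v /\ J v <= m + 16^-1 ^+ k / 4).
  have e0 : 0 < 16^-1 ^+ k / 4 :> R by rewrite divr_gt0 ?exprn_gt0// invr_gt0.
  by have [_ [v v2 <-] /ltW ?] := inf_adherent e0 hA; exists v.
have v2 k : L2 (v k) by case: (hv k).
have ReD2 f g : L2 f -> L2 g ->
    complex.Re (l (fun u => f u + g u)) = complex.Re (l f) + complex.Re (l g).
  by move=> f2 g2; rewrite lD// ReD.
have ReZ (t : R) f : L2 f ->
    complex.Re (l (fun u => t%:C%C * f u)) = t * complex.Re (l f).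
  by move=> f2; rewrite lZ// ReM /=; ring.
have nZ (t : R) f : L2 f -> L2norm (fun u => t%:C%C * f u) ^+ 2 = t ^+ 2 * L2norm f ^+ 2.
  by move=> f2; rewrite L2normZ// normc_real exprMn real_normK// num_real.
have vC k j : (k <= j)%N ->
    L2norm (fun u => v j u - v k u) ^+ 2 <= 16^-1 ^+ k.
  move=> kj.
  have jd : 16^-1 ^+ j <= 16^-1 ^+ k :> R by apply: ler_wiXn2l => //; lra.
  have vn2 := L2Z (-1) (v2 k).
  have sD := sqr_L2normD (v2 j) (v2 k).
  have sB := sqr_L2normD (v2 j) vn2.
  have JS := Jm _ (L2Z (2^-1)%:C%C (L2D (v2 j) (v2 k))).
  rewrite /J nZ ?ReZ ?ReD2 in JS; try by [exact: L2D|].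
  have := (hv k).2; have := (hv j).2; rewrite /J.
  move: sB; under eq_fun do rewrite mulN1r; move=> ->.
  rewrite innerZr// L2normZ// normc_opp Normc.normc1 mul1r.
  rewrite (_ : complex.Re (conjc (-1) * _) = - complex.Re (inner (v j) (v k))); last first.
    by rewrite ReM /=; ring.
  move: JS; rewrite sD; lra.
have [w w2 hw] := L2_complete v2 vC.
exists w => // g g2.
have main g' : L2 g' -> complex.Re (inner w g') = complex.Re (l g').
  move=> {}g2; apply/eqP; rewrite -subr_eq0 -normr_le0; apply/eqP.
  apply/eqP/(@geometric_bound_le0 _ ((4^-1 + L2norm g' ^+ 2) / 2 + L2norm g')) => k.
  set x : R := 4^-1 ^+ k.
  have x0 : 0 < x by rewrite exprn_gt0// invr_gt0.
  have x2 : 16^-1 ^+ k = x ^+ 2.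
    by rewrite /x -exprM mulnC exprM; congr (_ ^+ _); rewrite expr2; lra.
  have wk : `|complex.Re (inner w g') - complex.Re (inner (v k) g')| <= x * L2norm g'.
    rewrite (_ : _ - _ = complex.Re (inner (fun u => w u - v k u) g')); last first.
      by rewrite innerB// raddfB.
    rewrite (le_trans (abs_Re_le_normc _))// (le_trans (cauchy_schwarz (L2B _ _) _))//.
    rewrite ler_wpM2r ?L2norm_ge0// -(@ler_pXn2r _ 2)// ?nnegrE ?L2norm_ge0 ?(ltW x0)//.
    by rewrite -x2.
  set a := complex.Re (inner (v k) g') - complex.Re (l g').
  (* Moving v_k by t g' cannot decrease J by more than its distance x^2 / 4 to
     the infimum; the choice t = x or t = - x bounds the first variation a. *)
  have at_ t : 0 <= x ^+ 2 / 4 + 2 * t * a + t ^+ 2 * L2norm g' ^+ 2.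
    have tg2 := L2Z t%:C%C g2.
    have := Jm _ (L2D (v2 k) tg2); rewrite /J sqr_L2normD// ReD2// ReZ// nZ//.
    have := (hv k).2; rewrite x2 /J innerZr//.
    rewrite (_ : complex.Re (conjc t%:C%C * inner (v k) g') =
      t * complex.Re (inner (v k) g')); last by rewrite ReM /=; ring.
    by rewrite /a; lra.
  have ax : `|a| <= x * ((4^-1 + L2norm g' ^+ 2) / 2).
    have [_|_] := ger0P a; rewrite -(ler_pM2l x0).
      by have := at_ (- x); nra.
    by have := at_ x; nra.
  rewrite (_ : _ - _ = (complex.Re (inner w g') - complex.Re (inner (v k) g')) + a); last first.
    by rewrite /a; ring.
  rewrite (le_trans (ler_normD _ _))//; lra.
apply: complexP; first exact: main.
have := main _ (L2Z 'i%C g2); rewrite innerZr// lZ// !ReM /=.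
by rewrite !mul0r !sub0r => /oppr_inj; rewrite !mulN1r => /oppr_inj.
Qed.

End L2_complete.

(** * Measure-preserving maps *)

Section measure_preserving.
Context d (T : measurableType d) (R : realType).
Implicit Type mu : {measure set T -> \bar R}.

(** Invariance is required of integrals of nonnegative functions, rather than
    of measures of sets, because the maps used here are products and shears,
    to which the Tonelli theorem applies directly. *)
Definition mpres mu (rho : T -> T) := measurable_fun setT rho /\
  forall f : T -> \bar R, measurable_fun setT f -> (forall x, 0 <= f x)%E ->
    (\int[mu]_x f (rho x) = \int[mu]_x f x)%E.

Variables (mu : {measure set T -> \bar R}) (rho : T -> T).
Hypothesis rho_mu : mpres mu rho.

Lemma mpres_comp sigma : mpres mu sigma -> mpres mu (rho \o sigma).
Proof.
case: rho_mu => mr er [ms es]; split; first exact: measurableT_comp.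
move=> f mf f0 /=; rewrite -(er f mf f0) -(es (f \o rho) (measurableT_comp mf mr))// => x.
exact: f0.
Qed.

Lemma mpres_iter k : mpres mu (iter k rho).
Proof.
elim: k => [|k ih]; first by split => //; exact: measurable_id.
case: rho_mu => mr er; case: ih => ms es.
split; first exact: (@measurableT_comp _ _ _ _ _ _ rho _ (iter k rho)).
move=> f mf f0 /=; rewrite -(er f mf f0) -(es (f \o rho) (measurableT_comp mf mr))// => x.
exact: f0.
Qed.

Lemma mpres_integrable (f : T -> R) : mu.-integrable setT (EFin \o f) ->
  mu.-integrable setT (EFin \o (f \o rho)).
Proof.
case: rho_mu => mr er fi; have mf := measurable_int _ fi.
have /integrableP[_ foo] := fi; apply/integrableP; split.
  exact: (measurableT_comp mf mr).
rewrite (er (abse \o (EFin \o f)))//; first exact: measurableT_comp.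
by move=> x; exact: abse_ge0.
Qed.

Lemma mpres_Rintegral (f : T -> R) : mu.-integrable setT (EFin \o f) ->
  \int[mu]_x f (rho x) = \int[mu]_x f x.
Proof.
case: (rho_mu) => mr er fi; have mf := measurable_int _ fi.
congr fine; rewrite integralE [RHS]integralE; congr (_ - _)%E.
  rewrite -(er _ (measurable_funepos mf) (fun x => funepos_ge0 _ x)).
  by apply: eq_integral => x _; rewrite unlock.
rewrite -(er _ (measurable_funeneg mf) (fun x => funeneg_ge0 _ x)).
by apply: eq_integral => x _; rewrite unlock.
Qed.

Lemma mpres_cintegrable (f : T -> R[i]) : cintegrable mu f ->
  cintegrable mu (f \o rho).
Proof.
move=> [f1 f2]; split; first exact: (mpres_integrable f1).
exact: (mpres_integrable f2).
Qed.

Lemma mpres_cintegral (f : T -> R[i]) : cintegrable mu f ->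
  cintegral mu (f \o rho) = cintegral mu f.
Proof.
move=> [f1 f2]; rewrite /cintegral; congr Complex; first exact: (mpres_Rintegral f1).
exact: (mpres_Rintegral f2).
Qed.

End measure_preserving.

Section shears.
Context d1 d2 (T1 : measurableType d1) (T2 : measurableType d2) (R : realType).
Variables (m1 : {sigma_finite_measure set T1 -> \bar R})
          (m2 : {sigma_finite_measure set T2 -> \bar R}).

(** By the Tonelli theorem, it suffices that each slice preserves the measure;
    the map may depend on the slice. *)
Lemma mpres_shear1 (rho : T2 -> T1 -> T1) :
  measurable_fun setT (fun z : T1 * T2 => (rho z.2 z.1, z.2)) ->
  (forall y, mpres m1 (rho y)) ->
  mpres (m1 \x m2)%E (fun z => (rho z.2 z.1, z.2)).
Proof.
move=> mr er; split => // f mf f0.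
rewrite fubini_tonelli2//; last exact: measurableT_comp.
rewrite fubini_tonelli2//; apply: eq_integral => y _.
rewrite /fubini_G /= (proj2 (er y) (fun x => f (x, y)))//.
exact: measurableT_comp.
Qed.

Lemma mpres_shear2 (rho : T1 -> T2 -> T2) :
  measurable_fun setT (fun z : T1 * T2 => (z.1, rho z.1 z.2)) ->
  (forall x, mpres m2 (rho x)) ->
  mpres (m1 \x m2)%E (fun z => (z.1, rho z.1 z.2)).
Proof.
move=> mr er; split => // f mf f0.
rewrite fubini_tonelli1//; last exact: measurableT_comp.
rewrite fubini_tonelli1//; apply: eq_integral => x _.
rewrite /fubini_F /= (proj2 (er x) (fun y => f (x, y)))//.
exact: measurableT_comp.
Qed.

Lemma mpres_prod rho1 rho2 : mpres m1 rho1 -> mpres m2 rho2 ->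
  mpres (m1 \x m2)%E (fun z => (rho1 z.1, rho2 z.2)).
Proof.
move=> h1 h2; have [mr1 _] := h1; have [mr2 _] := h2.
apply: (@mpres_comp _ _ _ _ (fun z => (rho1 z.1, z.2)) _ (fun z => (z.1, rho2 z.2))).
  apply: (mpres_shear1 (rho := fun=> rho1)) => //.
  by apply: measurable_fun_pair => //; exact: measurableT_comp.
apply: (mpres_shear2 (rho := fun=> rho2)) => //.
by apply: measurable_fun_pair => //; exact: measurableT_comp.
Qed.

End shears.

(** * Lebesgue measure on R^n and Gaussian integrals *)

Section lebesgue_row_invariance.
Context {R : realType}.

(** The translated measure gives half-open intervals their lengths, which
    characterises Lebesgue measure. *)
Lemma mpres_shift1 (a : R) : mpres (@lebesgue_measure R)
  ((fun x => x + a) : measurableTypeR R -> measurableTypeR R).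
Proof.
have ma : measurable_fun setT
    ((fun x => x + a) : measurableTypeR R -> measurableTypeR R).
  by apply: measurable_funD.
split => // f mf f0.
have := ge0_integral_pushforward ma (@lebesgue_measure R) measurableT mf
  (fun x _ => f0 x).
rewrite preimage_setT => <-; apply: eq_measure_integral => A mA _; apply/esym/lebesgue_measure_unique => //.
move=> _ [[x y] _ <-] /=; rewrite /pushforward.
rewrite (_ : _ @^-1` _ = `]x - a, y - a]%classic); last first.
  by apply/seteqP; split => z /=; rewrite !in_itv /= ltrBlDr lerBrDr.
rewrite !lebesgue_measure_itv/= !lte_fin ltrD2r -!EFinB.
by case: ifPn => // _; congr EFin; ring.
Qed.

Lemma integral_lebesgue_rowS n (f : 'rV[R]_n.+1 -> \bar R) :
  measurable_fun setT f -> (forall u, 0 <= f u)%E ->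
  (\int[@lebesgue_row R n.+1]_u f u =
   \int[@lebesgue_measure R \x @lebesgue_row R n]_p f (row_cons p))%E.
Proof.
move=> mf f0; rewrite -[LHS]/(\int[lebesgue_cons _]_u f u)%E.
by rewrite (ge0_integral_pushforward (@measurable_row_cons R n)).
Qed.

Lemma measurable_row_shift n (a : 'rV[R]_n) :
  measurable_fun setT (fun u : 'rV[R]_n => u + a).
Proof.
apply: measurable_fun_rowP => i; under eq_fun do rewrite mxE.
by apply: measurable_funD => //; exact: measurable_row_coord.
Qed.

Lemma row_consD n (p q : R * 'rV[R]_n) :
  row_cons p + row_cons q = row_cons (p + q).
Proof.
apply/rowP => i; rewrite mxE /row_cons.
case: (split_ordP (i : 'I_(1 + n))) => j ->.
  by rewrite !(@row_mxEl _ 1 1 n) !mxE.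
by rewrite !(@row_mxEr _ 1 1 n) mxE.
Qed.

Lemma row_unconsK n : cancel (@row_uncons R n) (@row_cons R n).
Proof.
move=> v; apply/rowP => i; rewrite /row_cons /row_uncons/=.
case: (split_ordP (i : 'I_(1 + n))) => j ->.
  rewrite (@row_mxEl _ 1 1 n) mxE ord1; congr (v _ _); exact/val_inj.
by rewrite (@row_mxEr _ 1 1 n) mxE.
Qed.

Lemma mpres_row_shift n (a : 'rV[R]_n) :
  mpres (@lebesgue_row R n) (fun u => u + a).
Proof.
elim: n a => [|n ih] a; split; try exact: measurable_row_shift.
  by move=> f mf f0; apply: eq_integral => u _; congr f; apply/rowP => -[].
move=> f mf f0.
have mfa : measurable_fun setT (fun u : 'rV[R]_n.+1 => f (u + a)).
  exact: (measurableT_comp mf (measurable_row_shift a)).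
rewrite !integral_lebesgue_rowS//.
have [_ /(_ (f \o @row_cons R n)) <-//] :=
  mpres_prod (mpres_shift1 (row_uncons a).1) (ih (row_uncons a).2).
- by apply: eq_integral => p _ /=; rewrite -{1}(row_unconsK a) row_consD.
- exact: (measurableT_comp mf (@measurable_row_cons R n)).
- by move=> p; exact: f0.
Qed.

(** The integrand is the density of the centred normal law of variance c / 2,
    up to normalisation. *)
Lemma gauss_integral1 (c : R) : 0 < c ->
  (\int[@lebesgue_measure R]_x (expR (- (x * x / c)))%:E =
   (Num.sqrt (pi * c))%:E)%E.
Proof.
move=> c0; pose s := Num.sqrt (c / 2).
have s2 : s ^+ 2 * 2 = c by rewrite sqr_sqrtr ?divr_ge0 ?(ltW c0)// divfK.
have s0 : s != 0 by rewrite gt_eqF// sqrtr_gt0 divr_gt0.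
have pk : normal_peak s = (Num.sqrt (pi * c))^-1.
  by rewrite /normal_peak -s2; congr (Num.sqrt _)^-1; ring.
have sc0 : Num.sqrt (pi * c) != 0 by rewrite gt_eqF// sqrtr_gt0 mulr_gt0 ?pi_gt0.
under eq_integral => x _.
  rewrite (_ : expR _ = Num.sqrt (pi * c) * normal_pdf 0 s x); last first.
    rewrite normal_pdfE// pk /normal_fun subr0 -[_ *+ 2]mulr_natr s2 mulVKf// expr2 mulNr//.
  rewrite EFinM; over.
rewrite ge0_integralZl//.
- by rewrite integral_normal_pdf mule1.
- by apply/measurable_EFinP; exact: measurable_normal_pdf.
- by move=> x _; rewrite lee_fin normal_pdf_ge0.
Qed.

Lemma dotr_row_cons n (p : R * 'rV[R]_n) :
  dotr (row_cons p) (row_cons p) = p.1 * p.1 + dotr p.2 p.2.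
Proof.
rewrite /dotr big_ord_recl; congr (_ + _).
  rewrite (_ : ord0 = lshift n (0 : 'I_1)); last exact/val_inj.
  by rewrite /row_cons (@row_mxEl _ 1 1 n) mxE.
apply: eq_bigr => i _; rewrite (_ : lift ord0 i = rshift 1 i); last exact/val_inj.
by rewrite /row_cons (@row_mxEr _ 1 1 n).
Qed.

Lemma measurable_dotr n d (T : measurableType d) (f g : T -> 'rV[R]_n) :
  measurable_fun setT f -> measurable_fun setT g ->
  measurable_fun setT (fun x => dotr (f x) (g x)).
Proof.
move=> mf mg; apply: measurable_sum => i; apply: measurable_funM.
  exact: (measurableT_comp (measurable_row_coord i) mf).
exact: (measurableT_comp (measurable_row_coord i) mg).
Qed.

Lemma gauss_integral_row n (c : R) : 0 < c ->
  (\int[@lebesgue_row R n]_u (expR (- (dotr u u / c)))%:E =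
   (Num.sqrt (pi * c) ^+ n)%:E)%E.
Proof.
move=> c0.
have mE m : measurable_fun setT (fun u : 'rV[R]_m => (expR (- (dotr u u / c)))%:E).
  apply/measurable_EFinP; apply: measurableT_comp => //.
  apply: measurableT_comp => //; apply: measurable_funM => //.
  exact: measurable_dotr.
elim: n => [|n ih].
  rewrite integral_dirac//; last exact: mE.
  rewrite /dotr.
  rewrite big_ord0 mul0r oppr0 expR0 mule1.
  exact: diracT.
rewrite integral_lebesgue_rowS//.
under eq_integral do rewrite dotr_row_cons mulrDl opprD expRD EFinM.
have mx : measurable_fun setT
    (fun x : measurableTypeR R => (expR (- (x * x / c)))%:E).
  apply/measurable_EFinP; apply: measurableT_comp => //.
  apply: measurableT_comp => //; apply: measurable_funM => //.
  exact: measurable_funM.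
rewrite fubini_tonelli1//; last first.
  apply: emeasurable_funM; first exact: (measurableT_comp mx measurable_fst).
  exact: (measurableT_comp (mE n) measurable_snd).
transitivity (\int[@lebesgue_measure R]_x
    ((expR (- (x * x / c)))%:E * (Num.sqrt (pi * c) ^+ n)%:E))%E.
  apply: eq_integral => x _; rewrite /fubini_F /= -ih ge0_integralZl//.
  exact: mE.
rewrite ge0_integralZr ?gauss_integral1 ?exprS//.
Qed.

End lebesgue_row_invariance.

(** * Holomorphic functions of one variable *)

Section strict_holomorphy.
Context {R : realType}.
Implicit Types (g : R[i] -> R[i]) (a z w : R[i]).

(** Strict differentiability, in which both points of the difference quotient
    move. It holds for the functions considered here because they are analytic,
    and products and compositions preserve it. *)
Definition strict_cderiv g a (l : R[i]) := forall e : R, 0 < e ->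
  exists2 d : R, 0 < d & forall z w, normc (z - a) < d -> normc (w - a) < d ->
    normc (g w - g z - l * (w - z)) <= e * normc (w - z).

Definition strict_holo g := forall a, exists l, strict_cderiv g a l.

Lemma normc_triangle3 a z w : normc (z - w) <= normc (z - a) + normc (a - w).
Proof. by rewrite -{1}(subrK a z) -addrA normc_triangle. Qed.

Lemma normc_triangle4 (x y z w : R[i]) :
  normc (x + y + z + w) <= normc x + normc y + normc z + normc w.
Proof.
do 2 rewrite (le_trans (normc_triangle _ _))// lerD2r.
exact: normc_triangle.
Qed.

Lemma strict_cderiv_cont g a l : strict_cderiv g a l -> forall e : R, 0 < e ->
  exists2 d : R, 0 < d & forall z, normc (z - a) < d -> normc (g z - g a) < e.
Proof.
move=> gl e e0; have [d d0 H] := gl 1 ltr01.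
have l0 : 0 < 2 + normc l by rewrite ltr_wpDr// normc_ge0.
exists (Num.min d (e / (2 + normc l))); first by rewrite lt_min d0 divr_gt0.
move=> z; rewrite lt_min => /andP[zd ze].
have aa : normc (a - a) < d by rewrite subrr Normc.normc0.
have := H a z aa zd; rewrite mul1r => h.
have : normc (g z - g a) <= normc (g z - g a - l * (z - a)) + normc (l * (z - a)).
  by rewrite -{1}(subrK (l * (z - a)) (g z - g a)) normc_triangle.
rewrite Normc.normcM; move: ze; rewrite ltr_pdivlMr//.
have := normc_ge0 (z - a); lra.
Qed.

Lemma strict_cderiv_cst (c : R[i]) a : strict_cderiv (fun=> c) a 0.
Proof.
move=> e e0; exists 1 => // z w _ _.
by rewrite subrr mul0r subr0 Normc.normc0 mulr_ge0 ?(ltW e0)// normc_ge0.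
Qed.

Lemma strict_cderiv_affine (c b : R[i]) a :
  strict_cderiv (fun z => c * z + b) a c.
Proof.
move=> e e0; exists 1 => // z w _ _.
by rewrite opprD addrACA subrr addr0 -mulrBr subrr Normc.normc0 mulr_ge0 ?(ltW e0)// normc_ge0.
Qed.

(** The difference of the products is split into four terms, each of which
    carries one small factor; the constant 5 leaves room for their sum. *)
Lemma strict_cderivM g1 g2 a l1 l2 :
  strict_cderiv g1 a l1 -> strict_cderiv g2 a l2 ->
  strict_cderiv (fun z => g1 z * g2 z) a (l1 * g2 a + g1 a * l2).
Proof.
move=> h1 h2 e e0.
pose K := 1 + normc (g1 a) + normc (g2 a) + normc l1 + normc l2.
have K1 : 1 <= K by rewrite /K -!addrA lerDl !addr_ge0 ?normc_ge0.
pose e1 := Num.min 1 (e / (5 * K)).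
have K5 : 0 < 5 * K by lra.
have e10 : 0 < e1 by rewrite lt_min ltr01 divr_gt0.
have e11 : e1 <= 1 by rewrite ge_min lexx.
have e1e : e1 * (5 * K) <= e by rewrite -ler_pdivlMr// ge_min lexx orbT.
have [d1 d10 H1] := h1 _ e10; have [d2 d20 H2] := h2 _ e10.
have [d3 d30 H3] := strict_cderiv_cont h1 e10.
have [d4 d40 H4] := strict_cderiv_cont h2 e10.
exists (Num.min (Num.min d1 d2) (Num.min d3 d4)); first by rewrite !lt_min d10 d20 d30 d40.
move=> z w; rewrite !lt_min => /andP[/andP[z1 z2] /andP[z3 z4]].
move=> /andP[/andP[w1 w2] /andP[w3 w4]].
have {}H1 := H1 _ _ z1 w1; have {}H2 := H2 _ _ z2 w2.
have {}H3 := ltW (H3 _ z3); have {}H4 := ltW (H4 _ w4).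
set D := w - z in H1 H2 *.
have -> : g1 w * g2 w - g1 z * g2 z - (l1 * g2 a + g1 a * l2) * D =
   (g1 w - g1 z - l1 * D) * g2 w + g1 z * (g2 w - g2 z - l2 * D)
   + l1 * D * (g2 w - g2 a) + l2 * D * (g1 z - g1 a) by ring.
have g2w : normc (g2 w) <= K.
  have := normc_triangle (g2 w - g2 a) (g2 a); rewrite subrK /K.
  have := normc_ge0 (g1 a); have := normc_ge0 l1; have := normc_ge0 l2; lra.
have g1z : normc (g1 z) <= K.
  have := normc_triangle (g1 z - g1 a) (g1 a); rewrite subrK /K.
  have := normc_ge0 (g2 a); have := normc_ge0 l1; have := normc_ge0 l2; lra.
have l1K : normc l1 <= K.
  rewrite /K; have := normc_ge0 (g1 a); have := normc_ge0 (g2 a).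
  have := normc_ge0 l2; lra.
have l2K : normc l2 <= K.
  rewrite /K; have := normc_ge0 (g1 a); have := normc_ge0 (g2 a).
  have := normc_ge0 l1; lra.
have D0 := normc_ge0 D.
have K0 : 0 <= K by lra.
have b1 : normc ((g1 w - g1 z - l1 * D) * g2 w) <= e1 * normc D * K.
  by rewrite Normc.normcM ler_pM ?normc_ge0.
have b2 : normc (g1 z * (g2 w - g2 z - l2 * D)) <= K * (e1 * normc D).
  by rewrite Normc.normcM ler_pM ?normc_ge0.
have b3 : normc (l1 * D * (g2 w - g2 a)) <= K * normc D * e1.
  by rewrite !Normc.normcM ler_pM ?mulr_ge0 ?normc_ge0// ler_wpM2r.
have b4 : normc (l2 * D * (g1 z - g1 a)) <= K * normc D * e1.
  by rewrite !Normc.normcM ler_pM ?mulr_ge0 ?normc_ge0// ler_wpM2r.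
apply: (le_trans (normc_triangle4 _ _ _ _)).
have := ler_wpM2r D0 e1e; have := mulr_ge0 (mulr_ge0 (ltW e10) K0) D0.
lra.
Qed.

Lemma strict_cderiv_comp g f a lg lf :
  strict_cderiv f a lf -> strict_cderiv g (f a) lg ->
  strict_cderiv (fun z => g (f z)) a (lg * lf).
Proof.
move=> hf hg e e0.
pose K := 1 + normc lf + normc lg.
have lf0 := normc_ge0 lf; have lg0 := normc_ge0 lg.
have K0 : 0 < K by rewrite /K; lra.
pose e1 := Num.min 1 (e / (2 * K)).
have K2 : 0 < 2 * K by lra.
have e10 : 0 < e1 by rewrite lt_min ltr01 divr_gt0.
have e11 : e1 <= 1 by rewrite ge_min lexx.
have e1e : e1 * (2 * K) <= e by rewrite -ler_pdivlMr// ge_min lexx orbT.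
have [d1 d10 H1] := hg _ e10; have [d2 d20 H2] := hf _ e10.
have [d3 d30 H3] := strict_cderiv_cont hf d10.
exists (Num.min d2 d3); first by rewrite lt_min d20 d30.
move=> z w; rewrite !lt_min => /andP[z2 z3] /andP[w2 w3].
have {}H1 := H1 _ _ (H3 _ z3) (H3 _ w3); have {}H2 := H2 _ _ z2 w2.
set D := w - z in H2 *.
have D0 := normc_ge0 D.
have fD : normc (f w - f z) <= K * normc D.
  have := normc_triangle (f w - f z - lf * D) (lf * D).
  rewrite subrK Normc.normcM => h; apply: (le_trans h); rewrite /K.
  have := ler_wpM2r D0 e11; have := mulr_ge0 lg0 D0; lra.
have -> : g (f w) - g (f z) - lg * lf * D =
   (g (f w) - g (f z) - lg * (f w - f z)) + lg * (f w - f z - lf * D) by ring.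
apply: (le_trans (normc_triangle _ _)); rewrite Normc.normcM.
have h1 := ler_wpM2l lg0 H2; have h2 := ler_wpM2l (ltW e10) fD.
have h3 := ler_wpM2r D0 e1e.
have h4 := mulr_ge0 (mulr_ge0 (ltW e10) lf0) D0.
have h5 := mulr_ge0 (ltW e10) D0.
have : e1 * normc D * normc lg <= e1 * normc D * K.
  by rewrite ler_wpM2l// /K; lra.
lra.
Qed.

(** The complex exponential; its derivative is derived from those of the real
    exponential, sine and cosine at the origin. *)
Definition cexp z : R[i] := (expR (complex.Re z))%:C%C * expi (complex.Im z).

Lemma expiD s t : expi (s + t) = expi s * expi t :> R[i].
Proof. by rewrite /expi cosD sinD; simpc; congr Complex; ring. Qed.

Lemma expi0 : expi 0 = 1 :> R[i].
Proof. by rewrite /expi cos0 sin0. Qed.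

Lemma normc_expi t : normc (expi t : R[i]) = 1.
Proof. by rewrite /= cos2Dsin2 sqrtr1. Qed.

Lemma cexpD z w : cexp (z + w) = cexp z * cexp w.
Proof. by rewrite /cexp ReD ImD expRD expiD rmorphM/=; ring. Qed.

Lemma cexp0 : cexp 0 = 1.
Proof. by rewrite /cexp /= expR0 expi0 mulr1. Qed.

Lemma normc_cexp z : normc (cexp z) = expR (complex.Re z).
Proof. by rewrite Normc.normcM normc_expi mulr1 normc_real ger0_norm ?expR_ge0. Qed.

Lemma derive0_littleo (f : R -> R) (l : R) : is_derive (0 : R) 1 f l ->
  forall e, 0 < e -> exists2 d : R, 0 < d &
    forall t, `|t| < d -> `|f t - f 0 - l * t| <= e * `|t|.
Proof.
move=> [fd fl] e e0.
have : (fun h : R => h^-1 *: ((f \o shift 0) (h *: 1) - f 0)) @ 0^' --> l.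
  by rewrite -fl; exact: fd.
move=> /cvgrPdist_le /(_ e e0).
rewrite near_withinE => /nbhs_ballP[d /= d0 H]; exists d => // t td.
have [->|t0] := eqVneq t 0; first by rewrite subrr mulr0 subr0 normr0 mulr0.
have tb : ball 0 d t by rewrite /ball /= sub0r normrN.
have := H _ tb t0; rewrite addr0 scaler1 => h.
rewrite (_ : _ - _ = (t^-1 * (f t - f 0) - l) * t); last by field.
by rewrite normrM ler_wpM2r// -normrN opprB.
Qed.

Lemma expi_littleo (e : R) : 0 < e -> exists2 d : R, 0 < d &
  forall t, `|t| < d -> normc (expi t - 1 - (0 +i* t)%C) <= e * `|t|.
Proof.
move=> e0; have e20 : 0 < e / 2 by rewrite divr_gt0.
have dc : is_derive (0 : R) 1 cos 0.
  by have := is_derive_cos (0 : R); rewrite sin0 oppr0.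
have ds : is_derive (0 : R) 1 sin 1.
  by have := is_derive_sin (0 : R); rewrite cos0.
have [d1 d10 H1] := derive0_littleo dc e20.
have [d2 d20 H2] := derive0_littleo ds e20.
exists (Num.min d1 d2); first by rewrite lt_min d10 d20.
move=> t; rewrite lt_min => /andP[/H1 + /H2].
rewrite cos0 sin0 mul0r mul1r !subr0 => h1 h2.
apply: (le_trans (normc_le_ReIm _)); rewrite /= !subr0.
by move: h1 h2; lra.
Qed.

Lemma cexp_littleo (e : R) : 0 < e -> exists2 d : R, 0 < d &
  forall u, normc u < d -> normc (cexp u - 1 - u) <= e * normc u.
Proof.
move=> e0; have e60 : 0 < Num.min 1 (e / 6) by rewrite lt_min ltr01 divr_gt0.
have [d1 d10 H1] := expi_littleo e60.
have de : is_derive (0 : R) 1 (@expR R) 1.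
  by have := is_derive_expR (0 : R); rewrite expR0.
have [d2 d20 H2] := derive0_littleo de e60.
exists (Num.min (Num.min d1 d2) (Num.min 2^-1 (e / 4))).
  by rewrite !lt_min d10 d20 /= invr_gt0 divr_gt0 ?ltr0n.
move=> [s t]; rewrite !lt_min => /andP[/andP[u1 u2] /andP[u3 u4]].
set u := (s +i* t)%C in u1 u2 u3 u4 *.
have su : `|s| <= normc u := abs_Re_le_normc u.
have tu : `|t| <= normc u := abs_Im_le_normc u.
have {}H1 := H1 _ (le_lt_trans tu u1).
have := H2 _ (le_lt_trans su u2); rewrite expR0 mul1r => {}H2.
have m1 : Num.min 1 (e / 6) <= 1 by rewrite ge_min lexx.
have m2 : Num.min 1 (e / 6) <= e / 6 by rewrite ge_min lexx orbT.
move: (Num.min 1 (e / 6)) e60 m1 m2 H1 H2 => e1 e10 m1 m2 H1 H2.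
have es1 : `|expR s - 1| <= 2 * normc u.
  have := ler_normD (expR s - 1 - s) s; rewrite subrK.
  have := ler_wpM2r (normr_ge0 s) m1; lra.
have es2 : expR s <= 2 by have := ler_norm (expR s - 1); lra.
have -> : cexp u - 1 - u = (expR s)%:C%C * (expi t - 1 - (0 +i* t)%C) +
    ((expR s - 1 - s)%:C)%C + ((expR s - 1)%:C)%C * (0 +i* t)%C.
  by rewrite /cexp /u /expi; simpc; congr Complex; ring.
apply: (le_trans (normc_triangle _ _)).
rewrite Normc.normcM !normc_real.
have -> : normc (0 +i* t)%C = `|t| by rewrite /= expr0n add0r sqrtr_sqr.
have h1 : normc ((expR s)%:C%C * (expi t - 1 - (0 +i* t)%C)) <= 2 * (e1 * normc u).
  rewrite Normc.normcM normc_real ger0_norm ?expR_ge0//.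
  rewrite ler_pM ?expR_ge0 ?normc_ge0//; apply: (le_trans H1).
  by rewrite ler_wpM2l// ltW.
have h2 : `|expR s - 1| * `|t| <= e / 2 * normc u.
  by rewrite ler_pM ?normr_ge0//; lra.
have h3 := ler_wpM2l (ltW e10) su.
have h4 := ler_wpM2r (normc_ge0 u) m2.
have := normc_triangle ((expR s)%:C%C * (expi t - 1 - (0 +i* t)%C)) ((expR s - 1 - s)%:C)%C.
rewrite normc_real; lra.
Qed.

Lemma strict_cderiv_cexp0 : strict_cderiv cexp 0 1.
Proof.
move=> e e0.
have e40 : 0 < Num.min 1 (e / 4) by rewrite lt_min ltr01 divr_gt0.
have [d d0 H] := cexp_littleo e40.
exists (Num.min (d / 2) (Num.min 2^-1 (e / 4))).
  by rewrite !lt_min invr_gt0 !divr_gt0 ?ltr0n.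
move=> z w; rewrite !subr0 mul1r !lt_min => /andP[z1 /andP[z2 z3]] /andP[w1 _].
set u := w - z.
have ud : normc u < d.
  by have := normc_triangle w (- z); rewrite normc_opp -/u; lra.
have zd : normc z < d by have := normc_ge0 z; lra.
have {}H1 := H _ zd; have {}H2 := H _ ud.
have m1 : Num.min 1 (e / 4) <= 1 by rewrite ge_min lexx.
have m2 : Num.min 1 (e / 4) <= e / 4 by rewrite ge_min lexx orbT.
move: (Num.min 1 (e / 4)) e40 m1 m2 H1 H2 {H} => e1 e10 m1 m2 H1 H2.
have ez1 : normc (cexp z - 1) <= 2 * normc z.
  have := normc_triangle (cexp z - 1 - z) z; rewrite subrK.
  have := ler_wpM2r (normc_ge0 z) m1; lra.
have ez2 : normc (cexp z) <= 2.
  by have := normc_triangle (cexp z - 1) 1; rewrite subrK Normc.normc1; lra.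
have -> : cexp w - cexp z - u = cexp z * (cexp u - 1 - u) + (cexp z - 1) * u.
  by rewrite -(subrK z w) -/u cexpD; ring.
apply: (le_trans (normc_triangle _ _)).
rewrite (Normc.normcM (cexp z)) (Normc.normcM (cexp z - 1)).
have h1 : normc (cexp z) * normc (cexp u - 1 - u) <= 2 * (e1 * normc u).
  by rewrite ler_pM ?normc_ge0.
have h2 : normc (cexp z - 1) * normc u <= e / 2 * normc u.
  by rewrite ler_wpM2r ?normc_ge0//; lra.
have h4 := ler_wpM2r (normc_ge0 u) m2.
lra.
Qed.

Lemma strict_cderiv_cexp a : strict_cderiv cexp a (cexp a).
Proof.
have h : strict_cderiv (fun z => cexp (1 * z + - a)) a (1 * 1).
  apply: strict_cderiv_comp; first exact: strict_cderiv_affine.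
  by rewrite mul1r subrr; exact: strict_cderiv_cexp0.
have := strict_cderivM (strict_cderiv_cst (cexp a) a) h.
rewrite mul0r add0r !mulr1 (_ : (fun z => _) = cexp)//.
by apply/funext => z; rewrite -cexpD mul1r subrKC.
Qed.

(** A discrete mean value property. On the polar grid of the points
    p j k = (j / N) omega^k, the increments of g along the j-th circle sum to 0;
    by differentiability they are close to l (p j k) times a fixed multiple of
    omega^k, so that the sum of the l (p j k) omega^k is small. The same sum
    governs the change of the mean of g from the j-th circle to the next one.
    There are N steps, and each of them changes the mean by at most 2 e / N. *)
Section discrete_mean.
Variables (g l : R[i] -> R[i]) (e d : R) (N : nat) (omega : R[i]).
Hypotheses (e0 : 0 <= e) (N0 : (0 < N)%N) (Nd : N%:R^-1 < d).
Hypotheses (omegaN : omega ^+ N = 1) (omega1 : normc omega = 1).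
Hypotheses (omega_neq1 : omega != 1) (omegad : normc (omega - 1) < d).
Hypothesis gl : forall z w, normc z <= 1 -> normc (w - z) < d ->
  normc (g w - g z - l z * (w - z)) <= e * normc (w - z).

Let p (j k : nat) : R[i] := ((j%:R / N%:R)%:C)%C * omega ^+ k.
Let S j := \sum_(k < N) g (p j k).

Lemma normc_natr (k : nat) : normc (k%:R : R[i]) = k%:R.
Proof.
by have := @normc_real R k%:R; rewrite ger0_norm// => <-; rewrite rmorph_nat.
Qed.

Let normc_omegaX k : normc (omega ^+ k) = 1.
Proof.
elim: k => [|k ih]; first by rewrite expr0 Normc.normc1.
by rewrite exprS Normc.normcM omega1 ih mulr1.
Qed.

Let normc_p j k : normc (p j k) = j%:R / N%:R.
Proof.
by rewrite Normc.normcM normc_real normc_omegaX mulr1 ger0_norm// divr_ge0.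
Qed.

Lemma sum_rotation (x : R[i]) : \sum_(k < N) x * omega ^+ k = 0.
Proof.
rewrite -mulr_sumr; apply/eqP; rewrite mulf_eq0; apply/orP; right.
have := subrX1 omega N; rewrite omegaN subrr => /esym/eqP.
by rewrite mulf_eq0 subr_eq0 (negbTE omega_neq1).
Qed.

Let telescope j : \sum_(k < N) (g (p j k.+1) - g (p j k)) = 0.
Proof.
rewrite -(big_mkord xpredT (fun k => g (p j k.+1) - g (p j k))).
by rewrite telescope_sumr// /p omegaN expr0 subrr.
Qed.

Let step j : (j < N)%N -> normc (S j.+1 - S j) <= 2 * e.
Proof.
move=> jN.
have NR : 0 < N%:R :> R by rewrite ltr0n.
have j1 : j%:R / N%:R <= 1 :> R by rewrite ler_pdivrMr// mul1r ler_nat ltnW.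
have jN0 : 0 <= j%:R / N%:R :> R by rewrite divr_ge0.
have pin k : normc (p j k) <= 1 by rewrite normc_p.
have dj k : p j.+1 k - p j k = (N%:R^-1)%:C%C * omega ^+ k.
  by rewrite /p -mulrBl -rmorphB -mulrBl -natrB// subSnn mul1r.
have dk k : p j k.+1 - p j k = (j%:R / N%:R)%:C%C * (omega - 1) * omega ^+ k.
  by rewrite /p exprS; ring.
have ndj k : normc (p j.+1 k - p j k) = N%:R^-1.
  by rewrite dj Normc.normcM normc_real normc_omegaX mulr1 ger0_norm.
have ndk k : normc (p j k.+1 - p j k) = j%:R / N%:R * normc (omega - 1).
  by rewrite dk !Normc.normcM normc_real normc_omegaX mulr1 ger0_norm.
pose L := \sum_(k < N) l (p j k) * omega ^+ k.
have Lle : normc L <= N%:R * e.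
  have [j0|j0] := posnP j.
    rewrite /L (eq_bigr (fun k : 'I_N => l 0 * omega ^+ k)); last first.
      by move=> k _; rewrite /p j0 mul0r mul0r.
    by rewrite sum_rotation Normc.normc0 mulr_ge0.
  have c0 : 0 < j%:R / N%:R * normc (omega - 1).
    rewrite mulr_gt0 ?divr_gt0 ?ltr0n// lt_neqAle normc_ge0 andbT eq_sym.
    by apply: contra omega_neq1 => /eqP/Normc.eq0_normc/eqP; rewrite subr_eq0.
  rewrite -(ler_pM2l c0).
  have -> : j%:R / N%:R * normc (omega - 1) * normc L =
      normc ((j%:R / N%:R)%:C%C * (omega - 1) * L).
    by rewrite !Normc.normcM normc_real ger0_norm.
  have -> : (j%:R / N%:R)%:C%C * (omega - 1) * L =
     - \sum_(k < N) (g (p j k.+1) - g (p j k) - l (p j k) * (p j k.+1 - p j k)).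
    rewrite sumrB telescope sub0r opprK /L mulr_sumr; apply: eq_bigr => k _.
    by rewrite dk; ring.
  rewrite normc_opp (le_trans (normc_sum _ _ _))//.
  apply: (@le_trans _ _ (\sum_(k < N) e * (j%:R / N%:R * normc (omega - 1)))).
    apply: ler_sum => k _; rewrite -(ndk k) gl// ndk (le_lt_trans _ omegad)//.
    by rewrite ler_piMl ?normc_ge0.
  by rewrite sumr_const card_ord -mulr_natl; lra.
have -> : S j.+1 - S j = \sum_(k < N)
    (g (p j.+1 k) - g (p j k) - l (p j k) * (p j.+1 k - p j k)) +
    (N%:R^-1)%:C%C * L.
  rewrite /S /L mulr_sumr -big_split -sumrB; apply: eq_bigr => k _ /=.
  by rewrite dj; ring.
apply: (le_trans (normc_triangle _ _)).
have h1 : normc (\sum_(k < N)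
    (g (p j.+1 k) - g (p j k) - l (p j k) * (p j.+1 k - p j k))) <= e.
  rewrite (le_trans (normc_sum _ _ _))//.
  apply: (@le_trans _ _ (\sum_(k < N) e * N%:R^-1)).
    by apply: ler_sum => k _; rewrite -(ndj k) gl// ndj.
  by rewrite sumr_const card_ord -[leLHS]mulr_natr divfK ?gt_eqF.
have h2 : normc ((N%:R^-1)%:C%C * L) <= e.
  rewrite Normc.normcM normc_real ger0_norm// -(ler_pM2l NR).
  by rewrite mulVKf ?gt_eqF.
lra.
Qed.

Lemma discrete_mean :
  normc (N%:R^-1 * \sum_(k < N) g (omega ^+ k) - g 0) <= 2 * e.
Proof.
have NR : 0 < N%:R :> R by rewrite ltr0n.
have NC : (N%:R : R[i]) != 0 by rewrite pnatr_eq0 -lt0n.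
have SN j : (j <= N)%N -> normc (S j - S 0%N) <= j%:R * (2 * e).
  elim: j => [|j ih] jN; first by rewrite subrr Normc.normc0 mul0r.
  rewrite (le_trans (normc_triangle3 (S j) _ _))// -natr1 mulrDl mul1r addrC.
  by rewrite lerD ?ih ?step// ltnW.
have := SN N (leqnn N).
have -> : S 0%N = N%:R * g 0.
  rewrite /S (eq_bigr (fun=> g 0)) ?sumr_const ?card_ord ?mulr_natl//.
  by move=> k _; rewrite /p mul0r mul0r.
have -> : S N = \sum_(k < N) g (omega ^+ k).
  by apply: eq_bigr => k _; rewrite /p divff ?mul1r// gt_eqF.
move=> h; rewrite -(ler_pM2l NR) (le_trans _ h)// -{1}(normc_natr N).
by rewrite -(Normc.normcM N%:R) mulrBr mulVKf.
Qed.

End discrete_mean.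

End strict_holomorphy.

(** * Means over roots of unity *)

Section circle_average.
Context {R : realType}.

Definition root1 (N : nat) : R[i] := expi (2 * pi / N%:R).

Lemma expiX (t : R) k : expi t ^+ k = expi (t *+ k).
Proof.
elim: k => [|k ih]; first by rewrite expr0 mulr0n expi0.
by rewrite exprS ih mulrS expiD.
Qed.

Lemma root1X N : (0 < N)%N -> root1 N ^+ N = 1.
Proof.
move=> N0; rewrite /root1 expiX.
have -> : 2 * pi / N%:R *+ N = 2 * pi :> R.
  by rewrite -mulr_natr divfK// pnatr_eq0 -lt0n.
by rewrite /expi mulrC mulr_natr cos2pi sin2pi.
Qed.

Lemma sin_root1_gt0 N : (2 < N)%N -> 0 < sin (2 * pi / N%:R : R).
Proof.
move=> N2; have N0 : 0 < N%:R :> R by rewrite ltr0n; case: N N2.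
apply: sin_gt0_pi; rewrite ?divr_gt0 ?mulr_gt0 ?pi_gt0//.
by rewrite ltr_pdivrMr// mulrC ltr_pM2l ?pi_gt0// ltr_nat.
Qed.

Lemma root1_neq1 N : (2 < N)%N -> root1 N != 1.
Proof.
move=> /sin_root1_gt0 h; apply/eqP => /(congr1 (@complex.Im R)) /= h0.
by rewrite h0 ltxx in h.
Qed.

Lemma root1_near1 (d : R) : 0 < d ->
  \forall N \near \oo, normc (root1 N - 1) < d.
Proof.
move=> d0; have [d1 d10 H] := @expi_littleo R 1 ltr01.
have m0 : 0 < Num.min d1 (d / 2) by rewrite lt_min d10 divr_gt0.
near=> N.
have N0 : 0 < N%:R :> R by rewrite ltr0n; near: N; exists 1%N.
have tN : 2 * pi / N%:R < Num.min d1 (d / 2) :> R.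
  rewrite ltr_pdivrMr// -ltr_pdivrMl//.
  by near: N; exact: nbhs_infty_gtr.
have t0 : 0 <= 2 * pi / N%:R :> R by rewrite divr_ge0 ?mulr_ge0 ?pi_ge0// ltW.
move: tN; rewrite lt_min => /andP[t1 t2].
have := H (2 * pi / N%:R); rewrite ger0_norm// mul1r => /(_ t1) h.
have := normc_triangle (root1 N - 1 - (0 +i* (2 * pi / N%:R))%C) (0 +i* (2 * pi / N%:R))%C.
rewrite subrK; have -> : normc ((0 : R) +i* (2 * pi / N%:R))%C = 2 * pi / N%:R.
  by rewrite /= expr0n add0r sqrtr_sqr ger0_norm.
move: h; rewrite /root1; lra.
Unshelve. all: by end_near. Qed.

(** Strictness makes the estimate at a point valid, with the same linear part,
    at all nearby points; a finite cover of the square [-1, 1]^2 then gives one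
    radius for all of them. *)
Lemma strict_holo_uniform (g : R[i] -> R[i]) : strict_holo g ->
  forall e : R, 0 < e -> exists2 d : R, 0 < d & exists l : R[i] -> R[i],
    forall z w, normc z <= 1 -> normc (w - z) < d ->
      normc (g w - g z - l z * (w - z)) <= e * normc (w - z).
Proof.
move=> gh e e0.
pose K := `[(-1 : R), 1]%classic `*` `[(-1 : R), 1]%classic.
have cK : compact K by apply: compact_setX; exact: segment_compact.
pose P (d : R) (p : R * R) := exists l, forall w,
  normc (w - (p.1 +i* p.2)%C) < d ->
  normc (g w - g (p.1 +i* p.2)%C - l * (w - (p.1 +i* p.2)%C))
    <= e * normc (w - (p.1 +i* p.2)%C).
have : \forall d \near 0^'+, K `<=` P d.
  apply: ((compact_near_coveringP K).1 cK) => -[s t] _.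
  have [l /(_ _ e0)[d0 d00 H]] := gh (s +i* t)%C.
  exists (ball (s, t) (d0 / 4), [set d | 0 < d < d0 / 2]).
    split; first by apply: nbhsx_ballx; rewrite divr_gt0.
    by apply: filterS2 (nbhs_right_gt 0) (nbhs_right_lt (divr_gt0 d00 (ltr0n R 2))) => d /= -> ->.
  move=> [[s' t'] d] /= [[bs bt] /andP[dd0 dd1]].
  exists l => w wd; apply: H.
    apply: (le_lt_trans (normc_le_ReIm _)) => /=.
    by move: bs bt; rewrite /ball /= -normrN opprB -[X in _ -> X < _ -> _]normrN opprB; lra.
  rewrite (le_lt_trans (normc_triangle3 (s' +i* t')%C _ _))//.
  have := normc_le_ReIm ((s' +i* t')%C - (s +i* t)%C).
  by move: bs bt; rewrite /ball /= -normrN opprB -[X in _ -> X < _ -> _]normrN opprB; lra.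
move=> KP; have [d [d0 Hd]] := filter_ex (filterI (nbhs_right_gt (0 : R)) KP).
have [z|l Hl] := @choice _ _ (fun z l => normc z <= 1 -> forall w, normc (w - z) < d ->
    normc (g w - g z - l * (w - z)) <= e * normc (w - z)).
  case: z => s t; have [z1|z1] := pselect (normc (s +i* t)%C <= 1); last by exists 0.
  have [|l Hl] := Hd (s, t); last by exists l => _.
  split => /=; rewrite in_itv /= -ler_norml.
    exact: le_trans (abs_Re_le_normc _) z1.
  exact: le_trans (abs_Im_le_normc _) z1.
by exists d => //; exists l => z w z1; exact: Hl.
Qed.

(** Cauchy's mean value property for the unit circle, with Riemann sums in
    place of the integral. *)
Lemma circle_average (g : R[i] -> R[i]) : strict_holo g ->
  forall e : R, 0 < e -> \forall N \near \oo,
    normc (N%:R^-1 * \sum_(k < N) g (root1 N ^+ k) - g 0) <= e.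
Proof.
move=> gh e e0; have e20 : 0 < e / 2 by rewrite divr_gt0.
have [d d0 [l H]] := strict_holo_uniform gh e20.
near=> N.
have N2 : (2 < N)%N by near: N; exists 3%N.
rewrite (_ : e = 2 * (e / 2)); last by rewrite mulrC divfK.
apply: (@discrete_mean R g l (e / 2) d N (root1 N)) => //.
- exact: ltW.
- exact: ltn_trans N2.
- rewrite invf_plt ?posrE ?ltr0n ?(ltn_trans _ N2)//.
  by near: N; exact: nbhs_infty_gtr.
- by apply: root1X; exact: ltn_trans N2.
- exact: normc_expi.
- exact: root1_neq1.
- by near: N; exact: root1_near1.
Unshelve. all: by end_near. Qed.

End circle_average.

(** * Real-analytic functions *)

Section row_norm.
Context {R : realType} (N : nat).
Implicit Types u v : 'rV[R]_N.

Lemma row_norm_ge v i : `|v 0 i| <= `|v|.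
Proof.
rewrite [leRHS]/Num.Def.normr /= mx_normrE; apply/bigmax_geP; right => /=.
by exists (0, i).
Qed.

Lemma row_norm_le v (M : R) : 0 <= M -> (forall i, `|v 0 i| <= M) -> `|v| <= M.
Proof.
move=> M0 vM; rewrite [leLHS]/Num.Def.normr /= mx_normrE; apply/bigmax_leP.
by split => // -[i j] _ /=; rewrite ord1.
Qed.

End row_norm.

Section power_series.
Context {R : realType} (N : nat).
Local Notation row := 'rV[R]_N.
Local Notation expo := ({ffun 'I_N -> nat}).
Implicit Types (u v : row) (k : expo).

(** The real counterpart of [strict_cderiv]: it passes to complex lines and
    gives both continuity and directional derivatives. *)
Definition strict_deriv (f : row -> R) a (L : row -> R) :=
  forall e : R, 0 < e -> exists2 d : R, 0 < d &
    forall u v, `|u - a| < d -> `|v - a| < d ->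
      `|f v - f u - L (v - u)| <= e * `|v - u|.

Definition linear_form (L : row -> R) :=
  forall t u v, L (t *: u + v) = t * L u + L v.

Definition deg k := (\sum_(j < N) k j)%N.

(** For two monomials p and q of degree d, evaluated at points of norm at most M
    that lie at distance D. The three bounds form one predicate because the
    bound on the difference of two products uses the other two. *)
Let close (M D p q : R) (d : nat) :=
  [/\ `|p| <= M ^+ d, `|q| <= M ^+ d & `|p - q| <= d%:R * M ^+ d.-1 * D].

Let closeM M D p q d p' q' d' : 0 <= M -> 0 <= D ->
  close M D p q d -> close M D p' q' d' ->
  close M D (p * p') (q * q') (d + d')%N.
Proof.
move=> M0 D0 [p1 q1 pq1] [p2 q2 pq2]; split.
- by rewrite normrM exprD ler_pM.
- by rewrite normrM exprD ler_pM.
- rewrite (_ : _ - _ = (p - q) * p' + q * (p' - q')); last by ring.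
  rewrite (le_trans (ler_normD _ _))// !normrM.
  have h1 : `|p - q| * `|p'| <= d%:R * M ^+ (d + d').-1 * D.
    apply: (le_trans (ler_pM _ _ pq1 p2)) => //.
    case: d {p1 q1 pq1} => [|d]; first by rewrite !mul0r.
    by rewrite addSn /= exprD; nra.
  have h2 : `|q| * `|p' - q'| <= d'%:R * M ^+ (d + d').-1 * D.
    apply: (le_trans (ler_pM _ _ q1 pq2)) => //.
    case: d' {p2 q2 pq2 h1} => [|d']; first by rewrite !mul0r mulr0.
    by rewrite addnS /= exprD; nra.
  by rewrite natrD !mulrDl lerD.
Qed.

Lemma monomial_diff_le u v k (M : R) : `|u| <= M -> `|v| <= M ->
  `|\prod_(j < N) v 0 j ^+ k j - \prod_(j < N) u 0 j ^+ k j| <=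
  (deg k)%:R * M ^+ (deg k).-1 * `|v - u|.
Proof.
move=> uM vM; have M0 : 0 <= M := le_trans (normr_ge0 _) uM.
suff [] : close M `|v - u| (\prod_(j < N) v 0 j ^+ k j)
  (\prod_(j < N) u 0 j ^+ k j) (deg k) by [].
apply: (@big_ind3 _ _ _ (close M `|v - u|)).
- by split; rewrite ?expr0 ?normr1// subrr normr0 mul0r mul0r.
- by move=> *; exact: closeM.
- move=> j _; elim: (k j) => [|i ih].
    by rewrite !expr0; split; rewrite ?expr0 ?normr1// subrr normr0 mul0r mul0r.
  have h1 : close M `|v - u| (v 0 j) (u 0 j) 1.
    split; rewrite ?expr1 ?expr0 ?mulr1 ?mul1r.
    - exact: le_trans (row_norm_ge _ _) vM.
    - exact: le_trans (row_norm_ge _ _) uM.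
    - by have := row_norm_ge (v - u) j; rewrite !mxE.
  by rewrite !exprS; exact: (closeM M0 (normr_ge0 _) h1 ih).
Qed.

Definition unit_expo (j : 'I_N) : expo := [ffun i => (i == j) : nat].

Lemma deg_unit_expo j : deg (unit_expo j) = 1%N.
Proof.
rewrite /deg (bigD1 j)//= ffunE eqxx big1 ?addn0// => i /negPf ij.
by rewrite ffunE ij.
Qed.

Lemma deg1_unit_expo k : deg k = 1%N -> exists j, k = unit_expo j.
Proof.
move=> /eqP/sum_nat_eq1[j [_ kj kne]]; exists j; apply/ffunP => i; rewrite ffunE.
by have [->//|ij] := eqVneq i j; rewrite kne.
Qed.

Definition box_expo m (k : {ffun 'I_N -> 'I_m}) : expo := [ffun j => k j : nat].

Lemma box_expo_inj m : injective (@box_expo m).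
Proof.
move=> k1 k2 /ffunP k12; apply/ffunP => j; apply/val_inj.
by have := k12 j; rewrite !ffunE.
Qed.

Lemma sum_box_deg1 m (F : expo -> R) : (1 < m)%N ->
  \sum_(k : {ffun 'I_N -> 'I_m} | deg (box_expo k) == 1%N) F (box_expo k) =
  \sum_(j < N) F (unit_expo j).
Proof.
case: m => [//|m] m1.
pose h (j : 'I_N) : {ffun 'I_N -> 'I_m.+1} := [ffun i => inord (i == j)].
have hE j : box_expo (h j) = unit_expo j.
  by apply/ffunP => i; rewrite !ffunE inordK// (leq_ltn_trans (leq_b1 _) m1).
rewrite (eq_bigl (mem [set h j | j in [set: 'I_N]%SET]%SET)).
  rewrite big_imset /=; last first.
    move=> i j _ _ /(congr1 (@box_expo _)); rewrite !hE => /ffunP/(_ i).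
    by rewrite !ffunE eqxx; case: eqVneq.
  by apply: eq_big => [j|j _]; rewrite ?inE// hE.
move=> k /=; apply/eqP/imsetP => [/deg1_unit_expo[j kj]|[j _ ->]].
  by exists j; rewrite ?inE//; apply: box_expo_inj; rewrite hE.
by rewrite hE deg_unit_expo.
Qed.

Lemma summable_box_le (a : expo -> R) : summable setT (EFin \o a) ->
  exists2 S : R, 0 <= S & forall m,
    \sum_(k : {ffun 'I_N -> 'I_m}) `|a (box_expo k)| <= S.
Proof.
rewrite /summable => aoo.
have a0 : (0 <= \esum_(x in setT) `|(EFin \o a) x|)%E by exact: esum_ge0.
exists (fine (\esum_(x in setT) `|(EFin \o a) x|)%E); first exact: fine_ge0.
move=> m; rewrite -lee_fin fineK ?ge0_fin_numE//; apply: esum_ge.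
exists [set` map (@box_expo m) (index_enum {ffun 'I_N -> 'I_m})].
  split; [exact: finite_seq|exact: subsetT].
rewrite -fsbig_seq/=; last by rewrite map_inj_uniq ?index_enum_uniq//; exact: box_expo_inj.
by rewrite big_map sumEFin.
Qed.

(** For d >= 2, the derivative of the monomial of degree d gains a factor M
    over the weight rho^d, since d <= 4 * 2^(d - 2). *)
Lemma degree_geometric_le (d : nat) (M rho : R) : 0 < rho -> 0 <= M ->
  M <= rho / 2 -> (1 < d)%N ->
  d%:R * M ^+ d.-1 <= 4 / rho ^+ 2 * M * rho ^+ d.
Proof.
case: d => [//|[//|d]] rho0 M0 Mrho _ /=.
have Md : M ^+ d <= (rho / 2) ^+ d by rewrite lerXn2r ?nnegrE ?divr_ge0 ?(ltW rho0).
have d2 : d.+2%:R <= 4 * 2 ^+ d :> R.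
  elim: d {Md} => [|d ih]; first by rewrite expr0; lra.
  have : 1 <= 2 ^+ d :> R by rewrite exprn_ege1// ler1n.
  by rewrite exprS -natr1; lra.
rewrite (_ : 4 / rho ^+ 2 * M * rho ^+ d.+2 = M * (4 * 2 ^+ d) * (rho / 2) ^+ d).
  rewrite exprS mulrCA -[leRHS]mulrA ler_wpM2l// ler_pM//.
  exact: exprn_ge0.
rewrite expr_div_n !exprS expr0; field.
by rewrite !gt_eqF// exprn_gt0.
Qed.

(** The derivative is the homogeneous part of degree 1 of the power series. On a
    ball of radius d around the centre, the difference of the values of a
    monomial of degree at least 2 is O(d) |v - u|, with a constant that is
    summable against the coefficients by [degree_geometric_le]. *)
Lemma real_analytic_strict_deriv (f : row -> R) a : real_analytic f ->
  exists2 L, linear_form L & strict_deriv f a L.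
Proof.
move=> /(_ a)[c /nbhs_ballP[r /= r0 fc]].
pose rho := r / 2; have rho0 : 0 < rho by rewrite divr_gt0.
have rhor : rho < r by rewrite /rho; lra.
have [S S0 HS] : exists2 S : R, 0 <= S & forall m,
    \sum_(k : {ffun 'I_N -> 'I_m}) `|c (box_expo k)| * rho ^+ deg (box_expo k) <= S.
  have /fc[] : ball a r (a + const_mx rho).
    rewrite -ball_normE /= opprD addrA subrr add0r normrN (le_lt_trans _ rhor)//.
    by apply: row_norm_le => [|i]; rewrite ?mxE ?ger0_norm ?(ltW rho0).
  rewrite addrAC subrr add0r => /summable_box_le[S S0 HS] _.
  exists S => // m; rewrite (le_trans _ (HS m))//; apply: ler_sum => k _.
  rewrite /pseries_term normrM ler_wpM2l// (eq_bigr (fun j => rho ^+ box_expo k j)).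
    by rewrite prodrXr ger0_norm ?exprn_ge0 ?(ltW rho0)// /deg lexx.
  by move=> j _; rewrite mxE.
pose L v := \sum_(j < N) c (unit_expo j) * v 0 j.
have Llin : linear_form L.
  move=> t u v; rewrite /L mulr_sumr -big_split; apply: eq_bigr => j _ /=.
  by rewrite !mxE; ring.
have term_unit v j : pseries_term c v (unit_expo j) = c (unit_expo j) * v 0 j.
  rewrite /pseries_term (bigD1 j)//= big1; first by rewrite ffunE eqxx mulr1 expr1.
  by move=> i /negPf ij; rewrite ffunE ij expr0.
exists L => // e e0.
pose C := 4 / rho ^+ 2 * S.
have C0 : 0 <= C by rewrite mulr_ge0// divr_ge0// exprn_ge0// ltW.
pose d := Num.min (rho / 2) (e / (C + 1)).
have d0 : 0 < d by rewrite lt_min !divr_gt0// ltr_wpDl.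
have drho : d <= rho / 2 by rewrite ge_min lexx.
have dC : d * C <= e.
  have : d <= e / (C + 1) by rewrite ge_min lexx orbT.
  by rewrite ler_pdivlMr ?ltr_wpDl// => h; nra.
exists d => // u v ud vd.
pose P m w := \sum_(k : {ffun 'I_N -> 'I_m}) pseries_term c (w - a) (box_expo k).
have Pcvg w : `|w - a| < d -> P ^~ w @ \oo --> f w.
  move=> wd; have /fc[] // : ball a r w.
  rewrite -ball_normE /= -normrN opprB (lt_le_trans wd)// (le_trans drho)//.
  by rewrite /rho; lra.
have Pl : (fun m => `|P m v - P m u - L (v - u)|) @ \oo -->
    `|f v - f u - L (v - u)|.
  by apply: cvg_norm; apply: cvgB; [apply: cvgB; exact: Pcvg|exact: cvg_cst].
rewrite -(cvg_lim _ Pl)//; apply: limr_le; first by apply/cvg_ex; eexists; exact: Pl.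
near=> m; have m2 : (1 < m)%N by near: m; exists 2%N.
have -> : P m v - P m u - L (v - u) =
    \sum_(k : {ffun 'I_N -> 'I_m} | deg (box_expo k) != 1%N)
      (pseries_term c (v - a) (box_expo k) - pseries_term c (u - a) (box_expo k)).
  rewrite /P -sumrB (bigID (fun k : {ffun 'I_N -> 'I_m} => deg (box_expo k) == 1%N))/=.
  rewrite (sum_box_deg1 (fun k => pseries_term c (v - a) k - pseries_term c (u - a) k))//.
  rewrite addrAC [X in X + _](_ : _ = 0) ?add0r//; apply/eqP; rewrite subr_eq0.
  apply/eqP/eq_bigr => j _; rewrite !term_unit !mxE; ring.
rewrite (le_trans (ler_norm_sum _ _ _))//.
apply: (@le_trans _ _ (\sum_(k : {ffun 'I_N -> 'I_m})
   `|c (box_expo k)| * rho ^+ deg (box_expo k) * (4 / rho ^+ 2 * d * `|v - u|))).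
  rewrite [leRHS](bigID (fun k : {ffun 'I_N -> 'I_m} => deg (box_expo k) != 1%N))/= ler_wpDr//.
    apply: sumr_ge0 => k _; rewrite !mulr_ge0 ?invr_ge0 ?exprn_ge0//; exact: ltW.
  apply: ler_sum => k k1; rewrite /pseries_term -mulrBr normrM -mulrA ler_wpM2l//.
  have [k0|] := posnP (deg (box_expo k)).
    rewrite k0 expr0 mul1r.
    have := @monomial_diff_le (u - a) (v - a) (box_expo k) d (ltW ud) (ltW vd).
    rewrite k0 !mul0r => /le_trans -> //.
    by rewrite !mulr_ge0 ?invr_ge0 ?exprn_ge0//; exact: ltW.
  case: (deg (box_expo k)) (@monomial_diff_le (u - a) (v - a) (box_expo k) d (ltW ud) (ltW vd)) k1 => [//|[//|i]].
  rewrite opprD addrACA subrr addr0 => h _ _.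
  rewrite (le_trans h)// mulrA ler_wpM2r//.
  have := @degree_geometric_le i.+2 d rho rho0 (ltW d0) drho isT.
  by rewrite [leRHS]mulrC.
rewrite -mulr_suml.
apply: (@le_trans _ _ (S * (4 / rho ^+ 2 * d * `|v - u|))).
  by rewrite ler_wpM2r// !mulr_ge0 ?invr_ge0 ?exprn_ge0//; exact: ltW.
rewrite (_ : _ * _ = (d * C) * `|v - u|); last by rewrite /C; ring.
by rewrite ler_wpM2r.
Unshelve. all: by end_near. Qed.

End power_series.

Section continuous_measurable.
Context {R : realType} (N : nat).
Local Notation row := 'rV[R]_N.

Let grid k (u : row) : {ffun 'I_N -> int} :=
  [ffun j => Num.floor (u 0 j * 2 ^+ k)].

Let grid_pt k (m : {ffun 'I_N -> int}) : row := \row_j ((m j)%:~R / 2 ^+ k).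

Let measurable_grid k (m : {ffun 'I_N -> int}) :
  measurable [set u | grid k u = m].
Proof.
rewrite (_ : [set u | _] = \bigcap_(j in [set: 'I_N])
    ((fun u : row => u 0 j * 2 ^+ k) @^-1` `[(m j)%:~R, (m j + 1)%:~R[%classic)).
  apply: fin_bigcap_measurable => // j _.
  rewrite -[X in measurable X]setTI.
  apply: (@measurable_funM _ _ _ setT (fun u : row => u 0 j) (fun=> 2 ^+ k)) => //.
  exact: measurable_row_coord.
apply/seteqP; split => u /=.
  by move=> <- j _; rewrite /= in_itv /= ffunE floor_itv.
move=> H; apply/ffunP => j; rewrite ffunE; apply: floor_def.
by have := H j I; rewrite /= in_itv.
Qed.

Let grid_close k (u : row) : `|u - grid_pt k (grid k u)| <= (2 ^+ k)^-1.
Proof.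
apply: row_norm_le => [|j]; first by rewrite invr_ge0 exprn_ge0.
have k0 : 0 < 2 ^+ k :> R by rewrite exprn_gt0.
rewrite !mxE ffunE.
have /andP[h1 h2] := floor_itv (u 0 j * 2 ^+ k).
rewrite intrD in h2.
rewrite (_ : _ - _ = (u 0 j * 2 ^+ k - (Num.floor (u 0 j * 2 ^+ k))%:~R) / 2 ^+ k).
  rewrite normrM [X in _ * X]ger0_norm ?invr_ge0 ?(ltW k0)//.
  by rewrite ler_piMl ?invr_ge0 ?(ltW k0)// ger0_norm; lra.
by rewrite mulrBl mulfK// gt_eqF.
Qed.

(** The sigma-algebra is generated by the coordinates. A continuous function is
    the pointwise limit of its values at the corners of dyadic cubes, and these
    values are step functions of the coordinates. *)
Lemma continuous_row_measurable (f : row -> R) : continuous f ->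
  measurable_fun setT f.
Proof.
move=> cf.
apply: (@measurable_realfun.measurable_fun_cvg _ _ _ _
  (fun k u => f (grid_pt k (grid k u)))) => [k|u _].
  move=> _ B mB; rewrite setTI.
  rewrite (_ : _ @^-1` B = \bigcup_(m in [set: {ffun 'I_N -> int}])
     (if f (grid_pt k m) \in B then [set u | grid k u = m] else set0)).
    apply: countable_bigcupT_measurable => // m.
    by case: ifPn => // _; exact: measurable_grid.
  apply/seteqP; split => u /=.
    by move=> fB; exists (grid k u) => //; rewrite mem_set.
  by move=> [m _]; case: ifPn => // /set_mem fB /= ->.
apply: (cvg_comp (fun k => grid_pt k (grid k u)) f _ (cf u)).
apply/cvgrPdist_le => e e0; near=> k.
rewrite (le_trans (grid_close k u))//.
have k0 : 0 < 2 ^+ k :> R by rewrite exprn_gt0.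
rewrite invf_ple ?posrE//.
apply: (@le_trans _ _ k%:R).
  by near: k; exact: nbhs_infty_ger.
by rewrite -natrX ler_nat ltnW// ltn_expl.
Unshelve. all: by end_near. Qed.

Lemma linear_form0 (L : row -> R) : linear_form L -> L 0 = 0.
Proof. by move=> HL; have := HL 1 0 0; rewrite scale1r addr0 mul1r; lra. Qed.

Lemma linear_formZ (L : row -> R) t u : linear_form L -> L (t *: u) = t * L u.
Proof.
by move=> HL; rewrite -{1}(addr0 (t *: u)) HL (linear_form0 HL) addr0.
Qed.

Lemma linear_formD (L : row -> R) u v : linear_form L -> L (u + v) = L u + L v.
Proof. by move=> HL; rewrite -{1}(scale1r u) HL mul1r. Qed.

Lemma linear_form_sum (L : row -> R) I (r : seq I) (P : pred I) (F : I -> row) :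
  linear_form L -> L (\sum_(i <- r | P i) F i) = \sum_(i <- r | P i) L (F i).
Proof.
move=> HL; apply: (big_morph L) => [u v|]; first exact: linear_formD.
exact: linear_form0.
Qed.

Lemma linear_form_bound (L : row -> R) : linear_form L ->
  exists2 K : R, 0 <= K & forall v, `|L v| <= K * `|v|.
Proof.
move=> HL.
exists (\sum_(j < N) `|L (delta_mx 0 j)|); first exact: sumr_ge0.
move=> v; rewrite {1}(row_sum_delta v) linear_form_sum// mulr_suml.
rewrite (le_trans (ler_norm_sum _ _ _))//; apply: ler_sum => j _.
by rewrite linear_formZ// normrM mulrC ler_wpM2l// row_norm_ge.
Qed.

Lemma strict_deriv_continuous (f : row -> R) (a : row) L : linear_form L ->
  strict_deriv f a L -> f @ a --> f a.
Proof.
move=> /linear_form_bound[K K0 HK] fL.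
have aF : Filter (nbhs a) := nbhs_filter a.
apply/cvgrPdist_le => e e0.
have [d d0 H] := fL 1 ltr01.
near=> v.
have vd : `|v - a| < d.
  rewrite -normrN opprB; near: v.
  by move: (nbhsx_ballx a d d0); rewrite -ball_normE.
have ve : `|v - a| <= e / (K + 1).
  rewrite -normrN opprB; near: v.
  have ek : 0 < e / (K + 1) by rewrite divr_gt0// ltr_wpDl.
  move: (nbhsx_ballx a _ ek); rewrite -ball_normE; apply: filterS => v /= /ltW.
  by [].
have aa : `|a - a| < d by rewrite subrr normr0.
have := H a v aa vd; rewrite mul1r => h.
rewrite -normrN opprB.
have := ler_normD (f v - f a - L (v - a)) (L (v - a)); rewrite subrK => h2.
move: ve; rewrite ler_pdivlMr ?ltr_wpDl// => ve.
have := HK (v - a); lra.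
Unshelve. all: by end_near. Qed.

(** The directional derivative along an affine embedding [iota], such as freezing
    one of two variables; the condition on h says that iota is affine on the
    line through a directed by v. *)
Lemma derive_strict (V : normedModType R) (f : row -> R) (F : V -> R)
    (iota : V -> row) (a v : V) L :
  linear_form L -> strict_deriv f (iota a) L -> F = f \o iota ->
  (forall h : R, iota (h *: v + a) = h *: (iota (v + a) - iota a) + iota a) ->
  'D_v F a = L (iota (v + a) - iota a).
Proof.
move=> HL fL -> Hi; rewrite /derive; apply: cvg_lim => //.
set w := iota (v + a) - iota a in Hi *.
apply/cvgrPdist_le => e e0.
have e1 : 0 < e / (`|w| + 1) by rewrite divr_gt0// ltr_wpDl.
have [d d0 H] := fL _ e1.
have dw : 0 < d / (`|w| + 1) by rewrite divr_gt0// ltr_wpDl.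
near=> h => /=.
have h0 : h != 0 by near: h; exact: nbhs_dnbhs_neq.
rewrite Hi.
have aa : `|iota a - iota a| < d by rewrite subrr normr0.
have hd : `|h| < d / (`|w| + 1).
  by near: h; apply: dnbhs0_lt.
have hwd : `|h *: w + iota a - iota a| < d.
  rewrite addrK normrZ; move: hd; rewrite ltr_pdivlMr ?ltr_wpDl//.
  by have := normr_ge0 h; nra.
have := H _ _ aa hwd; rewrite addrK linear_formZ// normrZ => hh.
rewrite (_ : _ - _ = - (h^-1 * (f (h *: w + iota a) - f (iota a) - h * L w))); last first.
  by rewrite /GRing.scale /=; field.
rewrite normrN normrM normfV ler_pdivrMl ?normr_gt0// (le_trans hh)//.
rewrite mulrCA ler_wpM2l// mulrAC ler_pdivrMr ?ltr_wpDl//.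
by have := normr_ge0 w; nra.
Unshelve. all: by end_near. Qed.

End continuous_measurable.

Lemma real_analytic_continuous (R : realType) N (f : 'rV[R]_N -> R) : real_analytic f -> continuous f.
Proof.
move=> fan a; have [L HL fL] := real_analytic_strict_deriv a fan.
exact: strict_deriv_continuous fL.
Qed.

Lemma continuous_row_bounded (R : realType) N (f : 'rV[R]_N -> R) (M : R) : continuous f ->
  exists B : R, forall Z : 'rV[R]_N, `|Z| <= M -> `|f Z| <= B.
Proof.
move=> cf; pose K := [set Z : 'rV[R]_N | `|Z| <= M].
have bK : bounded_set K.
  exists M; split; first exact: num_real.
  by move=> x Mx Z /= ZM; rewrite (le_trans ZM)// ltW.
have clK : closed K.
  apply: (@preimage_closed _ _ (fun Z : 'rV[R]_N => `|Z|) [set x | x <= M]).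
    by move=> Z _; exact: norm_continuous.
  exact: closed_le.
have cK := bounded_closed_compact bK clK.
have := continuous_compact (continuous_subspaceT cf) cK.
move=> /compact_bounded[B [_ HB]]; exists (B + 1) => Z ZM.
by apply: (HB (B + 1)); rewrite ?ltrDl//; exists Z.
Qed.

(** * Sesqui-holomorphic functions *)

Section sesquiholomorphic_kernel.
Context {R : realType} (n : nat).
Local Notation row4 := 'rV[R]_((n + n) + (n + n)).
Implicit Types X Y Z : phase R n.

Definition pack X Y : row4 :=
  row_mx (row_mx X.1 X.2) (row_mx Y.1 Y.2).

Lemma packD X Y X' Y' : pack (X + X') (Y + Y') = pack X Y + pack X' Y'.
Proof. by rewrite /pack !add_row_mx. Qed.

Lemma packZ (t : R) X Y : pack (t *: X) (t *: Y) = t *: pack X Y.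
Proof. by rewrite /pack !scale_row_mx. Qed.

Lemma packB X Y X' Y' : pack X Y - pack X' Y' = pack (X - X') (Y - Y').
Proof. by rewrite /pack !opp_row_mx !add_row_mx. Qed.

(** Multiplication by z of the vector x + i xi of C^n attached to
    X = (x, xi). *)
Definition cact (z : R[i]) X : phase R n :=
  (complex.Re z *: X.1 - complex.Im z *: X.2,
   complex.Re z *: X.2 + complex.Im z *: X.1).

Lemma cact_split z X :
  cact z X = complex.Re z *: X + complex.Im z *: cact 'i%C X.
Proof.
by congr pair => /=; rewrite !(scale0r, scale1r, add0r, sub0r, scalerN).
Qed.

Lemma cactB z w X : cact z X - cact w X = cact (z - w) X.
Proof.
rewrite (cact_split z) (cact_split w) (cact_split (z - w)) !raddfB /= !scalerBl.
by rewrite opprD addrACA.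
Qed.

Lemma conjcB (z w : R[i]) : conjc (z - w) = conjc z - conjc w.
Proof. by rewrite conjcD; congr (_ + _); apply: complexP; case: w. Qed.

Lemma phase_pos_mom X : X = \sum_(j < n) (X.1 0 j *: pos_dir R j + X.2 0 j *: mom_dir R j).
Proof.
rewrite [RHS]surjective_pairing [LHS]surjective_pairing; congr pair.
  rewrite (big_morph fst (fun _ _ => erefl) erefl) {1}(row_sum_delta X.1).
  by apply: eq_bigr => j _; rewrite /= scaler0 addr0.
rewrite (big_morph snd (fun _ _ => erefl) erefl) {1}(row_sum_delta X.2).
by apply: eq_bigr => j _; rewrite /= scaler0 add0r.
Qed.

Lemma pack_sum I (r : seq I) (P : pred I) (F1 F2 : I -> phase R n) :
  pack (\sum_(i <- r | P i) F1 i) (\sum_(i <- r | P i) F2 i) =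
  \sum_(i <- r | P i) pack (F1 i) (F2 i).
Proof.
elim/big_rec3 : _ => [|i x y z _ <-]; last by rewrite packD.
by rewrite /pack !row_mx0.
Qed.

Lemma derive_pack1 (f : row4 -> R) L (F : phase R n -> phase R n -> R) X Y
    (v : phase R n) : linear_form L -> strict_deriv f (pack X Y) L ->
  (forall X Y, F X Y = f (pack X Y)) ->
  'D_v (fun W => F W Y) X = L (pack v 0).
Proof.
move=> HL fL FE.
rewrite (@derive_strict R _ (phase R n) f _ (fun W => pack W Y) X v L HL fL).
- by rewrite packB addrK subrr.
- by apply/funext => W; rewrite FE.
- by move=> h; rewrite packB addrK subrr -packZ scaler0 -packD add0r.
Qed.

Lemma derive_pack2 (f : row4 -> R) L (F : phase R n -> phase R n -> R) X Y
    (v : phase R n) : linear_form L -> strict_deriv f (pack X Y) L ->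
  (forall X Y, F X Y = f (pack X Y)) ->
  'D_v (fun W => F X W) Y = L (pack 0 v).
Proof.
move=> HL fL FE.
rewrite (@derive_strict R _ (phase R n) f _ (fun W => pack X W) Y v L HL fL).
- by rewrite packB addrK subrr.
- by apply/funext => W; rewrite FE.
- by move=> h; rewrite packB addrK subrr -packZ scaler0 -packD add0r.
Qed.

Lemma linear_form_pack1 (L : row4 -> R) X : linear_form L -> L (pack X 0) =
  \sum_(j < n) (X.1 0 j * L (pack (pos_dir R j) 0) +
                X.2 0 j * L (pack (mom_dir R j) 0)).
Proof.
move=> HL; rewrite {1}(phase_pos_mom X).
rewrite [X in L (pack _ X) = _](_ : 0 = \sum_(j < n) 0); last by rewrite big1.
rewrite pack_sum linear_form_sum//; apply: eq_bigr => j _.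
have := packD (X.1 0 j *: pos_dir R j) (X.1 0 j *: 0) (X.2 0 j *: mom_dir R j) (X.2 0 j *: 0).
by rewrite !packZ !scaler0 addr0 => ->; rewrite linear_formD// !linear_formZ.
Qed.

Lemma linear_form_pack2 (L : row4 -> R) X : linear_form L -> L (pack 0 X) =
  \sum_(j < n) (X.1 0 j * L (pack 0 (pos_dir R j)) +
                X.2 0 j * L (pack 0 (mom_dir R j))).
Proof.
move=> HL; rewrite {1}(phase_pos_mom X).
rewrite [X in L (pack X _) = _](_ : 0 = \sum_(j < n) 0); last by rewrite big1.
rewrite pack_sum linear_form_sum//; apply: eq_bigr => j _.
have := packD (X.1 0 j *: 0) (X.1 0 j *: pos_dir R j) (X.2 0 j *: 0) (X.2 0 j *: mom_dir R j).
by rewrite !packZ !scaler0 addr0 => ->; rewrite linear_formD// !linear_formZ.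
Qed.

Lemma linear_form_pack (L : row4 -> R) X Y : linear_form L ->
  L (pack X Y) = L (pack X 0) + L (pack 0 Y).
Proof. by move=> HL; rewrite -linear_formD// -packD addr0 add0r. Qed.

Variable G : phase R n -> phase R n -> R[i].
Let G1 (Z : row4) := complex.Re (G (phase_of_row (lsubmx Z)) (phase_of_row (rsubmx Z))).
Let G2 (Z : row4) := complex.Im (G (phase_of_row (lsubmx Z)) (phase_of_row (rsubmx Z))).

Let G1E X Y : complex.Re (G X Y) = G1 (pack X Y).
Proof.
by rewrite /G1 /pack row_mxKl row_mxKr /phase_of_row !row_mxKl !row_mxKr; case: X Y => ? ? [].
Qed.

Let G2E X Y : complex.Im (G X Y) = G2 (pack X Y).
Proof.
by rewrite /G2 /pack row_mxKl row_mxKr /phase_of_row !row_mxKl !row_mxKr; case: X Y => ? ? [].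
Qed.

Hypothesis Gan : real_analytic2 G.

Let G1an : real_analytic G1 := Gan.1.
Let G2an : real_analytic G2 := Gan.2.

Lemma measurable_pack : measurable_fun setT
  (fun p : phase R n * phase R n => pack p.1 p.2).
Proof.
have m11 := measurableT_comp (@measurable_fst _ _ 'rV[R]_n 'rV[R]_n)
  (@measurable_fst _ _ (phase R n) (phase R n)).
have m12 := measurableT_comp (@measurable_snd _ _ 'rV[R]_n 'rV[R]_n)
  (@measurable_fst _ _ (phase R n) (phase R n)).
have m21 := measurableT_comp (@measurable_fst _ _ 'rV[R]_n 'rV[R]_n)
  (@measurable_snd _ _ (phase R n) (phase R n)).
have m22 := measurableT_comp (@measurable_snd _ _ 'rV[R]_n 'rV[R]_n)
  (@measurable_snd _ _ (phase R n) (phase R n)).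
apply: measurable_fun_rowP => i; rewrite /pack.
case: (split_ordP i) => j ->; case: (split_ordP j) => k ->.
- under eq_fun do rewrite !row_mxEl.
  exact: measurableT_comp (measurable_row_coord k) m11.
- under eq_fun do rewrite row_mxEl row_mxEr.
  exact: measurableT_comp (measurable_row_coord k) m12.
- under eq_fun do rewrite row_mxEr row_mxEl.
  exact: measurableT_comp (measurable_row_coord k) m21.
- under eq_fun do rewrite !row_mxEr.
  exact: measurableT_comp (measurable_row_coord k) m22.
Qed.

Lemma analytic2_cmeasurable :
  cmeasurable (fun p : phase R n * phase R n => G p.1 p.2).
Proof.
split.
  under eq_fun do rewrite G1E.
  apply: measurableT_comp measurable_pack.
  exact: (continuous_row_measurable (real_analytic_continuous G1an)).
under eq_fun do rewrite G2E.
apply: measurableT_comp measurable_pack.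
exact: (continuous_row_measurable (real_analytic_continuous G2an)).
Qed.

Lemma analytic2_bounded (M : R) : exists B : R, forall X Y,
  `|pack X Y| <= M -> normc (G X Y) <= B.
Proof.
have [B1 H1] := continuous_row_bounded M (real_analytic_continuous G1an).
have [B2 H2] := continuous_row_bounded M (real_analytic_continuous G2an).
exists (B1 + B2) => X Y XYM; rewrite (le_trans (normc_le_ReIm _))//.
by rewrite G1E G2E lerD ?H1 ?H2.
Qed.

Hypothesis Gsesq : sesquiholomorphic G.

(** The two Cauchy-Riemann systems say that the differential of G multiplies
    by i when (Y, X) is replaced by (i Y, - i X). This is the direction in which
    (z Y, conj(z) X) moves when z moves along the imaginary axis, whence the
    complex differentiability in z. *)
Lemma sesquiholo_slice Z X Y :
  strict_holo (fun z => G (Z + cact z Y) (Z + cact (conjc z) X)).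
Proof.
move=> a.
set Pa := pack (Z + cact a Y) (Z + cact (conjc a) X).
have [L1 H1 D1] := real_analytic_strict_deriv Pa G1an.
have [L2 H2 D2] := real_analytic_strict_deriv Pa G2an.
have CR1 j : L1 (pack (pos_dir R j) 0) = L2 (pack (mom_dir R j) 0) /\
             L2 (pack (pos_dir R j) 0) = - L1 (pack (mom_dir R j) 0).
  have [+ _] := Gsesq (Z + cact a Y) (Z + cact (conjc a) X) j.
  rewrite /partial_deriv.
  rewrite !(derive_pack1 (F := fun X Y => complex.Re (G X Y)) _ H1 D1 G1E).
  rewrite !(derive_pack1 (F := fun X Y => complex.Im (G X Y)) _ H2 D2 G2E).
  by simpc => -[] e1 e2; split; lra.
have CR2 j : L1 (pack 0 (pos_dir R j)) = - L2 (pack 0 (mom_dir R j)) /\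
             L2 (pack 0 (pos_dir R j)) = L1 (pack 0 (mom_dir R j)).
  have [_] := Gsesq (Z + cact a Y) (Z + cact (conjc a) X) j.
  rewrite /partial_deriv.
  rewrite !(derive_pack2 (F := fun X Y => complex.Re (G X Y)) _ H1 D1 G1E).
  rewrite !(derive_pack2 (F := fun X Y => complex.Im (G X Y)) _ H2 D2 G2E).
  by simpc => -[] e1 e2; split; lra.
(* With LB2: the differential L1 + i L2 maps (i V, - i W) to i times the image
   of (V, W). *)
have LB1 V W : L1 (pack (cact 'i%C V) (- cact 'i%C W)) = - L2 (pack V W).
  rewrite (linear_form_pack _ _ H1) (linear_form_pack V W H2).
  rewrite !(linear_form_pack1 _ H1) !(linear_form_pack2 _ H1).
  rewrite !(linear_form_pack1 _ H2) !(linear_form_pack2 _ H2).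
  rewrite -!big_split -sumrN; apply: eq_bigr => j _ /=.
  rewrite !mxE; have [-> ->] := CR1 j; have [-> ->] := CR2 j; ring.
have LB2 V W : L2 (pack (cact 'i%C V) (- cact 'i%C W)) = L1 (pack V W).
  rewrite (linear_form_pack _ _ H2) (linear_form_pack V W H1).
  rewrite !(linear_form_pack1 _ H1) !(linear_form_pack2 _ H1).
  rewrite !(linear_form_pack1 _ H2) !(linear_form_pack2 _ H2).
  rewrite -!big_split; apply: eq_bigr => j _ /=.
  rewrite !mxE; have [-> ->] := CR1 j; have [-> ->] := CR2 j; ring.
pose l := (L1 (pack Y X) +i* L2 (pack Y X))%C.
exists l => e e0.
pose A := pack Y X; pose B := pack (cact 'i%C Y) (- cact 'i%C X).
pose K := `|A| + `|B| + 1.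
have K0 : 0 < K by rewrite ltr_wpDl// addr_ge0.
have eK : 0 < e / (2 * K) by rewrite divr_gt0// mulr_gt0.
have [d1 d10 E1] := D1 _ eK; have [d2 d20 E2] := D2 _ eK.
pose P z := pack (Z + cact z Y) (Z + cact (conjc z) X).
have PB z w : P w - P z = complex.Re (w - z) *: A + complex.Im (w - z) *: B.
  rewrite /P packB -!packZ -packD; congr pack.
    by rewrite opprD addrACA subrr add0r cactB (cact_split (w - z)).
  by rewrite opprD addrACA subrr add0r cactB -conjcB cact_split Re_conjc Im_conjc
    scaleNr scalerN.
have PK z w : `|P w - P z| <= K * normc (w - z).
  rewrite PB (le_trans (ler_normD _ _))// !normrZ.
  have := ler_wpM2r (normr_ge0 A) (abs_Re_le_normc (w - z)).
  have := ler_wpM2r (normr_ge0 B) (abs_Im_le_normc (w - z)).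
  have := normc_ge0 (w - z); rewrite /K; lra.
exists (Num.min d1 d2 / K); first by rewrite divr_gt0// lt_min d10 d20.
move=> z w; rewrite !ltr_pdivlMr// => zd wd.
have Pz : `|P z - Pa| < Num.min d1 d2.
  by rewrite (le_lt_trans (PK a z))// mulrC.
have Pw : `|P w - Pa| < Num.min d1 d2.
  by rewrite (le_lt_trans (PK a w))// mulrC.
move: Pz Pw; rewrite !lt_min => /andP[Pz1 Pz2] /andP[Pw1 Pw2].
have {}E1 := E1 _ _ Pz1 Pw1; have {}E2 := E2 _ _ Pz2 Pw2.
apply: (le_trans (normc_le_ReIm _)).
have -> : complex.Re (G (Z + cact w Y) (Z + cact (conjc w) X) -
    G (Z + cact z Y) (Z + cact (conjc z) X) - l * (w - z)) =
    G1 (P w) - G1 (P z) - L1 (P w - P z).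
  rewrite !raddfB /= !G1E ReM PB linear_formD// !linear_formZ// LB1.
  by rewrite raddfB /= /l /= raddfB/=; ring.
have -> : complex.Im (G (Z + cact w Y) (Z + cact (conjc w) X) -
    G (Z + cact z Y) (Z + cact (conjc z) X) - l * (w - z)) =
    G2 (P w) - G2 (P z) - L2 (P w - P z).
  rewrite !raddfB /= !G2E ImM PB linear_formD// !linear_formZ// LB2.
  by rewrite raddfB /= /l /= raddfB/=; ring.
apply: (le_trans (lerD E1 E2)).
rewrite -mulrDl (_ : e / (2 * K) + e / (2 * K) = e / K); last first.
  by field; rewrite gt_eqF.
by rewrite mulrAC ler_pdivrMr// -mulrA ler_wpM2l ?(ltW e0)// mulrC.
Qed.

End sesquiholomorphic_kernel.

(** * Averages over rotations *)

Section dominated.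
Context d (T : measurableType d) (R : realType) (mu : {measure set T -> \bar R}).

(** Dominated convergence, in the form used twice below: a number bounded by
    integrals that tend to 0 is not positive. *)
Lemma dominated_le0 (x : R) (h : nat -> T -> R) (g : T -> R) :
  (forall m, measurable_fun setT (h m)) ->
  (forall m t, 0 <= h m t <= g t) -> mu.-integrable setT (EFin \o g) ->
  (forall t, h ^~ t @ \oo --> 0) ->
  (\forall m \near \oo, x <= \int[mu]_t h m t) -> x <= 0.
Proof.
move=> mh hg gi h0 xh.
have mh' m : measurable_fun setT (fun t => (h m t)%:E).
  exact/measurable_EFinP.
have hcvg : {ae mu, forall t, setT t ->
    (fun m => (h m t)%:E) @ \oo --> (cst 0%E : T -> \bar R) t}.
  by apply: aeW => t _; apply: cvg_EFin; [exact: nearW|exact: h0].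
have hle : {ae mu, forall t m, setT t -> (`|(h m t)%:E| <= (EFin \o g) t)%E}.
  by apply: aeW => t m _ /=; rewrite lee_fin; have /andP[? ?] := hg m t; rewrite ger0_norm.
have [_ _] := dominated_convergence measurableT mh' (measurable_cst _) hcvg gi hle.
rewrite integral0 => hlim.
have Rlim : (fun m => \int[mu]_t h m t) @ \oo --> 0.
  exact: (fine_cvg hlim).
rewrite -(cvg_lim _ Rlim)//; apply: limr_ge => //.
by apply/cvg_ex; eexists; exact: Rlim.
Qed.

Lemma cintegral0 : cintegral mu (fun=> 0 : R[i]) = 0.
Proof. by rewrite /cintegral /= !Rintegral_cst// !mul0r. Qed.

Lemma cintegrable0 : cintegrable mu (fun=> 0 : R[i]).
Proof. by split; exact: integrable0. Qed.

Lemma cintegral_sum N (F : nat -> T -> R[i]) :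
  (forall k, cintegrable mu (F k)) ->
  cintegrable mu (fun t => \sum_(k < N) F k t) /\
  cintegral mu (fun t => \sum_(k < N) F k t) = \sum_(k < N) cintegral mu (F k).
Proof.
move=> Fi; elim: N => [|N [ih1 ih2]].
  under eq_fun do rewrite big_ord0; rewrite big_ord0.
  by split; [exact: cintegrable0|exact: cintegral0].
under eq_fun do rewrite big_ord_recr /=; rewrite big_ord_recr /= -ih2.
by split; [exact: cintegrableD|rewrite cintegralD].
Qed.

Lemma cintegralB (f g : T -> R[i]) : cintegrable mu f -> cintegrable mu g ->
  cintegrable mu (fun x => f x - g x) /\
  cintegral mu (fun x => f x - g x) = cintegral mu f - cintegral mu g.
Proof.
move=> fi gi; have gi' := cintegrableZ (-1) gi.
have := cintegrableD fi gi'; have := cintegralD fi gi'.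
by rewrite cintegralZ// mulN1r; under eq_fun do rewrite mulN1r.
Qed.

Lemma cintegrable_real (f : T -> R) : mu.-integrable setT (EFin \o f) ->
  cintegrable mu (fun x => (f x)%:C%C).
Proof. by move=> fi; split => //=; exact: integrable0. Qed.

Lemma integrable_indic_mul (f : T -> R) (E : set T) : measurable E ->
  mu.-integrable setT (EFin \o f) ->
  mu.-integrable setT (EFin \o (fun t => \1_E t * f t)).
Proof.
move=> mE fi.
apply: (@integrable_le _ _ _ _ _ (fun t => `|f t|)).
- apply: measurable_funM; first exact: measurable_indic.
  by apply/measurable_EFinP; exact: measurable_int fi.
- by move=> t; rewrite normrM ler_piMl// indicE; case: (_ \in _); rewrite ?normr1 ?normr0.
- exact: (integrable_abse fi).
Qed.

Lemma cintegrable_indic_mul (f : T -> R[i]) (E : set T) : measurable E ->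
  cintegrable mu f -> cintegrable mu (fun t => ((\1_E t)%:C)%C * f t).
Proof.
move=> mE [f1 f2]; split.
  under eq_fun do rewrite ReM /= mul0r subr0.
  exact: (integrable_indic_mul mE f1).
under eq_fun do rewrite ImM /= mul0r addr0.
exact: (integrable_indic_mul mE f2).
Qed.

End dominated.

(** A circle acts on T through its roots of unity and preserves mu; along each
    orbit, K is a constant weight w times the boundary values of a holomorphic
    function whose value at the centre is c. Averaging K over the orbits
    replaces it by c w. The mean values converge pointwise only; the invariant
    function q exhausts T by sets on which they are dominated, and the
    integrability of K and w disposes of the complements. *)
Section rotation_average.
Context d (T : measurableType d) (R : realType) (mu : {measure set T -> \bar R}).
Variables (act : R[i] -> T -> T) (K : T -> R[i]) (w q : T -> R)
  (g : T -> R[i] -> R[i]) (c : R[i]).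
Hypothesis Ki : cintegrable mu K.
Hypothesis wi : mu.-integrable setT (EFin \o w).
Hypothesis w0 : forall t, 0 <= w t.
Hypothesis mq : measurable_fun setT q.
(* For these N the angle is not a multiple of pi, and rotations are products of
   shears. *)
Hypothesis act_mpres : forall N, (2 < N)%N -> mpres mu (act (root1 N)).
Hypothesis act1 : forall t, act 1 t = t.
Hypothesis actM : forall z z' t, act (z * z') t = act z (act z' t).
Hypothesis q_act : forall z t, normc z = 1 -> q (act z t) = q t.
Hypothesis KE : forall z t, normc z = 1 -> K (act z t) = (w t)%:C%C * g t z.
Hypothesis g_holo : forall t, strict_holo (g t).
Hypothesis g0 : forall t, g t 0 = c.
Hypothesis g_bounded : forall M, exists B, forall t z, q t <= M ->
  normc z = 1 -> normc (g t z) <= B.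

Let E (M : nat) := [set t | q t <= M%:R].

Let mE M : measurable (E M).
Proof.
rewrite (_ : E M = q @^-1` `]-oo, M%:R]).
  by rewrite -[X in measurable X]setTI; exact: mq.
by apply/seteqP; split => t /=; rewrite in_itv.
Qed.

Let act_iter N k t : act (root1 N ^+ k) t = iter k (act (root1 N)) t.
Proof.
elim: k => [|k ih]; first by rewrite expr0 act1.
by rewrite exprS actM ih.
Qed.

Let normc_root1X N k : normc ((root1 N : R[i]) ^+ k) = 1.
Proof. by rewrite /root1 expiX normc_expi. Qed.

Let average_truncated M :
  cintegral mu (fun t => ((\1_(E M) t)%:C)%C * K t) =
  c * ((\int[mu]_t (\1_(E M) t * w t))%:C)%C.
Proof.
have [B gB] := g_bounded M%:R.
pose f t := ((\1_(E M) t)%:C)%C * K t.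
have fi : cintegrable mu f by exact: cintegrable_indic_mul.
pose D N t := ((N%:R^-1)%:C)%C * \sum_(k < N) f (act (root1 N ^+ k) t) -
  c * (\1_(E M) t * w t)%:C%C.
have fact N k : (2 < N)%N ->
    cintegrable mu (fun t => f (act (root1 N ^+ k) t)) /\
    cintegral mu (fun t => f (act (root1 N ^+ k) t)) = cintegral mu f.
  move=> N2; under eq_fun do rewrite act_iter.
  have h := mpres_iter (act_mpres N2) k.
  by split; [exact: (mpres_cintegrable h fi)|exact: (mpres_cintegral h fi)].
have wEi : mu.-integrable setT (EFin \o (fun t => \1_(E M) t * w t)).
  exact: integrable_indic_mul.
have Di N : (2 < N)%N -> cintegrable mu (D N) /\ cintegral mu (D N) =
    cintegral mu f - c * ((\int[mu]_t (\1_(E M) t * w t))%:C)%C.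
  move=> N2.
  have [si sE] := @cintegral_sum _ _ _ mu N (fun k t => f (act (root1 N ^+ k) t))
    (fun k => (fact N k N2).1).
  have i1 := cintegrableZ (N%:R^-1)%:C%C si.
  have i2 := cintegrableZ c (cintegrable_real wEi).
  have [Dh ->] := cintegralB i1 i2; split => //.
  rewrite !cintegralZ//; last exact: cintegrable_real.
  rewrite sE cintegral_real; congr (_ - _).
  rewrite (eq_bigr (fun=> cintegral mu f)) => [|k _]; last by have [] := fact N k N2.
  rewrite sumr_const card_ord -(mulr_natl (cintegral mu f) N) mulrA.
  rewrite (_ : (N%:R^-1)%:C%C * N%:R = 1) ?mul1r//.
  rewrite -(rmorph_nat (real_complex R)) -rmorphM/= mulVf ?rmorph1//.
  by rewrite pnatr_eq0; case: N N2 {si sE i1 Dh}.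
have DE N t : D N t = ((\1_(E M) t * w t)%:C)%C *
    (N%:R^-1 * \sum_(k < N) g t (root1 N ^+ k) - g t 0).
  have f_act k : f (act (root1 N ^+ k) t) =
      ((\1_(E M) t * w t)%:C)%C * g t (root1 N ^+ k).
    rewrite /f KE// mulrA -rmorphM; congr (((_ * _)%:C)%C * _).
    rewrite !indicE (_ : (act _ t \in E M) = (t \in E M))//.
    by apply/idP/idP; rewrite !inE /E /= q_act.
  rewrite /D g0; under eq_bigr do rewrite f_act.
  rewrite -mulr_sumr.
  by rewrite fmorphV/= rmorph_nat; ring.
apply/eqP; rewrite -subr_eq0; apply/eqP/Normc.eq0_normc/eqP.
rewrite eq_le normc_ge0 andbT.
pose h N t : R := if (2 < N)%N then normc (D N t) else 0.
apply: (@dominated_le0 _ _ _ mu _ h (fun t => (B + normc c) * (\1_(E M) t * w t))).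
- move=> N; rewrite /h; case: (boolP (2 < N)%N) => N2; last exact: measurable_cst.
  by apply/measurable_normc/(@cintegrable_meas _ _ _ mu); exact: (Di N N2).1.
- move=> N t; rewrite /h.
  have B0 : 0 <= (B + normc c) * (\1_(E M) t * w t).
    rewrite indicE; have [tE|_] := boolP (t \in E M); last by rewrite mul0r mulr0.
    rewrite !mulr_ge0// addr_ge0 ?normc_ge0//.
    apply: (@le_trans _ _ (normc (g t 1))); first exact: normc_ge0.
    apply: gB; last exact: Normc.normc1.
    by move: tE; rewrite inE.
  case: (boolP (2 < N)%N) => N2; rewrite ?lexx ?B0 ?normc_ge0//= DE.
  rewrite indicE; have [tE|_] := boolP (t \in E M); last first.
    by rewrite mul0r mul0r Normc.normc0 mulr0.
  rewrite Normc.normcM normc_real mul1r ger0_norm// mulrC ler_wpM2r//.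
  rewrite (le_trans (normc_triangle _ _))// normc_opp g0 lerD2r.
  have N0 : 0 < N%:R :> R by rewrite ltr0n; case: N N2.
  rewrite Normc.normcM Normc.normcV normc_natr ler_pdivrMl//.
  rewrite (le_trans (normc_sum _ _ _))//.
  apply: (@le_trans _ _ (\sum_(k < N) B)); last first.
    by rewrite sumr_const card_ord mulr_natl.
  by apply: ler_sum => k _; apply: gB => //; move: tE; rewrite inE.
- exact: integrable_mulrl.
- move=> t; apply/cvgrPdist_le => e e0.
  have e1 : 0 < e / (`|\1_(E M) t * w t| + 1) by rewrite divr_gt0// ltr_wpDl.
  have cN := circle_average (g_holo t) e1.
  near=> N.
  rewrite sub0r normrN /h; case: (boolP (2 < N)%N) => N2; last by rewrite normr0 ltW.
  rewrite ger0_norm ?normc_ge0// DE Normc.normcM normc_real.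
  have hN : normc (N%:R^-1 * \sum_(k < N) g t (root1 N ^+ k) - g t 0) <=
      e / (`|\1_(E M) t * w t| + 1) by near: N.
  have := ler_wpM2l (normr_ge0 (\1_(E M) t * w t)) hN.
  move/le_trans; apply; rewrite mulrCA ler_piMr ?(ltW e0)//.
  by rewrite ler_pdivrMr ?ltr_wpDl// mul1r lerDl.
- near=> N; have N2 : (2 < N)%N by near: N; exists 3%N.
  have [i1 i2] := Di N N2; rewrite -/f -i2 (le_trans (normc_cintegral_le i1))//.
  by under [leRHS]eq_Rintegral do rewrite /h N2.
Unshelve. all: by end_near. Qed.

Lemma rotation_average : cintegral mu K = c * ((\int[mu]_t w t)%:C)%C.
Proof.
apply/eqP; rewrite -subr_eq0; apply/eqP/Normc.eq0_normc/eqP.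
rewrite eq_le normc_ge0 andbT.
pose h M t : R := \1_(~` E M) t * (normc (K t) + normc c * w t).
have gi : mu.-integrable setT (EFin \o (fun t => normc (K t) + normc c * w t)).
  by apply: integrable_addr; [exact: cintegrable_normc|exact: integrable_mulrl].
have g00 t : 0 <= normc (K t) + normc c * w t.
  by rewrite addr_ge0 ?normc_ge0// mulr_ge0 ?normc_ge0.
have hi M : mu.-integrable setT (EFin \o h M).
  by apply: integrable_indic_mul => //; exact: measurableC.
apply: (@dominated_le0 _ _ _ mu _ h (fun t => normc (K t) + normc c * w t)) => //.
- by move=> M; apply/measurable_EFinP; exact: measurable_int (hi M).
- move=> M t; rewrite /h indicE; case: (_ \in _); rewrite ?mul1r ?mul0r ?lexx ?g00//.
- move=> t; apply/cvgrPdist_le => e e0; near=> M.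
  have tM : E M t by rewrite /E /=; near: M; exact: nbhs_infty_ger.
  by rewrite sub0r normrN /h indicE memNset ?mul0r ?normr0 ?ltW//= => /(_ tM).
- near=> M.
  have i1 := cintegrable_indic_mul (mE M) Ki.
  have wEi : mu.-integrable setT (EFin \o (fun t => \1_(E M) t * w t)).
    exact: integrable_indic_mul.
  have i2 := cintegrableZ c (cintegrable_real wEi).
  have i3 := cintegrableZ c (cintegrable_real wi).
  have [j1 e1] := cintegralB Ki i1.
  have [j2 e2] := cintegralB i3 i2.
  have [j3 e3] := cintegralB j1 j2.
  have -> : cintegral mu K - c * ((\int[mu]_t w t)%:C)%C =
     cintegral mu (fun t => (K t - ((\1_(E M) t)%:C)%C * K t) -
       (c * (w t)%:C%C - c * (\1_(E M) t * w t)%:C%C)).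
    rewrite e3 e1 e2 average_truncated !cintegralZ ?cintegral_real; [ring| |];
      exact: cintegrable_real.
  rewrite (le_trans (normc_cintegral_le j3))//.
  apply: le_Rintegral => //; first exact: cintegrable_normc.
  move=> t _; rewrite /h indicE; rewrite indicE in_setC.
  case: (t \in E M) => /=.
    by rewrite !mul1r !subrr Normc.normc0 mul0r.
  rewrite !mul0r mulr0 !subr0 mul1r (le_trans (normc_triangle _ _))//.
  by rewrite normc_opp Normc.normcM normc_real ger0_norm.
Unshelve. all: by end_near. Qed.

End rotation_average.

(** * Rotations and Gaussian integrals on phase space *)

Section dot_product.
Context {R : realType} (n : nat).
Implicit Types u v w : 'rV[R]_n.

Lemma dotrC u v : dotr u v = dotr v u.
Proof. by apply: eq_bigr => j _; rewrite mulrC. Qed.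

Lemma dotrDl u v w : dotr (u + v) w = dotr u w + dotr v w.
Proof. by rewrite -big_split; apply: eq_bigr => j _; rewrite mxE mulrDl. Qed.

Lemma dotrZl (t : R) u v : dotr (t *: u) v = t * dotr u v.
Proof. by rewrite mulr_sumr; apply: eq_bigr => j _; rewrite mxE mulrA. Qed.

Lemma dotrDr u v w : dotr w (u + v) = dotr w u + dotr w v.
Proof. by rewrite dotrC dotrDl !(dotrC w). Qed.

Lemma dotrZr (t : R) u v : dotr v (t *: u) = t * dotr v u.
Proof. by rewrite dotrC dotrZl dotrC. Qed.

Lemma dotrNl u v : dotr (- u) v = - dotr u v.
Proof. by rewrite -scaleN1r dotrZl mulN1r. Qed.

Lemma dotrNr u v : dotr v (- u) = - dotr v u.
Proof. by rewrite -scaleN1r dotrZr mulN1r. Qed.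

Definition dotrE := (dotrDl, dotrDr, dotrZl, dotrZr, dotrNl, dotrNr).

Lemma dotr_ge0 u : 0 <= dotr u u.
Proof. by apply: sumr_ge0 => j _; rewrite -expr2 sqr_ge0. Qed.

Lemma abs_dotr_le u v : `|dotr u v| <= (dotr u u + dotr v v) / 2.
Proof.
have h1 := dotr_ge0 (u - v); have h2 := dotr_ge0 (u + v).
rewrite !dotrE (dotrC v u) in h1 h2.
by rewrite ler_norml; apply/andP; split; lra.
Qed.

(** The norm of a row is the maximum norm. *)
Lemma row_norm_sq_le u : `|u| ^+ 2 <= dotr u u.
Proof.
have h i : `|u 0 i| ^+ 2 <= dotr u u.
  rewrite /dotr (bigD1 i)//= real_normK ?num_real// -expr2 lerDl.
  by apply: sumr_ge0 => j _; rewrite -expr2 sqr_ge0.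
rewrite -[leRHS]sqr_sqrtr ?dotr_ge0// ler_pXn2r ?nnegrE ?sqrtr_ge0//.
apply: row_norm_le; first exact: sqrtr_ge0.
by move=> i; rewrite -[leLHS]ger0_norm// -sqrtr_sqr ler_wsqrtr.
Qed.

End dot_product.

Section phase_space.
Context {R : realType} (n : nat).
Local Notation lebp := (@lebesgue_phase R n).
Implicit Types X Y Z : phase R n.

Lemma sqnorm_phase_ge0 X : 0 <= sqnorm_phase X.
Proof. by rewrite addr_ge0 ?dotr_ge0. Qed.

Lemma sqnorm_phaseN X : sqnorm_phase (- X) = sqnorm_phase X.
Proof. by rewrite /sqnorm_phase /= !dotrE !opprK. Qed.

Lemma sqnorm_cact z X : sqnorm_phase (cact z X) = normc z ^+ 2 * sqnorm_phase X.
Proof.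
rewrite sqr_normc /sqnorm_phase /cact /= !dotrE (dotrC X.2 X.1); ring.
Qed.

Lemma measurable_sqnorm_phase : measurable_fun setT (@sqnorm_phase R n).
Proof. by apply: measurable_funD; apply: measurable_dotr. Qed.

Lemma mpres_phase_shift Z : mpres lebp (fun X => X + Z).
Proof. exact: (mpres_prod (mpres_row_shift Z.1) (mpres_row_shift Z.2)). Qed.

Lemma measurable_scale_row d (T : measurableType d) (f : T -> 'rV[R]_n) (a : R) :
  measurable_fun setT f -> measurable_fun setT (fun x => a *: f x).
Proof.
move=> mf; apply: measurable_fun_rowP => i; under eq_fun do rewrite mxE.
by apply: measurable_funM => //; exact: measurableT_comp (measurable_row_coord i) mf.
Qed.

Lemma measurable_add_row d (T : measurableType d) (f g : T -> 'rV[R]_n) :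
  measurable_fun setT f -> measurable_fun setT g ->
  measurable_fun setT (fun x => f x + g x).
Proof.
move=> mf mg; apply: measurable_fun_rowP => i; under eq_fun do rewrite mxE.
by apply: measurable_funD;
  [exact: measurableT_comp (measurable_row_coord i) mf|exact: measurableT_comp (measurable_row_coord i) mg].
Qed.

Lemma mpres_phase_shear1 (a : R) :
  mpres lebp (fun X => (X.1 + a *: X.2, X.2)).
Proof.
apply: (@mpres_shear1 _ _ _ _ R (@lebesgue_row R n) (@lebesgue_row R n)
  (fun xi x => x + a *: xi)) => [|y]; last exact: mpres_row_shift.
apply: measurable_fun_pair; last exact: measurable_snd.
apply: measurable_add_row; first exact: measurable_fst.
exact: measurable_scale_row measurable_snd.
Qed.

Lemma mpres_phase_shear2 (a : R) :
  mpres lebp (fun X => (X.1, X.2 + a *: X.1)).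
Proof.
apply: (@mpres_shear2 _ _ _ _ R (@lebesgue_row R n) (@lebesgue_row R n)
  (fun x xi => xi + a *: x)) => [|y]; last exact: mpres_row_shift.
apply: measurable_fun_pair; first exact: measurable_fst.
apply: measurable_add_row; first exact: measurable_snd.
exact: measurable_scale_row measurable_fst.
Qed.

(** A rotation of angle distinct from 0 and pi is a product of three shears,
    and each shear is a translation in one variable when the other is fixed. *)
Lemma mpres_cact z : normc z = 1 -> complex.Im z != 0 -> mpres lebp (cact z).
Proof.
move=> z1 zI; set c := complex.Re z; set s := complex.Im z in zI *.
have cs : c ^+ 2 + s ^+ 2 = 1 by rewrite -sqr_normc z1 expr1n.
pose a := (c - 1) / s.
have as_ : a * s = c - 1 by rewrite divfK.
have -> : cact z = (fun X => (X.1 + a *: X.2, X.2)) \o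
    ((fun X => (X.1, X.2 + s *: X.1)) \o (fun X => (X.1 + a *: X.2, X.2))).
  apply/funext => -[x xi] /=; rewrite /cact -/c -/s /=.
  have sa : s * a = c - 1 by rewrite mulrC.
  have e (x0 y0 : R) : y0 + s * (x0 + a * y0) = c * y0 + s * x0.
    by rewrite mulrDr mulrA sa; ring.
  have aa : a * (1 + c) = - s.
    apply: (mulIf zI); rewrite mulrAC as_; lra.
  congr pair; apply/rowP => i; rewrite !mxE e//.
  have es : s * xi 0 i = - (a * (1 + c) * xi 0 i) by rewrite aa mulNr opprK.
  have ex : a * (s * x 0 i) = (c - 1) * x 0 i by rewrite mulrA as_.
  by rewrite (mulrDr a) ex es; ring.
apply: (mpres_comp (mpres_phase_shear1 a)).
apply: (mpres_comp (mpres_phase_shear2 s)).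
exact: mpres_phase_shear1.
Qed.

Lemma cact1 X : cact 1 X = X.
Proof. by case: X => x xi; rewrite /cact /= !scale1r !scale0r subr0 addr0. Qed.

Lemma cactM z w X : cact (z * w) X = cact z (cact w X).
Proof.
rewrite /cact ReM ImM /=.
by congr pair; apply/rowP => i; rewrite !mxE; ring.
Qed.

Lemma gauss_integral_phase (c : R) : 0 < c ->
  (\int[lebp]_X (expR (- (sqnorm_phase X / c)))%:E = ((pi * c) ^+ n)%:E)%E.
Proof.
move=> c0.
have mE : measurable_fun setT (fun u : 'rV[R]_n => (expR (- (dotr u u / c)))%:E).
  apply/measurable_EFinP; apply: measurableT_comp => //.
  apply: measurableT_comp => //; apply: measurable_funM => //.
  exact: measurable_dotr.
under eq_integral do rewrite /sqnorm_phase mulrDl opprD expRD EFinM.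
rewrite fubini_tonelli1//; last first.
  apply: emeasurable_funM; first exact: (measurableT_comp mE measurable_fst).
  exact: (measurableT_comp mE measurable_snd).
transitivity (\int[@lebesgue_row R n]_x
    ((expR (- (dotr x x / c)))%:E * (Num.sqrt (pi * c) ^+ n)%:E))%E.
  apply: eq_integral => x _; rewrite /fubini_F /= -(gauss_integral_row n c0).
  by rewrite ge0_integralZl.
rewrite ge0_integralZr ?gauss_integral_row//.
rewrite -EFinM -exprMn -expr2 sqr_sqrtr// mulr_ge0 ?pi_ge0//; exact: ltW.
Qed.

Lemma gauss_integrable_phase (c : R) : 0 < c ->
  lebp.-integrable setT (EFin \o (fun X => expR (- (sqnorm_phase X / c)))).
Proof.
move=> c0; apply/integrableP; split.
  apply/measurable_EFinP; apply: measurableT_comp => //.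
  apply: measurableT_comp => //; apply: measurable_funM => //.
  exact: measurable_sqnorm_phase.
under eq_integral do rewrite /= ger0_norm ?expR_ge0//.
by rewrite gauss_integral_phase// ltry.
Qed.

Lemma gauss_integrable_row (c : R) : 0 < c ->
  (@lebesgue_row R n).-integrable setT (EFin \o (fun u => expR (- (dotr u u / c)))).
Proof.
move=> c0; apply/integrableP; split.
  apply/measurable_EFinP; apply: measurableT_comp => //.
  apply: measurableT_comp => //; apply: measurable_funM => //.
  exact: measurable_dotr.
under eq_integral do rewrite /= ger0_norm ?expR_ge0//.
by rewrite gauss_integral_row// ltry.
Qed.

End phase_space.

(** * Coherent states *)

Lemma realcM (R : realType) (a b : R) : ((a * b)%:C = a%:C * b%:C)%C.
Proof. by rewrite -rmorphM. Qed.

Section gaussian_fourier.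
Context {R : realType} (n : nat) (h : R).
Hypothesis h0 : 0 < h.
Local Notation leb := (@lebesgue_row R n).
Local Notation lebp := (@lebesgue_phase R n).

Lemma expi_conj (t : R) : conjc (expi t) = expi (- t) :> R[i].
Proof. by rewrite /expi cosN sinN. Qed.

Lemma cexpE (s t : R) : cexp (s +i* t)%C = (expR s)%:C%C * expi t.
Proof. by []. Qed.

Lemma strict_holo_cexp_linear (b : R[i]) :
  strict_holo (fun z => cexp (b * z)).
Proof.
move=> a; eexists; apply: strict_cderiv_comp; last exact: strict_cderiv_cexp.
have -> : *%R b = (fun z => b * z + 0) by apply/funext => z; rewrite addr0.
exact: strict_cderiv_affine.
Qed.

Lemma cmeasurable_expi d (T : measurableType d) (f : T -> R) :
  measurable_fun setT f -> cmeasurable (fun x => expi (f x)).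
Proof.
move=> mf; split => /=; apply: measurableT_comp => //; apply: continuous_measurable_fun.
  exact: continuous_cos.
exact: continuous_sin.
Qed.

(** Completing the square. *)
Lemma gauss_shift_integrable (b : 'rV[R]_n) :
  leb.-integrable setT (EFin \o (fun y => expR (- (dotr y y / h) + dotr b y))) /\
  \int[leb]_y expR (- (dotr y y / h) + dotr b y) =
  expR (h * dotr b b / 4) * Num.sqrt (pi * h) ^+ n.
Proof.
have E y : expR (- (dotr y y / h) + dotr b y) = expR (h * dotr b b / 4) *
    expR (- (dotr (y - (h / 2) *: b) (y - (h / 2) *: b) / h)).
  rewrite -expRD; congr expR; rewrite !dotrE (dotrC y b).
  by field; rewrite gt_eqF.
have sh := mpres_row_shift (- ((h / 2) *: b)).
have gi := gauss_integrable_row n h0.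
have gi' := mpres_integrable sh gi.
split.
  under [X in _.-integrable _ X]eq_fun do rewrite /= E.
  exact: integrable_mulrl.
under eq_Rintegral do rewrite E.
rewrite RintegralZl//; congr (_ * _).
rewrite (mpres_Rintegral sh gi) /Rintegral gauss_integral_row//.
Qed.

(** The function exp (b . (y + i eta)) is holomorphic in y + i eta, so that its
    Gaussian mean over R^(2n) is its value 1 at the origin, by rotation. The
    integral factors; the one in y is elementary, and the other one is the
    Fourier transform. *)
Lemma gauss_fourier (b : 'rV[R]_n) :
  cintegral leb (fun v => (expR (- (dotr v v / h)))%:C%C * expi (dotr b v)) =
  (Num.sqrt (pi * h) ^+ n * expR (- (h * dotr b b / 4)))%:C%C.
Proof.
pose beta (X : phase R n) : R[i] := (dotr b X.1 +i* dotr b X.2)%C.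
pose w (X : phase R n) := expR (- (sqnorm_phase X / h)).
pose K X := (w X)%:C%C * cexp (beta X).
pose g X z := cexp (beta X * z).
have beta_act z X : beta (cact z X) = beta X * z.
  rewrite /beta /cact /= !dotrE; apply: complexP; rewrite ?ReM ?ImM /=; ring.
have [fi fE] := gauss_shift_integrable b.
pose F v : R[i] := (expR (- (dotr v v / h)))%:C%C * expi (dotr b v).
have mexp (f : 'rV[R]_n -> R) : measurable_fun setT f ->
    measurable_fun setT (fun x => expR (f x)) by move=> mf; exact: measurableT_comp.
have mquad : measurable_fun setT (fun v : 'rV[R]_n => - (dotr v v / h)).
  apply: measurableT_comp => //; apply: measurable_funM => //.
  exact: measurable_dotr.
have Fi : cintegrable leb F.
  apply: (@cintegrable_le _ _ _ _ _ (fun v => expR (- (dotr v v / h)))).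
  - apply: cmeasurableM; first by apply: cmeasurable_real; exact: mexp.
    by apply: cmeasurable_expi; exact: measurable_dotr.
  - by move=> v; rewrite Normc.normcM normc_expi mulr1 normc_real ger0_norm ?expR_ge0.
  - exact: gauss_integrable_row.
have KE X : K X = (expR (- (dotr X.1 X.1 / h) + dotr b X.1))%:C%C * F X.2.
  rewrite /K /w /F cexpE /sqnorm_phase mulrDl opprD !expRD !rmorphM /=; ring.
have [] := cintegral_tensor (cintegrable_real fi) Fi.
rewrite -(_ : K = fun X => _) => [Ki KF|]; last exact/funext.
have main : cintegral lebp K = 1 * (\int[lebp]_X w X)%:C%C.
  apply: (@rotation_average _ _ R lebp (@cact R n) K w (@sqnorm_phase R n) g 1) => //.
  - exact: gauss_integrable_phase.
  - by move=> X; exact: expR_ge0.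
  - exact: measurable_sqnorm_phase.
  - move=> N N2; apply: mpres_cact; first exact: normc_expi.
    by rewrite gt_eqF//; exact: sin_root1_gt0.
  - exact: cact1.
  - exact: cactM.
  - by move=> z X z1; rewrite sqnorm_cact z1 expr1n mul1r.
  - by move=> z X z1; rewrite /K /w /g beta_act sqnorm_cact z1 expr1n mul1r.
  - by move=> X; exact: strict_holo_cexp_linear.
  - by move=> X; rewrite /g mulr0 cexp0.
  - move=> M; exists (expR (dotr b b + M / 2)) => X z XM z1.
    rewrite normc_cexp ler_expR (le_trans (ler_norm _))//.
    rewrite (le_trans (abs_Re_le_normc _))// Normc.normcM z1 mulr1.
    rewrite (le_trans (normc_le_ReIm _))//=.
    have := abs_dotr_le b X.1; have := abs_dotr_le b X.2.
    by move: XM; rewrite /sqnorm_phase; lra.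
move: KF; rewrite [LHS]main mul1r cintegral_real fE.
rewrite {1}/Rintegral gauss_integral_phase//= => /esym.
set A := cintegral leb F => HA.
have s0 : 0 < Num.sqrt (pi * h) ^+ n by rewrite exprn_gt0// sqrtr_gt0 mulr_gt0 ?pi_gt0.
have c0 : (expR (h * dotr b b / 4) * Num.sqrt (pi * h) ^+ n)%:C%C != 0 :> R[i].
  by rewrite fmorph_eq0 mulf_neq0 ?gt_eqF// expR_gt0.
apply: (mulfI c0); rewrite HA -rmorphM; congr (_%:C)%C.
set S := Num.sqrt _ ^+ n; set a := h * _ / 4.
transitivity (S * S * (expR a * expR (- a))); last by ring.
rewrite -expRD subrr expR0 mulr1 -exprMn -expr2 sqr_sqrtr//.
by rewrite mulr_ge0 ?pi_ge0// ltW.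
Qed.

End gaussian_fourier.

Section coherent_states.
Context {R : realType} (n : nat) (h : R).
Hypothesis h0 : 0 < h.
Local Notation leb := (@lebesgue_row R n).
Local Notation lebp := (@lebesgue_phase R n).
Local Notation Psi := (@coherent R n h).
Implicit Types X Y Z : phase R n.

Let N := (pi * h) `^ (- (n%:R / 4)).

Let N_sqr : N ^+ 2 * Num.sqrt (pi * h) ^+ n = 1.
Proof.
have ph : 0 < pi * h by rewrite mulr_gt0 ?pi_gt0.
rewrite -powR12_sqrt ?(ltW ph)// -!powR_mulrn ?powR_ge0// -!powRrM -powRD; last first.
  by rewrite (gt_eqF ph) implybT.
by rewrite (_ : _ + _ = 0) ?powRr0//; lra.
Qed.

Lemma measurable_coherent :
  cmeasurable (fun p : phase R n * 'rV[R]_n => Psi p.1 p.2).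
Proof.
have m1 := measurableT_comp (@measurable_fst _ _ 'rV[R]_n 'rV[R]_n)
  (@measurable_fst _ _ (phase R n) 'rV[R]_n).
have m2 := measurableT_comp (@measurable_snd _ _ 'rV[R]_n 'rV[R]_n)
  (@measurable_fst _ _ (phase R n) 'rV[R]_n).
have mu := @measurable_snd _ _ (phase R n) 'rV[R]_n.
have mD : measurable_fun setT
    (fun p : phase R n * 'rV[R]_n => p.2 - p.1.1).
  apply: measurable_add_row => //.
  by under eq_fun do rewrite -scaleN1r; exact: measurable_scale_row.
apply: cmeasurableM.
  apply: cmeasurable_real; apply: measurable_funM => //.
  apply: measurableT_comp => //; apply: measurableT_comp => //.
  by apply: measurable_funM => //; exact: measurable_dotr.
apply: cmeasurable_expi; apply: measurable_funB; apply: measurable_funM => //.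
  exact: measurable_dotr.
exact: measurable_dotr.
Qed.

Lemma cmeasurable_coherent X : cmeasurable (Psi X).
Proof. exact: (cmeasurable_comp (pair1_measurable X) measurable_coherent). Qed.

Lemma normc_coherent_sq X u : normc (Psi X u) ^+ 2 =
  N ^+ 2 * expR (- (dotr (u - X.1) (u - X.1) / h)).
Proof.
rewrite /coherent Normc.normcM normc_expi mulr1 normc_real.
rewrite ger0_norm ?mulr_ge0 ?powR_ge0 ?expR_ge0// exprMn -/N; congr (_ * _).
by rewrite expr2 -expRD; congr expR; field; rewrite gt_eqF.
Qed.

Lemma L2_coherent X : L2 (Psi X).
Proof.
apply: (@L2_le _ _ _ (fun u => N ^+ 2 * expR (- (dotr (u - X.1) (u - X.1) / h)))).
- exact: cmeasurable_coherent.
- by move=> u; rewrite normc_coherent_sq.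
- apply: integrable_mulrl.
  exact: (mpres_integrable (mpres_row_shift (- X.1)) (gauss_integrable_row n h0)).
Qed.

(** Completing the square around the mean position m leaves the Fourier
    transform of a centred Gaussian, taken at the difference b of the momenta
    divided by h. *)
Lemma inner_coherent Y X : inner (Psi Y) (Psi X) =
  (expR (- (sqnorm_phase (X - Y) / (4 * h))))%:C%C *
  expi ((dotr X.1 Y.2 - dotr Y.1 X.2) / (2 * h)).
Proof.
pose m := 2^-1 *: (X.1 + Y.1).
pose b := h^-1 *: (Y.2 - X.2).
pose F v : R[i] := (expR (- (dotr v v / h)))%:C%C * expi (dotr b v).
pose c : R[i] := (N ^+ 2 * expR (- (dotr (X.1 - Y.1) (X.1 - Y.1) / (4 * h))))%:C%C *
   expi ((dotr X.1 Y.2 - dotr Y.1 X.2) / (2 * h)).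
have PE u : Psi Y u * conjc (Psi X u) = c * F (u - m).
  rewrite /coherent -/N conjcM expi_conj.
  rewrite (_ : conjc (N * expR (- (dotr (u - X.1) (u - X.1) / (2 * h))))%:C%C =
    (N * expR (- (dotr (u - X.1) (u - X.1) / (2 * h))))%:C%C); last first.
    by rewrite /conjc /= oppr0.
  set A1 := expR (- (dotr (u - Y.1) _ / _)); set A2 := expR (- (dotr (u - X.1) _ / _)).
  set t1 := dotr u Y.2 / h - _; set t2 := - (dotr u X.2 / h - _).
  transitivity ((N ^+ 2 * (A1 * A2))%:C%C * expi (t1 + t2)).
    rewrite (expiD t1 t2) expr2 !realcM.
    by move: (N%:C)%C (A1%:C)%C (A2%:C)%C (expi t1) (expi t2) => *; ring.
  rewrite /c /F; set B1 := expR (- (dotr (X.1 - Y.1) _ / _)).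
  set B2 := expR (- (dotr (u - m) _ / _)); set s1 := (_ - _) / (2 * h).
  transitivity ((N ^+ 2 * (B1 * B2))%:C%C * expi (s1 + dotr b (u - m))); last first.
    rewrite (expiD s1) expr2 !realcM.
    move: (N%:C)%C (B1%:C)%C (B2%:C)%C (expi s1) (expi (dotr b (u - m))) => *.
    by ring.
  have hn0 : h != 0 by rewrite gt_eqF.
  congr ((_ * _)%:C%C * expi _).
    rewrite -!expRD; congr expR; rewrite /m !dotrE.
    rewrite (dotrC Y.1 X.1) (dotrC u X.1) (dotrC u Y.1).
    by field.
  rewrite /t1 /t2 /s1 /b /m !dotrE ?(dotrC u Y.2) ?(dotrC u X.2)
    ?(dotrC Y.2 X.1) ?(dotrC Y.2 Y.1) ?(dotrC X.2 X.1) ?(dotrC X.2 Y.1).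
  by field.
have Fi : cintegrable leb F.
  apply: (@cintegrable_le _ _ _ _ _ (fun v => expR (- (dotr v v / h)))).
  - apply: cmeasurableM.
      apply: cmeasurable_real; apply: measurableT_comp => //.
      apply: measurableT_comp => //; apply: measurable_funM => //.
      exact: measurable_dotr.
    by apply: cmeasurable_expi; exact: measurable_dotr.
  - by move=> v; rewrite Normc.normcM normc_expi mulr1 normc_real ger0_norm ?expR_ge0.
  - exact: gauss_integrable_row.
have sh := mpres_row_shift (- m).
rewrite /inner; under [X in cintegral _ X]eq_fun do rewrite PE.
rewrite (cintegralZ c (mpres_cintegrable sh Fi)) (mpres_cintegral sh Fi).
rewrite gauss_fourier// /c mulrAC -rmorphM /=; congr (_%:C%C * _).
set A := expR (- (dotr (X.1 - Y.1) _ / _)); set B := expR (- (h * _ / 4)).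
transitivity ((N ^+ 2 * Num.sqrt (pi * h) ^+ n) * (A * B)); first by ring.
rewrite N_sqr mul1r -expRD; congr expR; rewrite /sqnorm_phase /b /= !dotrE.
rewrite (dotrC Y.2 X.2); have hn0 : h != 0 by rewrite gt_eqF.
by field.
Qed.

End coherent_states.

(** * Parametric integrals and the Schur test *)

Section parametric.
Context d1 d2 (T1 : measurableType d1) (T2 : measurableType d2) (R : realType).
Variables (m1 : {sigma_finite_measure set T1 -> \bar R})
          (m2 : {sigma_finite_measure set T2 -> \bar R}).

Lemma measurable_Rintegral (f : T1 * T2 -> R) : measurable_fun setT f ->
  measurable_fun setT (fun x => \int[m2]_y f (x, y)).
Proof.
move=> mf; rewrite /Rintegral.
have mE : measurable_fun setT (EFin \o f) by exact/measurable_EFinP.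
have E x : (\int[m2]_y (f (x, y))%:E =
    \int[m2]_y ((EFin \o f)^\+ (x, y)) - \int[m2]_y ((EFin \o f)^\- (x, y)))%E.
  rewrite integralE; congr (_ - _)%E; apply: eq_integral => y _;
    by rewrite unlock.
under eq_fun do rewrite E.
apply: (measurableT_comp (fine_measurable _)); first exact: measurableT.
apply: emeasurable_funB.
  apply: (@measurable_fun_fubini_tonelli_F _ _ _ _ _ _ (EFin \o f)^\+%E).
    exact: measurable_funepos.
  by move=> z; exact: funepos_ge0.
apply: (@measurable_fun_fubini_tonelli_F _ _ _ _ _ _ (EFin \o f)^\-%E).
  exact: measurable_funeneg.
by move=> z; exact: funeneg_ge0.
Qed.

Lemma cmeasurable_cintegral (f : T1 * T2 -> R[i]) : cmeasurable f ->
  cmeasurable (fun x => cintegral m2 (fun y => f (x, y))).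
Proof.
move=> [f1 f2]; split; first exact: (measurable_Rintegral f1).
exact: (measurable_Rintegral f2).
Qed.

Lemma Rintegral_tensor (f : T1 -> R) (g : T2 -> R) :
  m1.-integrable setT (EFin \o f) -> m2.-integrable setT (EFin \o g) ->
  \int[(m1 \x m2)%E]_z (f z.1 * g z.2) = \int[m1]_x f x * \int[m2]_y g y.
Proof.
move=> fi gi; have [_ <-] := Rfubini1 (integrable_tensor fi gi).
rewrite mulrC -RintegralZl//; apply: eq_Rintegral => x _ /=.
by rewrite RintegralZl// mulrC.
Qed.

End parametric.

Section schur.
Context {R : realType} (n : nat).
Local Notation lebp := (@lebesgue_phase R n).
Local Notation P := (phase R n).

Lemma measurable_phaseD d (T : measurableType d) (f g : T -> P) :
  measurable_fun setT f -> measurable_fun setT g ->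
  measurable_fun setT (fun x => f x + g x).
Proof.
move=> mf mg; apply: measurable_fun_pair; apply: measurable_add_row;
  by [exact: measurableT_comp measurable_fst mf|exact: measurableT_comp measurable_fst mg|
      exact: measurableT_comp measurable_snd mf|exact: measurableT_comp measurable_snd mg].
Qed.

Lemma measurable_phaseN d (T : measurableType d) (f : T -> P) :
  measurable_fun setT f -> measurable_fun setT (fun x => - f x).
Proof.
move=> mf; apply: measurable_fun_pair => /=; under eq_fun do rewrite -scaleN1r;
  apply: measurable_scale_row;
  by [exact: measurableT_comp measurable_fst mf|exact: measurableT_comp measurable_snd mf].
Qed.

Let shear2 : mpres (lebp \x lebp)%E (fun z : P * P => (z.1, z.2 - z.1)).
Proof.
apply: (@mpres_shear2 _ _ _ _ R lebp lebp (fun X Y => Y - X)) => [|X].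
  apply: measurable_fun_pair => //; apply: measurable_phaseD => //.
  exact: measurable_phaseN.
exact: mpres_phase_shift.
Qed.

Let shear1 : mpres (lebp \x lebp)%E (fun z : P * P => (z.1 + z.2, z.2)).
Proof.
apply: (@mpres_shear1 _ _ _ _ R lebp lebp (fun W X => X + W)) => [|X].
  by apply: measurable_fun_pair => //; exact: measurable_phaseD.
exact: mpres_phase_shift.
Qed.

Let swap_shear : mpres (lebp \x lebp)%E (fun z : P * P => (z.2, z.2 - z.1)).
Proof.
have := mpres_comp shear1 shear2; congr mpres.
by apply/funext => -[X Y]; rewrite /= subrKC.
Qed.

Let mul_le_sqrD (u v : R) : 0 <= u -> 0 <= v -> u * v <= u ^+ 2 + v ^+ 2.
Proof. by move=> u0 v0; have := sqr_ge0 (u - v); have := mulr_ge0 u0 v0; nra. Qed.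

Let weighted_amgm (s u v : R) : 0 < s ->
  2 * (u * v) <= s * u ^+ 2 + s^-1 * v ^+ 2.
Proof.
move=> s0; rewrite -(ler_pM2l s0) mulrDr (mulrA s s^-1) mulfV ?gt_eqF// mul1r.
by have := sqr_ge0 (s * u - v); nra.
Qed.

(** By the inequality between weighted means, psi(Y - X) a(Y) b(X) is bounded
    by the average of s a(Y)^2 psi(Y - X) and s^-1 b(X)^2 psi(Y - X). Shears
    of the product space turn each of these into a tensor product, and s is
    then optimised by [le_mul_of_amgm]. *)
Lemma schur_test (psi a b : P -> R) :
  lebp.-integrable setT (EFin \o psi) ->
  measurable_fun setT a -> measurable_fun setT b ->
  (forall X, 0 <= psi X) -> (forall X, 0 <= a X) -> (forall X, 0 <= b X) ->
  lebp.-integrable setT (EFin \o (fun X => a X ^+ 2)) ->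
  lebp.-integrable setT (EFin \o (fun X => b X ^+ 2)) ->
  (lebp \x lebp)%E.-integrable setT
    (EFin \o (fun z : P * P => psi (z.2 - z.1) * (a z.2 * b z.1))) /\
  \int[(lebp \x lebp)%E]_z (psi (z.2 - z.1) * (a z.2 * b z.1)) <=
  \int[lebp]_X psi X *
    (Num.sqrt (\int[lebp]_X a X ^+ 2) * Num.sqrt (\int[lebp]_X b X ^+ 2)).
Proof.
move=> psii ma mb psi0 a0 b0 ai bi.
have mpsi : measurable_fun setT psi by apply/measurable_EFinP; exact: measurable_int psii.
have ta := integrable_tensor ai psii; have tb := integrable_tensor bi psii.
have ia := mpres_integrable swap_shear ta.
have ib := mpres_integrable shear2 tb.
have Ia : \int[(lebp \x lebp)%E]_z (a z.2 ^+ 2 * psi (z.2 - z.1)) =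
    (\int[lebp]_X a X ^+ 2) * \int[lebp]_X psi X.
  by rewrite -(Rintegral_tensor ai psii); exact: (mpres_Rintegral swap_shear ta).
have Ib : \int[(lebp \x lebp)%E]_z (b z.1 ^+ 2 * psi (z.2 - z.1)) =
    (\int[lebp]_X b X ^+ 2) * \int[lebp]_X psi X.
  by rewrite -(Rintegral_tensor bi psii); exact: (mpres_Rintegral shear2 tb).
have mdiff : measurable_fun setT (fun z : P * P => z.2 - z.1).
  by apply: measurable_phaseD => //; exact: measurable_phaseN.
have i0 : (lebp \x lebp)%E.-integrable setT
    (EFin \o (fun z : P * P => psi (z.2 - z.1) * (a z.2 * b z.1))).
  apply: (integrable_le _ _ (integrable_addr ia ib)).
    apply: measurable_funM; first exact: measurableT_comp mpsi mdiff.
    by apply: measurable_funM;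
      [exact: measurableT_comp ma measurable_snd|exact: measurableT_comp mb measurable_fst].
  move=> [X Y] /=; rewrite ger0_norm ?mulr_ge0//.
  have h1 := psi0 (Y - X); rewrite -mulrDl mulrC ler_wpM2r//.
  exact: mul_le_sqrD.
split => //.
set I := Rintegral _ _ _.
set Q := \int[lebp]_X psi X; set A2 := \int[lebp]_X a X ^+ 2; set B2 := \int[lebp]_X b X ^+ 2.
have Q0 : 0 <= Q by apply: Rintegral_ge0 => X _; exact: psi0.
have A20 : 0 <= A2 by apply: Rintegral_ge0 => X _; exact: sqr_ge0.
have B20 : 0 <= B2 by apply: Rintegral_ge0 => X _; exact: sqr_ge0.
have -> : Q * (Num.sqrt A2 * Num.sqrt B2) =
    (Num.sqrt Q * Num.sqrt A2) * (Num.sqrt Q * Num.sqrt B2).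
  by rewrite mulrACA -expr2 sqr_sqrtr.
apply: le_mul_of_amgm; rewrite ?mulr_ge0 ?sqrtr_ge0// => s s0.
rewrite !exprMn !sqr_sqrtr// (mulrC Q A2) (mulrC Q B2).
rewrite -Ia -Ib /I -!RintegralZl// -RintegralD//; try exact: integrable_mulrl.
apply: le_Rintegral => //; first exact: integrable_mulrl.
  by apply: integrable_addr; exact: integrable_mulrl.
move=> [X Y] _ /=.
have -> : 2 * (psi (Y - X) * (a Y * b X)) = psi (Y - X) * (2 * (a Y * b X)) by ring.
have -> : s * (a Y ^+ 2 * psi (Y - X)) + s^-1 * (b X ^+ 2 * psi (Y - X)) =
  psi (Y - X) * (s * a Y ^+ 2 + s^-1 * b X ^+ 2) by ring.
by rewrite ler_wpM2l// weighted_amgm.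
Qed.

End schur.

(** * The coherent state transform *)

Section coherent_transform.
Context {R : realType} (n : nat) (h : R).
Hypothesis h0 : 0 < h.
Local Notation fct := ('rV[R]_n -> R[i]).
Local Notation leb := (@lebesgue_row R n).
Local Notation lebp := (@lebesgue_phase R n).
Local Notation Psi := (@coherent R n h).
Implicit Types (X Y Z : phase R n) (f g : fct).

Lemma normc_inner_coherent Y X : normc (inner (Psi Y) (Psi X)) =
  expR (- (sqnorm_phase (X - Y) / (4 * h))).
Proof.
by rewrite inner_coherent// Normc.normcM normc_expi mulr1 normc_real ger0_norm ?expR_ge0.
Qed.

Lemma L2norm_coherent X : L2norm (Psi X) = 1.
Proof.
have s0 : sqnorm_phase (0 : phase R n) = 0.
  by rewrite /sqnorm_phase /dotr !big1 ?addr0// => i _; rewrite mxE mul0r.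
have /(congr1 (@Normc.normc R)) := inner_self (Psi X).
rewrite normc_inner_coherent subrr s0 mul0r oppr0 expR0 normc_real.
rewrite ger0_norm ?sqr_ge0// => /esym/eqP.
by rewrite sqrp_eq1 ?L2norm_ge0// => /eqP.
Qed.

Lemma cmeasurable_transform f : L2 f -> cmeasurable (fun Y => inner f (Psi Y)).
Proof.
move=> [mf _].
apply: (@cmeasurable_cintegral _ _ (phase R n) 'rV[R]_n R leb
  (fun p => f p.2 * conjc (Psi p.1 p.2))).
apply: cmeasurableM; first exact: (cmeasurable_comp measurable_snd mf).
by apply: cmeasurable_conj; exact: measurable_coherent.
Qed.

Lemma normc_transform_le f Y : L2 f -> normc (inner f (Psi Y)) <= L2norm f.
Proof.
move=> f2; have := cauchy_schwarz f2 (L2_coherent h0 Y).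
by rewrite L2norm_coherent mulr1.
Qed.

Let N := (pi * h) `^ (- (n%:R / 4)).

Let normc_coherent X u : normc (Psi X u) =
  N * expR (- (dotr (u - X.1) (u - X.1) / (2 * h))).
Proof.
rewrite /coherent Normc.normcM normc_expi mulr1 normc_real ger0_norm//.
by rewrite mulr_ge0 ?powR_ge0 ?expR_ge0.
Qed.

Let normc_coherent_le X u : normc (Psi X u) <= N.
Proof.
rewrite normc_coherent ler_piMr ?powR_ge0// -expR0 ler_expR oppr_le0.
by rewrite divr_ge0 ?dotr_ge0// mulr_ge0// ltW.
Qed.

Let gauss_shear (a : phase R n -> R) (c : R) : 0 < c ->
  lebp.-integrable setT (EFin \o a) ->
  (lebp \x leb)%E.-integrable setT (EFin \o (fun p : phase R n * 'rV[R]_n =>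
    a p.1 * expR (- (dotr (p.2 - p.1.1) (p.2 - p.1.1) / c)))).
Proof.
move=> c0 ai.
have sh : mpres (lebp \x leb)%E (fun p : phase R n * 'rV[R]_n => (p.1, p.2 - p.1.1)).
  apply: (@mpres_shear2 _ _ _ _ R lebp leb (fun X u => u - X.1)) => [|X].
    apply: measurable_fun_pair => //; apply: measurable_add_row => //.
    under eq_fun do rewrite -scaleN1r; apply: measurable_scale_row.
    exact: measurableT_comp measurable_fst measurable_fst.
  exact: mpres_row_shift.
exact: (mpres_integrable sh (integrable_tensor ai (gauss_integrable_row n c0))).
Qed.

(** The adjoint of the transform f |-> <f, Psi_Y>. *)
Definition superposition (a : phase R n -> R[i]) : fct :=
  fun u => cintegral lebp (fun Y => a Y * Psi Y u).

Section superposition.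
Variable a : phase R n -> R[i].
Hypothesis ai : cintegrable lebp a.

Let aPsi_integrable u : cintegrable lebp (fun Y => a Y * Psi Y u).
Proof.
apply: (@cintegrable_le _ _ _ _ _ (fun Y => N * normc (a Y))).
- apply: cmeasurableM; first exact: cintegrable_meas ai.
  exact: (cmeasurable_comp (pair2_measurable u) (measurable_coherent n h)).
- by move=> Y; rewrite Normc.normcM mulrC ler_wpM2r ?normc_ge0.
- exact: integrable_mulrl (cintegrable_normc ai).
Qed.

Let m_aPsi : cmeasurable (fun p : phase R n * 'rV[R]_n => a p.1 * Psi p.1 p.2).
Proof.
apply: cmeasurableM; last exact: measurable_coherent.
exact: (cmeasurable_comp measurable_fst (cintegrable_meas ai)).
Qed.

(** The modulus of the superposition is bounded, and it is also bounded by
    the integral of |a(Y)| against Gaussians in u. The product of the two bounds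
    is integrable in u, by Fubini's theorem. *)
Lemma L2_superposition : L2 (superposition a).
Proof.
have mv : cmeasurable (superposition a).
  apply: (@cmeasurable_cintegral _ _ 'rV[R]_n (phase R n) R lebp
    (fun p => a p.2 * Psi p.2 p.1)).
  exact: (cmeasurable_comp (measurable_fun_pair measurable_snd measurable_fst) m_aPsi).
have h20 : 0 < 2 * h by rewrite mulr_gt0.
have gi := gauss_shear h20 (cintegrable_normc ai).
have [Gi _] := Rfubini2 gi.
pose B := N * \int[lebp]_Y normc (a Y).
apply: (@L2_le _ _ _ (fun u => B * (N * \int[lebp]_Y
   (normc (a Y) * expR (- (dotr (u - Y.1) (u - Y.1) / (2 * h))))))) => //; last first.
  by do 2 apply: integrable_mulrl.
move=> u.
have nai := cintegrable_normc (aPsi_integrable u).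
have le1 : normc (superposition a u) <= B.
  rewrite (le_trans (normc_cintegral_le (aPsi_integrable u)))// /B.
  rewrite -RintegralZl//; last exact: cintegrable_normc.
  apply: le_Rintegral => //.
    exact: integrable_mulrl (cintegrable_normc ai).
  by move=> Y _; rewrite Normc.normcM mulrC ler_wpM2r ?normc_ge0.
have le2 : normc (superposition a u) <= N * \int[lebp]_Y
    (normc (a Y) * expR (- (dotr (u - Y.1) (u - Y.1) / (2 * h)))).
  rewrite (le_trans (normc_cintegral_le (aPsi_integrable u)))//.
  rewrite -RintegralZl//; last first.
    move: nai; under [X in _.-integrable _ X -> _]eq_fun do rewrite /= Normc.normcM normc_coherent mulrCA.
    move=> /(integrable_mulrl N^-1); congr (_.-integrable _ _).
    apply/funext => Y /=; rewrite mulKf// gt_eqF// powR_gt0 ?mulr_gt0 ?pi_gt0//.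
  by under eq_Rintegral do rewrite Normc.normcM normc_coherent mulrCA.
by rewrite expr2 ler_pM ?normc_ge0.
Qed.

Lemma inner_superposition f : L2 f -> inner f (superposition a) =
  cintegral lebp (fun Y => conjc (a Y) * inner f (Psi Y)).
Proof.
move=> f2; have [mf _] := f2.
pose F (p : phase R n * 'rV[R]_n) := f p.2 * conjc (a p.1 * Psi p.1 p.2).
have Fi : cintegrable (lebp \x leb)%E F.
  have g1 := integrable_tensor (cintegrable_normc ai) (L2_sq_integrable f2).
  have g2 := integrable_mulrl (N ^+ 2) (gauss_shear h0 (cintegrable_normc ai)).
  apply: (cintegrable_le _ _ (integrable_addr g1 g2)).
    apply: cmeasurableM; first exact: (cmeasurable_comp measurable_snd mf).
    exact: cmeasurable_conj.
  move=> [Y u] /=; rewrite Normc.normcM normc_conjc Normc.normcM.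
  have e : N ^+ 2 * (normc (a Y) * expR (- (dotr (u - Y.1) (u - Y.1) / h))) =
     normc (a Y) * normc (Psi Y u) ^+ 2.
    by rewrite normc_coherent_sq// mulrCA.
  rewrite e -mulrDr mulrCA ler_wpM2l ?normc_ge0//.
  have := sqr_ge0 (normc (f u) - normc (Psi Y u)).
  have := sqr_ge0 (normc (f u)); have := sqr_ge0 (normc (Psi Y u)); nra.
have [_ e1] := cfubini1 Fi; have [_ e2] := cfubini2 Fi.
transitivity (cintegral (lebp \x leb)%E F).
  rewrite -e2 /inner; apply: eq_cintegral => u.
  rewrite /superposition -cintegral_conj; last exact: aPsi_integrable.
  by rewrite -cintegralZ//; exact/cintegrable_conj/aPsi_integrable.
rewrite -e1; apply: eq_cintegral => Y; rewrite /inner -cintegralZ; last first.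
  exact: L2_mul_conj f2 (L2_coherent h0 Y).
by apply: eq_cintegral => u; rewrite /F conjcM mulrCA.
Qed.

End superposition.

Lemma gauss4_integrable :
  lebp.-integrable setT (EFin \o (fun X => expR (- (sqnorm_phase X / (4 * h))))) /\
  \int[lebp]_X expR (- (sqnorm_phase X / (4 * h))) = (pi * (4 * h)) ^+ n.
Proof.
have h40 : 0 < 4 * h by rewrite mulr_gt0.
split; first exact: gauss_integrable_phase.
by rewrite /Rintegral gauss_integral_phase.
Qed.

(** With v the superposition of the a(Y) = 1_K(Y) <f, Psi_Y>, the integral I of
    |a|^2 equals <f, v>, and <v, v> <= C I by the Schur test for the kernel
    |<Psi_Y, Psi_X>|; hence I <= C |f|^2 by the Cauchy-Schwarz inequality. The
    truncation to K makes a integrable and I finite, which allows the division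
    by I. *)
Lemma transform_bounded_on (K : set (phase R n)) f : L2 f ->
  measurable K -> (lebp K < +oo)%E ->
  (\int[lebp]_(Y in K) (normc (inner f (Psi Y)) ^+ 2)%:E <=
    ((pi * (4 * h)) ^+ n * L2norm f ^+ 2)%:E)%E.
Proof.
move=> f2 mK Koo.
pose a Y : R[i] := (\1_K Y)%:C%C * inner f (Psi Y).
have ma : cmeasurable a.
  by apply: cmeasurableM; [apply: cmeasurable_real; exact: measurable_indic|exact: cmeasurable_transform].
have Ki : lebp.-integrable setT (EFin \o (\1_K : phase R n -> R)).
  apply/integrableP; split; first exact/measurable_EFinP/measurable_indic.
  by under eq_integral do rewrite /= ger0_norm//; rewrite integral_indic ?setIT.
have na Y : normc (a Y) ^+ 2 = \1_K Y * normc (inner f (Psi Y)) ^+ 2.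
  rewrite Normc.normcM normc_real exprMn; congr (_ * _).
  by rewrite indicE; case: (_ \in _); rewrite ?normr1 ?normr0 ?expr1n ?expr0n.
have ai : cintegrable lebp a.
  apply: (@cintegrable_le _ _ _ _ _ (fun Y => L2norm f * \1_K Y)) => //.
    move=> Y; rewrite Normc.normcM normc_real mulrC ger0_norm//.
    by rewrite ler_wpM2r// normc_transform_le.
  exact: integrable_mulrl.
have a2i : lebp.-integrable setT (EFin \o (fun Y => normc (a Y) ^+ 2)).
  apply: (@integrable_le _ _ _ _ _ (fun Y => L2norm f ^+ 2 * \1_K Y)).
  - exact: measurable_normc_sq.
  - move=> Y; rewrite ger0_norm ?sqr_ge0// na mulrC ler_wpM2r//.
    by rewrite ler_pXn2r ?nnegrE ?normc_ge0 ?L2norm_ge0// normc_transform_le.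
  - exact: integrable_mulrl.
pose v := superposition a; have v2 : L2 v := L2_superposition ai.
rewrite integral_mkcond.
have -> : ((fun Y => (normc (inner f (Psi Y)) ^+ 2)%:E) \_ K =
    (fun Y => (normc (a Y) ^+ 2)%:E))%E.
  apply/funext => Y; rewrite na patchE indicE.
  by case: (_ \in _); rewrite ?mul1r ?mul0r.
rewrite -[leLHS]fineK ?(integrable_fin_num _ a2i)// lee_fin -/(Rintegral _ _ _).
set I := Rintegral _ _ _; set C := _ ^+ n.
have I0 : 0 <= I by apply: Rintegral_ge0 => Y _; exact: sqr_ge0.
have C0 : 0 <= C by rewrite exprn_ge0// mulr_ge0 ?pi_ge0// mulr_ge0// ltW.
have fv : inner f v = I%:C%C.
  rewrite inner_superposition// -cintegral_real; apply: eq_cintegral => Y.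
  rewrite /a; set w := inner f _; rewrite -mulc_conjc conjcM.
  have -> : conjc (\1_K Y)%:C%C = (\1_K Y)%:C%C :> R[i] by rewrite /conjc/= oppr0.
  rewrite indicE; case: (_ \in _); rewrite ?mul0r// !mul1r mulrC//.
have IC : I <= L2norm f * L2norm v.
  have := cauchy_schwarz f2 v2; rewrite fv normc_real ger0_norm//.
pose psi X := expR (- (sqnorm_phase X / (4 * h))).
have [psii psiE] := gauss4_integrable.
have mna : measurable_fun setT (fun Y => normc (a Y)) by exact: measurable_normc.
have vv : L2norm v ^+ 2 <= C * I.
  have [Si Sle] := schur_test psii mna mna (fun X => expR_ge0 _)
    (fun X => normc_ge0 _) (fun X => normc_ge0 _) a2i a2i.
  have [Fi FE] := Rfubini1 Si.
  rewrite -expr2 sqr_sqrtr// -/C psiE in Sle.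
  apply: le_trans Sle; rewrite -FE.
  have avi : cintegrable lebp (fun Y => conjc (a Y) * inner v (Psi Y)).
    apply: (@cintegrable_le _ _ _ _ _ (fun Y => L2norm v * normc (a Y))).
    - apply: cmeasurableM; first exact: cmeasurable_conj.
      exact: cmeasurable_transform.
    - move=> Y; rewrite Normc.normcM normc_conjc mulrC ler_wpM2r ?normc_ge0//.
      exact: normc_transform_le.
    - by apply: integrable_mulrl; exact: cintegrable_normc.
  have -> : L2norm v ^+ 2 = normc (inner v v).
    by rewrite inner_self normc_real ger0_norm ?sqr_ge0.
  rewrite {2}/v inner_superposition//.
  rewrite (le_trans (normc_cintegral_le avi))//.
  apply: le_Rintegral => //; first exact: cintegrable_normc.
  move=> Y _; rewrite Normc.normcM normc_conjc.
  have PY := L2_coherent h0 Y.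
  rewrite (inner_conj PY v2) normc_conjc {1}/v inner_superposition//.
  have bi : cintegrable lebp (fun X => conjc (a X) * inner (Psi Y) (Psi X)).
    apply: (@cintegrable_le _ _ _ _ _ (fun X => normc (a X))).
    - apply: cmeasurableM; first exact: cmeasurable_conj.
      exact: cmeasurable_transform.
    - move=> X; rewrite Normc.normcM normc_conjc ler_piMr ?normc_ge0//.
      by rewrite -(L2norm_coherent Y) normc_transform_le.
    - exact: cintegrable_normc.
  have nbi := cintegrable_normc bi.
  rewrite (le_trans (ler_wpM2l (normc_ge0 _) (normc_cintegral_le bi)))//.
  rewrite -RintegralZl//.
  rewrite le_eqVlt; apply/orP; left; apply/eqP; apply: eq_Rintegral => X _.
  rewrite (Normc.normcM (conjc (a X))) (normc_conjc (a X)) normc_inner_coherent.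
  rewrite /=; move: (normc (a X)) (normc (a Y)) (expR _) => p q r; ring.
have : I ^+ 2 <= (L2norm f ^+ 2 * C) * I.
  rewrite (le_trans (_ : _ <= (L2norm f * L2norm v) ^+ 2))//.
    by rewrite ler_pXn2r ?nnegrE ?mulr_ge0 ?L2norm_ge0.
  by rewrite exprMn -mulrA ler_wpM2l ?sqr_ge0.
have [->|In0] := eqVneq I 0; first by move=> _; rewrite mulr_ge0 ?sqr_ge0.
by rewrite expr2 ler_pM2r ?lt0r ?In0// mulrC.
Qed.

Lemma transform_bounded f : L2 f ->
  lebp.-integrable setT (EFin \o (fun Y => normc (inner f (Psi Y)) ^+ 2)) /\
  \int[lebp]_Y normc (inner f (Psi Y)) ^+ 2 <=
    (pi * (4 * h)) ^+ n * L2norm f ^+ 2.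
Proof.
move=> f2; set C := _ * _.
have mg : measurable_fun setT (fun Y => (normc (inner f (Psi Y)) ^+ 2)%:E).
  exact/measurable_EFinP/measurable_normc_sq/cmeasurable_transform.
have leC : (\int[lebp]_Y (normc (inner f (Psi Y)) ^+ 2)%:E <= C%:E)%E.
  have /sigma_finiteP[F [FT ndF Foo]] := sigma_finiteT lebp.
  have mF i : measurable (F i) by case: (Foo i).
  have := @ge0_nondecreasing_set_cvg_integral _ _ R F
    (fun Y => (normc (inner f (Psi Y)) ^+ 2)%:E) lebp ndF mF
    (fun i => measurable_funTS mg) (fun i Y _ => sqr_ge0 _).
  rewrite -FT => cv; rewrite -(cvg_lim _ cv)//; apply: lime_le.
    by apply/cvg_ex; eexists; exact: cv.
  by apply: nearW => i; have [mFi Fioo] := Foo i; exact: transform_bounded_on.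
have gi : lebp.-integrable setT (EFin \o (fun Y => normc (inner f (Psi Y)) ^+ 2)).
  apply/integrableP; split => //.
  under eq_integral do rewrite /= ger0_norm ?sqr_ge0//.
  exact: le_lt_trans leC (ltry _).
by split=> //; rewrite -lee_fin /Rintegral fineK// (integrable_fin_num _ gi).
Qed.

End coherent_transform.

(** * The operator defined by a sesqui-holomorphic kernel *)

Section sesquiholomorphic_operator.
Context {R : realType} (n : nat) (h : R).
Hypothesis h0 : 0 < h.
Local Notation P := (phase R n).
Local Notation fct := ('rV[R]_n -> R[i]).
Local Notation leb := (@lebesgue_row R n).
Local Notation lebp := (@lebesgue_phase R n).
Local Notation Psi := (@coherent R n h).
Implicit Types (f g k : fct) (X Y Z : P).

Variables (G : P -> P -> R[i]) (psi : P -> R).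
Hypothesis G_analytic : real_analytic2 G.
Hypothesis G_holo : sesquiholomorphic G.
Hypothesis psi_integrable : lebp.-integrable setT (EFin \o psi).
Hypothesis G_le : forall X Y,
  normc (G X Y) <= expR (sqnorm_phase (X - Y) / (4 * h)) * psi (X - Y).

(** The integrand of the weak integral that defines the operator. *)
Definition op_kernel f g (XY : P * P) : R[i] :=
  let: (X, Y) := XY in
  inner (coherent_proj h X (fun u => G Y X * coherent_proj h Y f u)) g.

Lemma op_kernelE f g X Y : L2 f -> L2 g -> op_kernel f g (X, Y) =
  G Y X * inner f (Psi Y) * (inner (Psi Y) (Psi X) * inner (Psi X) g).
Proof.
move=> f2 g2; have PX := L2_coherent h0 X; have PY := L2_coherent h0 Y.
rewrite /op_kernel /coherent_proj innerZ// innerZ; [|exact: L2Z|by []].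
by rewrite innerZ// !mulrA.
Qed.

(** A positive multiple of psi dominates a modulus. *)
Lemma bound_ge0 X : 0 <= psi X.
Proof.
have := G_le X 0; rewrite subr0 => /(le_trans (normc_ge0 _)).
by rewrite pmulr_rge0// expR_gt0.
Qed.

(** The Gaussian overlap of the coherent states cancels the growth of G. *)
Lemma normc_op_kernel_le f g (z : P * P) : L2 f -> L2 g ->
  normc (op_kernel f g z) <=
  psi (z.2 - z.1) * (normc (inner f (Psi z.2)) * normc (inner g (Psi z.1))).
Proof.
case: z => X Y f2 g2; rewrite op_kernelE// (inner_conj g2 (L2_coherent h0 X)).
change ((X, Y).2) with Y; change ((X, Y).1) with X.
have := normc_inner_coherent h0 Y X; move: (inner (Psi Y) (Psi X)) => r rE.
have := G_le Y X; rewrite -(opprB X Y) sqnorm_phaseN.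
move: (inner f _) (inner g _) (G Y X) (psi _) => p q u v Gle.
rewrite !Normc.normcM normc_conjc rE; set s := sqnorm_phase _ / _ in Gle *.
have pq0 : 0 <= normc p * normc q by rewrite mulr_ge0 ?normc_ge0.
have := ler_wpM2r (expR_ge0 (- s)) Gle.
rewrite mulrAC -expRD subrr expR0 mul1r => /(ler_wpM2r pq0).
by apply: le_trans; rewrite le_eqVlt; apply/orP; left; apply/eqP; ring.
Qed.

Lemma cmeasurable_op_kernel f g : L2 f -> L2 g -> cmeasurable (op_kernel f g).
Proof.
move=> f2 g2.
rewrite (_ : op_kernel f g = (fun z => G z.2 z.1 * inner f (Psi z.2) *
  (inner (Psi z.2) (Psi z.1) * inner (Psi z.1) g))); last first.
  by apply/funext => -[X Y]; rewrite op_kernelE.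
have m1 := @measurable_fst _ _ P P; have m2 := @measurable_snd _ _ P P.
apply: cmeasurableM; apply: cmeasurableM.
- exact: (cmeasurable_comp (measurable_fun_pair m2 m1) (analytic2_cmeasurable G_analytic)).
- exact: (cmeasurable_comp m2 (cmeasurable_transform h f2)).
- apply: (@cmeasurable_cintegral _ _ _ 'rV[R]_n R leb
    (fun p : (P * P) * 'rV[R]_n => Psi p.1.2 p.2 * conjc (Psi p.1.1 p.2))).
  have mp := @measurable_fst _ _ (P * P)%type 'rV[R]_n.
  have mr := @measurable_snd _ _ (P * P)%type 'rV[R]_n.
  apply: cmeasurableM; last apply: cmeasurable_conj.
    exact: (cmeasurable_comp (measurable_fun_pair (measurableT_comp m2 mp) mr)
      (measurable_coherent n h)).
  exact: (cmeasurable_comp (measurable_fun_pair (measurableT_comp m1 mp) mr)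
      (measurable_coherent n h)).
- under eq_fun => z do rewrite (inner_conj g2 (L2_coherent h0 z.1)).
  apply: cmeasurable_conj.
  exact: (cmeasurable_comp m1 (cmeasurable_transform h g2)).
Qed.

Let mu := (lebp \x lebp)%E.
Let Q := \int[lebp]_X psi X.
Let C := (pi * (4 * h)) ^+ n.

Let C_ge0 : 0 <= C.
Proof. by rewrite exprn_ge0// mulr_ge0 ?pi_ge0// mulr_ge0// ltW. Qed.

Let Q_ge0 : 0 <= Q.
Proof. by apply: Rintegral_ge0 => X _; exact: bound_ge0. Qed.

Let sqrt_transform_le f : L2 f ->
  Num.sqrt (\int[lebp]_Y normc (inner f (Psi Y)) ^+ 2) <= Num.sqrt C * L2norm f.
Proof.
move=> f2; have [_ le1] := transform_bounded h0 f2.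
have -> : Num.sqrt C * L2norm f = Num.sqrt (C * L2norm f ^+ 2).
  by rewrite sqrtrM// sqrtr_sqr ger0_norm ?L2norm_ge0.
exact: ler_wsqrtr.
Qed.

(** The Schur test for psi, with the transforms of f and g as L^2 functions. *)
Lemma op_kernel_bounded f g : L2 f -> L2 g ->
  cintegrable mu (op_kernel f g) /\
  normc (cintegral mu (op_kernel f g)) <= Q * C * L2norm f * L2norm g.
Proof.
move=> f2 g2.
have ma f' : L2 f' -> measurable_fun setT (fun Y => normc (inner f' (Psi Y))).
  by move=> f2'; exact/measurable_normc/cmeasurable_transform.
have [Si Sle] := schur_test psi_integrable (ma f f2) (ma g g2) bound_ge0
  (fun Y => normc_ge0 _) (fun Y => normc_ge0 _)
  (transform_bounded h0 f2).1 (transform_bounded h0 g2).1.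
have Ki : cintegrable mu (op_kernel f g).
  apply: cintegrable_le Si; first exact: cmeasurable_op_kernel.
  by move=> z; exact: normc_op_kernel_le.
split => //; rewrite (le_trans (normc_cintegral_le Ki))//.
apply: (@le_trans _ _ (Q * ((Num.sqrt C * L2norm f) * (Num.sqrt C * L2norm g)))).
  apply: (@le_trans _ _ (Q * (Num.sqrt (\int[lebp]_Y normc (inner f (Psi Y)) ^+ 2) *
      Num.sqrt (\int[lebp]_Y normc (inner g (Psi Y)) ^+ 2)))).
    apply: le_trans Sle; apply: le_Rintegral => //; first exact: cintegrable_normc.
    by move=> z _; exact: normc_op_kernel_le.
  by rewrite ler_wpM2l// ler_pM ?sqrtr_ge0// sqrt_transform_le.
rewrite mulrACA -expr2 sqr_sqrtr// !mulrA//.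
Qed.

Let c0 : R := (2 * pi * h) ^- (2 * n)%N.

Let c0_ge0 : 0 <= c0.
Proof. by rewrite invr_ge0 exprn_ge0// mulr_ge0 ?(ltW h0)// mulr_ge0 ?pi_ge0. Qed.

Let M := c0 * (Q * C).

Let M_ge0 : 0 <= M. Proof. by rewrite !mulr_ge0. Qed.

Let op_form f g : R[i] := c0%:C%C * cintegral mu (op_kernel f g).

Let op_form_le f g : L2 f -> L2 g ->
  normc (op_form f g) <= M * L2norm f * L2norm g.
Proof.
move=> f2 g2; have [_ le1] := op_kernel_bounded f2 g2.
rewrite Normc.normcM normc_real ger0_norm//.
by rewrite (le_trans (ler_wpM2l c0_ge0 le1))// /M !mulrA.
Qed.

Let op_formDr f g k : L2 f -> L2 g -> L2 k ->
  op_form f (fun u => g u + k u) = op_form f g + op_form f k.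
Proof.
move=> f2 g2 k2; rewrite /op_form -mulrDr -cintegralD;
  [|exact: (op_kernel_bounded f2 g2).1|exact: (op_kernel_bounded f2 k2).1].
congr (_ * _); apply: eq_cintegral => -[X Y]; rewrite !op_kernelE//; last exact: L2D.
by rewrite innerDr// ?mulrDr//; exact: L2_coherent.
Qed.

Let op_formZr f c g : L2 f -> L2 g ->
  op_form f (fun u => c * g u) = conjc c * op_form f g.
Proof.
move=> f2 g2; have Ki := (op_kernel_bounded f2 g2).1.
rewrite /op_form mulrCA -(cintegralZ (conjc c) Ki).
congr (_ * _); apply: eq_cintegral => -[X Y]; rewrite !op_kernelE//; last exact: L2Z.
rewrite innerZr//; last exact: L2_coherent.
by move: (conjc c) (G Y X) (inner _ _) (inner _ _) (inner _ _) => *; ring.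
Qed.

Let op_formZDl a f g k : L2 f -> L2 g -> L2 k ->
  op_form (fun u => a * f u + g u) k = a * op_form f k + op_form g k.
Proof.
move=> f2 g2 k2; have fi := (op_kernel_bounded f2 k2).1.
have gi := (op_kernel_bounded g2 k2).1.
rewrite /op_form (mulrCA a) -mulrDr -(cintegralZ a fi).
rewrite -(cintegralD (cintegrableZ a fi) gi).
congr (_ * _); apply: eq_cintegral => -[X Y].
have af2 := L2Z a f2; have s2 := L2D af2 g2.
rewrite !op_kernelE// innerD//; last exact: L2_coherent.
rewrite innerZ//; last exact: L2_coherent.
by move: (G Y X) (inner _ _) (inner _ k) (inner f _) (inner g _) => *; ring.
Qed.

Lemma op_kernel_ae f g k : L2 f -> L2 g -> L2 k -> f = g %[ae leb] ->
  op_kernel f k = op_kernel g k.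
Proof.
move=> f2 g2 k2 fg; apply/funext => -[X Y]; rewrite !op_kernelE//.
congr (_ * _ * _); apply: ae_eq_cintegral.
- exact: cintegrable_meas (L2_mul_conj f2 (L2_coherent h0 Y)).
- exact: cintegrable_meas (L2_mul_conj g2 (L2_coherent h0 Y)).
- by apply: filterS fg => u /= + _ => /(_ I) ->.
Qed.

Let op_form_ae f g k : L2 f -> L2 g -> L2 k -> f = g %[ae leb] ->
  op_form f k = op_form g k.
Proof.
move=> f2 g2 k2 fg; have := op_kernel_ae f2 g2 k2 fg.
by rewrite /op_form; move: (op_kernel f k) (op_kernel g k) => K1 K2 ->.
Qed.

(** For each f, the form is bounded and antilinear in g, hence represented by a
    vector A f; linearity and compatibility with equality almost everywhere
    come from the injectivity of the representation, and the norm bound from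
    testing against A f itself. *)
Lemma is_Op_exists : exists A, is_Op h G A.
Proof.
have /choice[A AP] : forall f, exists v : fct, L2 f ->
    L2 v /\ forall g, L2 g -> inner v g = op_form f g.
  move=> f; have [f2|nf2] := pselect (L2 f); last by exists f.
  have [v v2 vE] := @riesz R n (op_form f) (M * L2norm f)
    (mulr_ge0 M_ge0 (L2norm_ge0 f)) (fun g k => op_formDr f2)
    (fun c g => op_formZr c f2) (fun g => op_form_le f2).
  by exists v.
have A2 f (f2 : L2 f) : L2 (A f) := (AP f f2).1.
have AE f g (f2 : L2 f) (g2 : L2 g) : inner (A f) g = op_form f g := (AP f f2).2 g g2.
exists A; split; last first.
  by move=> f g f2 g2; split; [exact: (op_kernel_bounded f2 g2).1|exact: AE].
split => //.
- move=> f g f2 g2 fg; apply: inner_ae_inj; [exact: A2|exact: A2|].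
  move=> k k2; rewrite (AE f k f2 k2) (AE g k g2 k2).
  exact: op_form_ae f2 g2 k2 fg.
- move=> a f g f2 g2; have s2 := L2D (L2Z a f2) g2.
  have aA2 := L2Z a (A2 f f2).
  apply: inner_ae_inj; [exact: A2|exact: L2D aA2 (A2 g g2)|].
  move=> k k2; rewrite (innerD aA2 (A2 g g2) k2) (innerZ a (A2 f f2) k2).
  by rewrite (AE _ k s2 k2) (AE f k f2 k2) (AE g k g2 k2); exact: op_formZDl.
- exists M => f f2; have Af2 := A2 f f2.
  have := op_form_le f2 Af2; rewrite -(AE f (A f) f2 Af2) inner_self normc_real.
  rewrite ger0_norm ?sqr_ge0// expr2.
  have [->|A0] := eqVneq (L2norm (A f)) 0.
    by move=> _; rewrite mulr_ge0 ?L2norm_ge0.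
  by rewrite ler_pM2r// lt0r A0 L2norm_ge0.
Qed.

Lemma is_Op_unique (H : P -> P -> R[i]) A B : is_Op h H A -> is_Op h H B ->
  forall f, L2 f -> A f = B f %[ae leb].
Proof.
move=> [[A2 _ _ _] AE] [[B2 _ _ _] BE] f f2.
apply: inner_ae_inj; [exact: A2|exact: B2|] => k k2.
by have [_ ->] := AE f k f2 k2; have [_ ->] := BE f k f2 k2.
Qed.

(* 1 / (2 h) times the Hermitian product conj(X) Y on C^n. *)
Let s (X Y : P) : R[i] := ((dotr X.1 Y.1 + dotr X.2 Y.2) / (2 * h) +i*
  ((dotr X.1 Y.2 - dotr Y.1 X.2) / (2 * h)))%C.

(** The phases of the three overlaps depend on Z, but their sum does not; the
    cross term of |X - Y|^2 and this phase are the two parts of s. *)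
Lemma op_kernel_shift Z X Y : op_kernel (Psi Z) (Psi Z) (X + Z, Y + Z) =
  (expR (- (sqnorm_phase X / (2 * h))) * expR (- (sqnorm_phase Y / (2 * h))))%:C%C *
  (cexp (s X Y) * G (Z + Y) (Z + X)).
Proof.
have PZ := L2_coherent h0 Z.
rewrite op_kernelE// !inner_coherent// !(addrC Z).
set t1 := (_ - _) / _; set t2 := (_ - _) / _; set t3 := (_ - _) / _.
set p1 := - (_ / _); set p2 := - (_ / _); set p3 := - (_ / _).
transitivity (G (Y + Z) (X + Z) *
    ((expR (p1 + p2 + p3))%:C%C * expi (t1 + t2 + t3))).
  rewrite !expiD !expRD !realcM.
  move: (G _ _) (expi t1) (expi t2) (expi t3) => q e1 e2 e3.
  by move: ((expR p1)%:C)%C ((expR p2)%:C)%C ((expR p3)%:C)%C => *; ring.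
rewrite cexpE -expRD.
set q1 := - (_ / _); set q2 := - (_ / _); set r1 := (_ + _) / (2 * h).
set r2 := _ / (2 * h).
have hn0 : h != 0 by rewrite gt_eqF.
have -> : t1 + t2 + t3 = r2.
  rewrite /t1 /t2 /t3 /r2 /= !dotrE.
  rewrite ?(dotrC Z.1 X.2) ?(dotrC Z.1 Y.2) ?(dotrC Z.2 X.1) ?(dotrC Z.2 Y.1).
  by field.
have -> : p1 + p2 + p3 = q1 + q2 + r1.
  rewrite /p1 /p2 /p3 /q1 /q2 /r1 /sqnorm_phase /= !dotrE.
  rewrite ?(dotrC X.1 Z.1) ?(dotrC X.2 Z.2) ?(dotrC Y.1 Z.1) ?(dotrC Y.2 Z.2)
    ?(dotrC Y.1 X.1) ?(dotrC Y.2 X.2).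
  by field.
rewrite (expRD (q1 + q2)) realcM.
by move: (G _ _) (expi r2) ((expR _)%:C)%C ((expR _)%:C)%C => *; ring.
Qed.

(* The first variable is the antiholomorphic one: in the kernel, X is the second
   argument of G. *)
Let act (z : R[i]) (t : P * P) : P * P := (cact (conjc z) t.1, cact z t.2).

Let s_act z X Y : s (cact (conjc z) X) (cact z Y) = s X Y * (z * z).
Proof.
have hn0 : h != 0 by rewrite gt_eqF.
apply: complexP; rewrite /s ?ReM ?ImM /= ?ReM ?ImM Re_conjc Im_conjc !dotrE
  ?(dotrC Y.1 X.1) ?(dotrC Y.2 X.2) ?(dotrC Y.1 X.2) ?(dotrC Y.2 X.1); by field.
Qed.

Let pack_norm_le X Y : `|pack X Y| <= 1 + (sqnorm_phase X + sqnorm_phase Y).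
Proof.
have dotr_row m1 m2 (a b : 'rV[R]_m1) (c d : 'rV[R]_m2) :
    dotr (row_mx a c) (row_mx b d) = dotr a b + dotr c d.
  rewrite /dotr big_split_ord; congr (_ + _); apply: eq_bigr => j _.
    by rewrite !row_mxEl.
  by rewrite !row_mxEr.
have := row_norm_sq_le (pack X Y); rewrite {2 3}/pack !dotr_row -/(sqnorm_phase X).
rewrite -/(sqnorm_phase Y) => ple.
by have := sqr_ge0 (`|pack X Y| - 1); have := normr_ge0 (pack X Y); nra.
Qed.

Let sqnormD_le X Y : sqnorm_phase (X + Y) <= 2 * sqnorm_phase X + 2 * sqnorm_phase Y.
Proof.
have := sqnorm_phase_ge0 (X - Y).
by rewrite /sqnorm_phase /= !dotrE (dotrC Y.1 X.1) (dotrC Y.2 X.2); lra.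
Qed.

Lemma rotated_bounded Z M' : exists B, forall t z,
  sqnorm_phase t.1 + sqnorm_phase t.2 <= M' -> normc z = 1 ->
  normc (cexp (s t.1 t.2 * (z * z)) *
    G (Z + cact z t.2) (Z + cact (conjc z) t.1)) <= B.
Proof.
have [B0 B0P] := analytic2_bounded G_analytic (1 + (4 * sqnorm_phase Z + 2 * M')).
exists (expR (M' / (2 * h)) * B0) => -[X Y] z /= tM z1.
rewrite Normc.normcM ler_pM ?normc_ge0//.
  rewrite normc_cexp ler_expR -s_act.
  have hX : sqnorm_phase (cact (conjc z) X) = sqnorm_phase X.
    by rewrite sqnorm_cact normc_conjc z1 expr1n mul1r.
  have hY : sqnorm_phase (cact z Y) = sqnorm_phase Y.
    by rewrite sqnorm_cact z1 expr1n mul1r.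
  move: tM; rewrite -hX -hY; move: (cact _ X) (cact _ Y) => U V tM.
  rewrite /s [complex.Re _]/= ler_pM2r ?invr_gt0 ?mulr_gt0//; apply: le_trans tM.
  have := ler_norm (dotr U.1 V.1); have := ler_norm (dotr U.2 V.2).
  have := abs_dotr_le U.1 V.1; have := abs_dotr_le U.2 V.2.
  have := dotr_ge0 U.1; have := dotr_ge0 U.2; have := dotr_ge0 V.1.
  have := dotr_ge0 V.2; rewrite /sqnorm_phase; lra.
apply: B0P; rewrite (le_trans (pack_norm_le _ _))// lerD2l.
have := sqnormD_le Z (cact z Y); have := sqnormD_le Z (cact (conjc z) X).
by rewrite !sqnorm_cact normc_conjc z1 expr1n !mul1r; lra.
Qed.

(** After the translation by (Z, Z), the kernel satisfies the hypotheses of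
    [rotation_average], with the Gaussian as weight. *)
Lemma is_Op_diag A : is_Op h G A ->
  forall Z, inner (A (Psi Z)) (Psi Z) = G Z Z.
Proof.
move=> [_ AE] Z; have PZ := L2_coherent h0 Z.
have [Ki ->] := AE _ _ PZ PZ; rewrite -/(op_kernel _ _) in Ki *.
have sh := mpres_prod (mpres_phase_shift Z) (mpres_phase_shift Z).
have h20 : 0 < 2 * h by rewrite mulr_gt0.
pose e (X : P) := expR (- (sqnorm_phase X / (2 * h))).
have ei : lebp.-integrable setT (EFin \o e) := gauss_integrable_phase n h20.
rewrite -(mpres_cintegral sh Ki).
pose K (t : P * P) := op_kernel (Psi Z) (Psi Z) (t.1 + Z, t.2 + Z).
pose w (t : P * P) := e t.1 * e t.2.
pose g (t : P * P) z := cexp (s t.1 t.2 * (z * z)) *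
  G (Z + cact z t.2) (Z + cact (conjc z) t.1).
have -> : cintegral mu K = G Z Z * (\int[mu]_t w t)%:C%C.
  apply: (@rotation_average _ _ R mu act K w
    (fun t => sqnorm_phase t.1 + sqnorm_phase t.2) g).
  - exact: (mpres_cintegrable sh Ki).
  - exact: integrable_tensor.
  - by move=> t; rewrite mulr_ge0 ?expR_ge0.
  - apply: measurable_funD; apply: measurableT_comp => //; exact: measurable_sqnorm_phase.
  - move=> N N2; have := sin_root1_gt0 N2 => sN.
    have n1 : normc (root1 N : R[i]) = 1 by exact: normc_expi.
    have I0 : complex.Im (root1 N : R[i]) != 0 by apply: lt0r_neq0; exact: sN.
    apply: mpres_prod; apply: mpres_cact => //; first by rewrite normc_conjc.
    by rewrite Im_conjc oppr_eq0.
  - by move=> -[X Y]; rewrite /act conjc1 !cact1.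
  - by move=> z z' [X Y]; rewrite /act conjcM !cactM.
  - move=> z [X Y] z1 /=.
    by rewrite !sqnorm_cact normc_conjc z1 expr1n !mul1r.
  - move=> z [X Y] z1; rewrite /K op_kernel_shift /= s_act /w /e.
    by rewrite !sqnorm_cact normc_conjc z1 expr1n !mul1r.
  - move=> -[X Y] a; have [l2 H2] := sesquiholo_slice G_analytic G_holo Z X Y a.
    have idE (b : R[i]) : strict_cderiv (fun z => z) b 1.
      have := @strict_cderiv_affine R 1 0 b.
      by under eq_fun do rewrite mul1r addr0.
    have sq := strict_cderivM (idE a) (idE a).
    have [l1 H1] := strict_holo_cexp_linear (s X Y) (a * a).
    by eexists; apply: strict_cderivM H2; exact: (strict_cderiv_comp sq H1).
  - move=> -[X Y]; rewrite /g mul0r mulr0 cexp0 mul1r conjc0.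
    by rewrite /cact /= !scale0r subr0 addr0 addr0.
  - exact: rotated_bounded.
rewrite (Rintegral_tensor ei ei) mulrCA -realcM.
have -> : \int[lebp]_X e X = (2 * pi * h) ^+ n.
  by rewrite /Rintegral gauss_integral_phase//= mulrCA mulrA.
rewrite -exprD addnn -mul2n mulVf ?mulr1// expf_neq0//.
by rewrite !mulf_neq0 ?gt_eqF ?pi_gt0.
Qed.

End sesquiholomorphic_operator.

(** * The operator and its diagonal values *)

Theorem theorem2p10 (R : realType) (n : nat) (h : R) (h_gt0 : 0 < h)
    (F : phase R n -> R[i]) (nu : complex_measure (phase R n) R)
    (Fnu : forall X : phase R n, cm_integrable nu (fun T => F (X - T)))
    (Fnu_Dh : Dh h (convolution F nu))
    (Fnu_ext : phase R n -> phase R n -> R[i])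
    (Fnu_extP : Dh_extension h (convolution F nu) Fnu_ext) :
  [/\ exists A, is_Op h Fnu_ext A,
      forall A B, is_Op h Fnu_ext A -> is_Op h Fnu_ext B ->
        forall f, L2 f -> A f = B f %[ae @lebesgue_row R n] &
      forall A, is_Op h Fnu_ext A ->
        forall X : phase R n,
          inner (A (coherent h X)) (coherent h X) = convolution F nu X].

Proof.
have [G_analytic G_holo G_diag [psi [/Lfun1_integrable psii _ G_le]]] := Fnu_extP.
split.
- exact: (is_Op_exists h_gt0 G_analytic psii G_le).
- by move=> A B; exact: is_Op_unique.
- move=> A HA X; rewrite -(G_diag X).
  exact: (is_Op_diag h_gt0 G_analytic G_holo HA).
Qed.
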